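(* Let $m\ge1$, let $B=(B^1,\dots,B^m)$ be a boundary conditions operator on $\mathcal{H}^m$, let $(\tau_d)_{d\ge1}$ be a sequence of finite sampling grids $\tau_d=(t_l)_{l=1}^{|\tau_d|}$ in $[0,1]$ (points depending on $d$, in increasing order), and let $(\lambda_d)_{d\ge1}$ be a sequence of positive real numbers. Let $(X,Y)$ be a pair of random variables with $X$ taking values in $\mathcal{H}^m$ and $Y$ either taking values in $\{-1,1\}$ (binary classification case) or real valued (regression case), and let $(X_i,Y_i)_{i\ge1}$ be independent copies of $(X,Y)$. Assume: (A1) for every $d$, the points of $\tau_d$ are distinct, $|\tau_d|\ge m$, and $B^1,\dots,B^m$ are linearly independent from the $|\tau_d|$ linear forms $h\mapsto h(t_l)$ on $\mathcal{H}^m$; (A2) there is $R$ such that $\overline{\Delta}_{\tau_d}/\underline{\Delta}_{\tau_d}\le R$ for all $d$; (A3) $\lim_{d\to+\infty}|\tau_d|=+\infty$ and $\lim_{d\to+\infty}\lambda_d=0$; (A4) either (a) $\mathbb{E}(\|D^mX\|_{L^2}^2)$ is finite and $Y\in\{-1,1\}$ (binary classification case), or (b) $\tau_d\subset\tau_{d+1}$ for all $d$ and $\mathbb{E}(Y^2)$ is finite (binary classification or regression case). Let $\psi$ be any consistent multivariate classification (respectively regression) scheme, and let $\phi_{n,\tau_d}$ be the functional classifier (respectively regression function) obtained by applying $\psi$ to the transformed data $\mathcal{E}_{n,\tau_d}=\{(\mathbf{Q}_{\lambda_d,\tau_d}\mathbf{X}_i^{\tau_d},Y_i)\}_{1\le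 i\le n}$, i.e. $\phi_{n,\tau_d}(\mathbf{x})=\psi_{\mathcal{E}_{n,\tau_d}}(\mathbf{Q}_{\lambda_d,\tau_d}\mathbf{x})$ for $\mathbf{x}\in\mathbb{R}^{|\tau_d|}$. Then the family $(\phi_{n,\tau_d})_{n,d}$ is consistent: $$\lim_{d\to+\infty}\lim_{n\to+\infty}\mathbb{E}\left(L(\phi_{n,\tau_d})\right)=L^*.$$
   Context: $\mathcal{H}^m=\{h\in L^2([0,1]) : D^jh \text{ exists in the weak sense for } j=1,\dots,m \text{ and } D^mh\in L^2([0,1])\}$ is the Sobolev space on $[0,1]$, $D^jh=h^{(j)}$ being the $j$-th derivative (elements are identified with their continuous representatives). A boundary conditions operator is a full rank continuous linear operator $B=(B^j)_{j=1}^m:\mathcal{H}^m\to\mathbb{R}^m$ with $\mathrm{Ker}\,B\cap\mathbb{P}^{m-1}=\{0\}$, where $\mathbb{P}^{m-1}=\mathrm{Ker}\,D^m$ is the space of polynomial functions of degree at most $m-1$. Then $\mathcal{H}^m=\mathbb{P}^{m-1}\oplus\mathcal{H}^m_1$ with $\mathcal{H}^m_1=\mathrm{Ker}\,B$. On $\mathbb{P}^{m-1}$ one uses $\langle u,v\rangle_0=\sum_{j=1}^mB^ju\,B^jv$, on $\mathcal{H}^m_1$ one uses $\langle u,v\rangle_1=\int_0^1u^{(m)}(t)v^{(m)}(t)\,dt$, and $\mathcal{H}^m$ is equipped with the Hilbert space inner product $\langle u,v\rangle_{\mathcal{H}^m}=\int_0^1u^{(m)}(t)v^{(m)}(t)\,dt+\sum_{j=1}^mB^ju\,B^jv$.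 $k_1$ denotes the reproducing kernel of $(\mathcal{H}^m_1,\langle\cdot,\cdot\rangle_1)$. Grid quantities: $\overline{\Delta}_{\tau_d}=\max\{t_1,t_2-t_1,\dots,1-t_{|\tau_d|}\}$ and $\underline{\Delta}_{\tau_d}=\min_{1\le i<|\tau_d|}\{t_{i+1}-t_i\}$. Sampled functions: $\mathbf{X}^{\tau_d}=(X(t_1),\dots,X(t_{|\tau_d|}))^T$, and similarly $\mathbf{X}_i^{\tau_d}$. The matrix $\mathbf{Q}_{\lambda,\tau_d}$: for a vector $\mathbf{x}=(x(t))_{t\in\tau_d}^T\in\mathbb{R}^{|\tau_d|}$ and $\lambda>0$ let $\widehat{x}_{\lambda,\tau_d}$ be the smoothing spline, the unique solution of $$\arg\min_{h\in\mathcal{H}^m}\frac{1}{|\tau_d|}\sum_{l=1}^{|\tau_d|}(x(t_l)-h(t_l))^2+\lambda\int_{[0,1]}(h^{(m)}(t))^2\,dt .$$ $\mathbf{M}_{\lambda,\tau_d}$ is the symmetric positive definite $|\tau_d|\times|\tau_d|$ matrix such that $\langle\widehat{u}_{\lambda,\tau_d},\widehat{v}_{\lambda,\tau_d}\rangle_{\mathcal{H}^m}=\mathbf{u}^T\mathbf{M}_{\lambda,\tau_d}\mathbf{v}$ for all $\mathbf{u},\mathbf{v}\in\mathbb{R}^{|\tau_d|}$. Explicitly, $\mathbf{M}_{\lambda,\tau_d}=M_0^TWM_0+M_1^TK_1M_1$, where $\{\omega_1,\dots,\omega_m\}$ is a basis of $\mathbb{P}^{m-1}$, $W=(\langle\omega_i,\omega_j\rangle_0)_{i,j}$,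 $U=(\omega_i(t))_{i=1,\dots,m,\ t\in\tau_d}$, $K_1=(k_1(t,t'))_{t,t'\in\tau_d}$, $M_0=(U(K_1+|\tau_d|\lambda I)^{-1}U^T)^{-1}U(K_1+|\tau_d|\lambda I)^{-1}$ and $M_1=(K_1+|\tau_d|\lambda I)^{-1}(I-U^TM_0)$, with $I$ the $|\tau_d|\times|\tau_d|$ identity. $\mathbf{Q}_{\lambda,\tau_d}$ is the transpose of the Cholesky triangle of $\mathbf{M}_{\lambda,\tau_d}$, i.e. the upper triangular matrix with positive diagonal such that $\mathbf{Q}_{\lambda,\tau_d}^T\mathbf{Q}_{\lambda,\tau_d}=\mathbf{M}_{\lambda,\tau_d}$. Risks: in the binary classification case $L(\phi_{n,\tau_d})=\mathbb{P}(\phi_{n,\tau_d}(\mathbf{X}^{\tau_d})\ne Y)$ and $L^*=\inf_{\phi:\mathcal{H}^m\to\{-1,1\}}\mathbb{P}(\phi(X)\ne Y)$; in the regression case $L(\phi_{n,\tau_d})=\mathbb{E}([\phi_{n,\tau_d}(\mathbf{X}^{\tau_d})-Y]^2)$ and $L^*=\inf_{\phi:\mathcal{H}^m\to\mathbb{R}}\mathbb{E}([\phi(X)-Y]^2)$. Infima are over measurable $\phi$; in $L(\phi_{n,\tau_d})$ the pair $(X,Y)$ is independent of the learning sample and the probability/expectation is conditional on the learning sample $(X_i,Y_i)_{1\le i\le n}$, so that $\mathbb{E}(L(\phi_{n,\tau_d}))$ averages over the learning sample. A multivariate classification (resp. regression) scheme $\psi$ associates, for every $p\ge1$, to each finite dataset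 $\mathcal{D}=\{(U_i,T_i)\}_{1\le i\le n}$ in $\mathbb{R}^p\times\{-1,1\}$ (resp. $\mathbb{R}^p\times\mathbb{R}$) a function $\psi_{\mathcal{D}}:\mathbb{R}^p\to\{-1,1\}$ (resp. $\mathbb{R}^p\to\mathbb{R}$), measurably. It is consistent if for every $p$ and every pair $(U,T)$ with values in $\mathbb{R}^p\times\{-1,1\}$ (resp. in $\mathbb{R}^p\times\mathbb{R}$ with $\mathbb{E}(T^2)<\infty$), when $\mathcal{D}$ consists of $n$ independent copies of $(U,T)$, independent of $(U,T)$, one has $\lim_{n\to\infty}\mathbb{P}(\psi_{\mathcal{D}}(U)\ne T)=\inf_{\phi:\mathbb{R}^p\to\{-1,1\}}\mathbb{P}(\phi(U)\ne T)$ (resp. $\lim_{n\to\infty}\mathbb{E}([\psi_{\mathcal{D}}(U)-T]^2)=\inf_{\phi:\mathbb{R}^p\to\mathbb{R}}\mathbb{E}([\phi(U)-T]^2)$), infima over measurable $\phi$. *)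

(* Defs.v *)
From HB Require Import structures.
From mathcomp Require Import all_boot all_order all_algebra.
From mathcomp Require Import all_classical all_reals all_analysis.

Set Implicit Arguments.
Unset Strict Implicit.
Unset Printing Implicit Defensive.

Import Order.TTheory GRing.Theory Num.Theory.
Import numFieldNormedType.Exports.
Local Open Scope classical_set_scope.
Local Open Scope ring_scope.

(* A function h on [0, 1] is represented by a total function R -> R of which
   only the values on [0, 1] matter: all the predicates, norms and functionals
   below ignore the values outside [0, 1]. *)

Section Sobolev.
Context {R : realType}.
Local Notation mu := (@lebesgue_measure R).
Implicit Types (f g h u v : R -> R) (m j : nat).

Definition test_function (phi : R -> R) : Prop :=
  (forall k x, derivable (derive1n k phi) x 1) /\
  exists a b, [/\ 0 < a, b < 1 & forall x, ~ (a <= x <= b) -> phi x = 0].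

Definition is_weak_derivative j h g : Prop :=
  locally_integrable `]0, 1[ g /\
  forall phi, test_function phi ->
    \int[mu]_(x in `[0, 1]) (h x * derive1n j phi x) =
    (-1) ^+ j * \int[mu]_(x in `[0, 1]) (g x * phi x).

(* D^j h; it is determined up to a null set, and is the junk value 0 when h has
   no weak derivative of order j. *)
Definition wderiv j h : R -> R := xget (fun=> 0) [set g | is_weak_derivative j h g].

Definition square_integrable f : Prop :=
  measurable_fun (`[0, 1] : set R) f /\
  mu.-integrable `[0, 1] (fun x => (f x ^+ 2)%:E).

(* Elements of the Sobolev space are their continuous representatives. *)
Definition sobolev m : set (R -> R) := [set h : R -> R |
  [/\ {within `[0, 1], continuous h},
      square_integrable h,
      (forall j, (1 <= j <= m)%N -> exists g, is_weak_derivative j h g) &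
      square_integrable (wderiv m h)]].

Definition L2sqnorm f : R := \int[mu]_(x in `[0, 1]) (f x ^+ 2).

(* The usual Sobolev norm, which defines the topology for which a boundary
   conditions operator has to be continuous. *)
Definition sobolev_norm m h : R :=
  Num.sqrt (L2sqnorm h + \sum_(1 <= j < m.+1) L2sqnorm (wderiv j h)).

Record boundary_operator m (B : 'I_m -> (R -> R) -> R) : Prop := {
  boundary_linear : forall (a : R) u v, sobolev m u -> sobolev m v ->
    forall j : 'I_m, B j (fun x => a * u x + v x) = a * B j u + B j v;
  boundary_continuous : forall u, sobolev m u -> forall e : R, 0 < e ->
    exists2 r : R, 0 < r & forall v, sobolev m v -> sobolev_norm m (v \- u) < r ->
      forall j : 'I_m, `|B j v - B j u| < e;
  boundary_full_rank : forall y : 'I_m -> R,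
    exists2 h, sobolev m h & forall j : 'I_m, B j h = y j;
  boundary_ker_poly : forall p : {poly R}, (size p <= m)%N ->
    (forall j : 'I_m, B j (fun x => p.[x]) = 0) -> p = 0 }.

Definition sobolev_dot m (B : 'I_m -> (R -> R) -> R) u v : R :=
  \int[mu]_(x in `[0, 1]) (wderiv m u x * wderiv m v x) +
  \sum_(j < m) B j u * B j v.

Definition sobolev_open m (B : 'I_m -> (R -> R) -> R) : set (set (R -> R)) :=
  [set O | O `<=` sobolev m /\
    forall u, O u -> exists2 e : R, 0 < e & forall v, sobolev m v ->
      Num.sqrt (sobolev_dot B (v \- u) (v \- u)) < e -> O v].

(* R -> R with a sigma-algebra whose trace on the (measurable) set sobolev m is
   the Borel sigma-algebra of the Hilbert space. *)
Definition sobolev_borel m (B : 'I_m -> (R -> R) -> R) :=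
  g_sigma_algebraType (sobolev_open B).

End Sobolev.

Section Splines.
Context {R : realType}.
Local Notation mu := (@lebesgue_measure R).
Implicit Types (tau : seq R) (lam : R) (h : R -> R) (m : nat).

(* A grid is the sequence of its points t_1, ..., t_N; t_(l+1) is tau`_l. *)
Definition max_gap tau : R :=
  \big[Num.max/0]_(g <- pairmap (fun s t => t - s) 0 (rcons tau 1)) g.

(* The gaps of a grid in [0, 1] are at most 1, so that the default value 1 only
   matters for a grid with fewer than two points. *)
Definition min_gap tau : R :=
  \big[Num.min/1]_(i < (size tau).-1) (tau`_i.+1 - tau`_i).

Definition independent_of_evaluations m (B : 'I_m -> (R -> R) -> R) tau : Prop :=
  forall (a : 'I_m -> R) (b : 'I_(size tau) -> R),
    (forall h, sobolev m h ->
      \sum_(j < m) a j * B j h + \sum_(l < size tau) b l * h tau`_l = 0) ->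
    (forall j, a j = 0) /\ (forall l, b l = 0).

Definition sample tau h : (size tau).-tuple R := [tuple h tau`_l | l < size tau].

Definition spline_objective m tau lam (x : 'cV[R]_(size tau)) h : R :=
  (size tau)%:R^-1 * (\sum_(l < size tau) (x l 0 - h tau`_l) ^+ 2) +
  lam * L2sqnorm (wderiv m h).

Definition smoothing_spline m tau lam (x : 'cV[R]_(size tau)) : R -> R :=
  xget (fun=> 0) [set h | sobolev m h /\
    forall g, sobolev m g ->
      spline_objective m lam x h <= spline_objective m lam x g].

Definition spline_mx m (B : 'I_m -> (R -> R) -> R) tau lam : 'M[R]_(size tau) :=
  xget 0 [set M : 'M[R]_(size tau) |
    [/\ M^T = M,
        (forall u : 'cV[R]_(size tau), u != 0 -> 0 < (u^T *m M *m u) 0 0) &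
        forall u v : 'cV[R]_(size tau),
          sobolev_dot B (smoothing_spline m lam u) (smoothing_spline m lam v) =
          (u^T *m M *m v) 0 0]].

Definition cholesky_tr n (M : 'M[R]_n) : 'M[R]_n :=
  xget 0 [set Q : 'M[R]_n |
    [/\ is_trig_mx Q^T, (forall i, 0 < Q i i) & Q^T *m Q = M]].

Definition spline_cholesky m (B : 'I_m -> (R -> R) -> R) tau lam :
  'M[R]_(size tau) := cholesky_tr (spline_mx B tau lam).

Definition mulmx_tuple p (Q : 'M[R]_p) (x : p.-tuple R) : p.-tuple R :=
  [tuple (Q *m \col_j tnth x j) i 0 | i < p].

End Splines.

Section Independence.
Context {R : realType} d (T : measurableType d) (P : probability T R).
Context d' (E : measurableType d').

Definition mutually_independent (I : choiceType) (Z : I -> T -> E) : Prop :=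
  forall (s : seq I) (A : I -> set E), uniq s -> (forall i, measurable (A i)) ->
    P (\bigcap_(i in [set` s]) (Z i @^-1` A i)) =
    (\prod_(i <- s) P (Z i @^-1` A i))%E.

(* The Zs i have the law of Z, and Z, Zs 0, Zs 1, ... are independent. *)
Definition independent_copies (Z : T -> E) (Zs : nat -> T -> E) : Prop :=
  (forall i A, measurable A -> P (Zs i @^-1` A) = P (Z @^-1` A)) /\
  mutually_independent (fun o : option nat => if o is Some i then Zs i else Z).

End Independence.

Inductive learning_problem := Classification | Regression.

Section Learning.
Context {R : realType}.
Implicit Type c : learning_problem.

Definition labels c : set R :=
  if c is Classification then [set -1; 1] else setT.

Definition risk c d (T : measurableType d) (P : probability T R)
    (F Y : T -> R) : \bar R :=
  match c with
  | Classification => P [set w | F w <> Y w]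
  | Regression => 'E_P[fun w => (F w - Y w) ^+ 2]
  end.

(* X takes its values in the measurable set D; the values of phi outside D are
   irrelevant. *)
Definition optimal_risk c d (T : measurableType d) (P : probability T R)
    d' (E : measurableType d') (D : set E) (X : T -> E) (Y : T -> R) : \bar R :=
  ereal_inf [set risk c P (phi \o X) Y | phi in [set phi : E -> R |
    measurable_fun D phi /\ forall x, D x -> labels c (phi x)]].

(* psi p n D u is psi_D(u) for a dataset D of n pairs in R^p * R; R^p is
   p.-tuple R, with the product sigma-algebra. *)
Definition multivariate_scheme :=
  forall p n : nat, n.-tuple (p.-tuple R * R) -> p.-tuple R -> R.

Definition labelled_by p n (S : set R) (D : n.-tuple (p.-tuple R * R)) : Prop :=
  forall i, S (tnth D i).2.

Definition is_scheme c (psi : multivariate_scheme) : Prop :=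
  forall p n, (1 <= p)%N ->
    (forall D u, labelled_by (labels c) D -> labels c (psi p n D u)) /\
    measurable_fun
      [set z : n.-tuple (p.-tuple R * R) * p.-tuple R | labelled_by (labels c) z.1]
      (fun z => psi p n z.1 z.2).

Definition consistent_scheme c (psi : multivariate_scheme) : Prop :=
  forall p, (1 <= p)%N ->
  forall d (T : measurableType d) (P : probability T R)
    (U : {RV P >-> p.-tuple R}) (V : {RV P >-> R})
    (Us : nat -> {RV P >-> p.-tuple R}) (Vs : nat -> {RV P >-> R}),
    (forall w, labels c (V w)) -> (forall i w, labels c (Vs i w)) ->
    (c = Regression -> ('E_P[fun w => (V w ^+ 2)%R] < +oo)%E) ->
    independent_copies P (fun w => (U w, V w)) (fun i w => (Us i w, Vs i w)) ->
    risk c P (fun w => psi p n [tuple (Us i w, Vs i w) | i < n] (U w)) V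
      @[n --> \oo] --> optimal_risk c P setT U V.

Definition spline_rule (psi : multivariate_scheme) m (B : 'I_m -> (R -> R) -> R)
    (tau : seq R) (lam : R) n (D : n.-tuple ((R -> R) * R))
    (x : (size tau).-tuple R) : R :=
  let Q := spline_cholesky B tau lam in
  psi (size tau) n
    [tuple (mulmx_tuple Q (sample tau (tnth D i).1), (tnth D i).2) | i < n]
    (mulmx_tuple Q x).

(* The expectation, over the learning sample Xs, Ys, of the risk L(phi_(n, tau)).
   As (X, Y) is independent of the sample, the probability (or expectation)
   conditional on the sample is the one over w' at fixed w. *)
Definition expected_risk c (psi : multivariate_scheme)
    m (B : 'I_m -> (R -> R) -> R) (tau : seq R) (lam : R)
    d (T : measurableType d) (P : probability T R)
    (X : T -> (R -> R)) (Y : T -> R)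
    (Xs : nat -> T -> (R -> R)) (Ys : nat -> T -> R) (n : nat) : \bar R :=
  (\int[P]_w risk c P (fun w' => spline_rule psi B lam
     [tuple (Xs i w, Ys i w) | i < n] (sample tau (X w'))) Y)%E.

End Learning.

(* Main.v *)
Require Import Defs.
From HB Require Import structures.
From mathcomp Require Import all_boot all_order all_algebra.
From mathcomp Require Import all_classical all_reals all_analysis.
From mathcomp Require Import measurable_realfun ring lra zify.

Set Implicit Arguments.
Unset Strict Implicit.
Unset Printing Implicit Defensive.

Import Order.TTheory GRing.Theory Num.Theory.
Import numFieldNormedType.Exports.
Local Open Scope classical_set_scope.
Local Open Scope ring_scope.

(** The scheme psi only sees the vectors Q x, with x the samples of the functions
    and Q the Cholesky factor of the spline matrix. For a fixed grid this is a
    finite-dimensional problem: the pairs (Q X_i, Y_i) are independent copies of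
    (Q X, Y), the expectation of the conditional risk is the joint risk
    ([expected_conditional_risk], by Fubini), and consistency of psi gives the
    limit l_d, the optimal risk among the measurable functions of Q X
    ([expected_risk_cvg]). It remains to compare l_d with the optimal risk L* among
    the measurable functions of X.

    The inequality L* <= l_d holds because a function of Q X is a function of X.

    For the converse, Q is invertible ([spline_cholesky_unit]), so that l_d is also
    the optimal risk among the functions of the samples. Invertibility comes from an
    explicit form of the smoothing spline, whose coefficients solve a linear system:
    its norm only vanishes when the data vanish, by independence of B from the
    evaluations. Hence neither the limit of the smoothing parameters nor the
    convergence of the splines plays a role, and what matters is that the samples
    asymptotically determine X. Call an event known if it is, up to a small
    probability, an event about the samples on every fine enough grid. Known events
    form a sigma-algebra, and a square integrable known function is approached in
    mean square by functions of the samples ([known_L2]). As the gaps of the grids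
    tend to 0 and X is continuous, each evaluation X(t) is known. Now every event
    about X is known ([known_sobolev]), because the evaluations generate the Borel
    sets of H^m ([sobolev_measurable]): the derivatives of X are limits of
    difference quotients, so the coefficients of its Taylor polynomial at 0 and the
    averages of its m-th derivative over small cells are known. These numbers,
    rounded, define approximations of X with countably many values that converge to
    X in H^m, so that membership of X in an open set is a known event. Approximating
    a nearly optimal rule phi(X) in this way gives rules of the samples whose risk is
    nearly the same ([sampled_risk]): in classification the event phi(X) = 1 is
    approached in probability, and in regression phi(X), which is square integrable
    because Y is, is approached in mean square.

    The theory of H^m behind this rests on the representation of its elements as
    polynomials plus iterated integrals ([sobolevP]), a consequence of the
    du Bois-Reymond lemma. It gives the bounds that relate the norm attached to B
    to evaluations ([evaluation_bound]) and to Taylor data ([sobolev_dot_bound]). The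
    density of step functions in L2([0, 1]) is the case of [known_L2] where the
    observations are the positions of a uniform variable on finer and finer grids. *)

(** * Smooth cutoff functions *)

Section Smooth.
Context {R : realType}.
Implicit Types (f g : R -> R) (p : {poly R}) (a b x y : R).

(** Infinitely differentiable functions, in the form used by test functions. *)
Definition smooth f : Prop := forall k x, derivable (derive1n k f) x 1.

(** A set of functions that is stable under differentiation consists of smooth
    functions. *)
Lemma smooth_coind (S : set (R -> R)) :
  (forall f, S f -> exists2 f', S f' & forall x, is_derive x (1 : R) f (f' x)) ->
  S `<=` smooth.
Proof.
move=> SS f Sf k.
have : S (derive1n k f).
  elim: k => [//|k IH]; have [f' Sf' df] := SS _ IH.
  rewrite derive1nS (_ : derive1 _ = f')//; apply/funext => x.
  by rewrite derive1E; apply: derive_val.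
by move=> /SS[f' _ df] x; apply: (@ex_derive _ _ _ _ _ _ _ (df x)).
Qed.

Lemma smooth_derive1 f : smooth f -> smooth (derive1 f).
Proof. by move=> sf k x; rewrite -derive1Sn. Qed.

Lemma smooth_antiderivative f g : smooth g ->
  (forall x, is_derive x (1 : R) f (g x)) -> smooth f.
Proof.
move=> sg df [|k] x; first by apply: (@ex_derive _ _ _ _ _ _ _ (df x)).
rewrite derive1Sn (_ : derive1 f = g)//; apply/funext => y.
by rewrite derive1E; apply: derive_val.
Qed.

Lemma smooth_is_derive f k x : smooth f ->
  is_derive x (1 : R) (derive1n k f) (derive1n k.+1 f x).
Proof. by move=> /(_ k x) /derivableP; rewrite -derive1E. Qed.

Lemma smooth_continuous f k : smooth f -> continuous (derive1n k f).
Proof.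
by move=> sf x; apply/differentiable_continuous/derivable1_diffP/sf.
Qed.

(** e^y dominates every polynomial. *)
Lemma horner_expR_bound p k :
  exists2 C : R, 0 <= C & forall y, 0 <= y -> `|p.[y]| * y ^+ k <= C * expR y.
Proof.
have D k' : exists2 C : R, 0 <= C & forall y, 0 <= y -> y ^+ k' <= C * expR y.
  elim: k' => [|n [C C0 IH]].
    exists 1 => // y y0; rewrite expr0 mul1r.
    by have := @expR_ge1Dx R y; lra.
  exists (2 ^+ n.+1 * C); first by rewrite mulr_ge0// exprn_ge0.
  move=> y y0; have y20 : 0 <= y / 2 by lra.
  have := IH _ y20; have h := @expR_ge1Dx R (y/2).
  have -> : expR y = expR (y/2) * expR (y/2) by rewrite -expRD; congr expR; lra.
  move=> h1.
  have -> : y ^+ n.+1 = 2 ^+ n.+1 * ((y/2)^+n * (y/2)).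
    by rewrite -exprSr exprMn mulrCA exprVn mulfV ?mulr1// expf_neq0.
  rewrite -[leRHS]mulrA ler_wpM2l ?exprn_ge0// [leRHS]mulrA ler_pM ?exprn_ge0//; lra.
elim/poly_ind: p k => [|p c IH] k.
  by exists 0 => // y _; rewrite horner0 normr0 !mul0r.
have [C C0 hC] := IH k.+1; have [C' C'0 hC'] := D k.
exists (C + `|c| * C'); first by rewrite addr_ge0// mulr_ge0.
move=> y y0; rewrite !hornerE mulrDl.
apply: (@le_trans _ _ ((`|p.[y]| * y + `|c|) * y ^+ k)).
  rewrite ler_wpM2r ?exprn_ge0// (le_trans (ler_normD _ _))// normrM.
  by rewrite (ger0_norm y0).
rewrite mulrDl -mulrA -exprS lerD ?hC// -mulrA ler_wpM2l//; exact: hC'.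
Qed.

(** The function x |-> p(1 / x) e^(-1 / x) for x > 0, extended by 0; these
    functions are stable under differentiation. *)
Definition flat p x : R := if 0 < x then p.[x^-1] * expR (- x^-1) else 0.

Lemma flatE p x : 0 < x -> flat p x = p.[x^-1] * expR (- x^-1).
Proof. by rewrite /flat => ->. Qed.

Lemma flat_le0 p x : x <= 0 -> flat p x = 0.
Proof. by move=> x0; rewrite /flat ifF//; apply/negbTE; rewrite -leNgt. Qed.

Lemma flat_sq_bound p : exists2 C : R, 0 <= C &
  forall x, `|flat p x| <= C * x ^+ 2.
Proof.
have [C C0 hC] := horner_expR_bound p 2; exists C => // x.
have [x0|x0] := leP x 0.
  by rewrite flat_le0// normr0 mulr_ge0// sqr_ge0.
rewrite flatE// normrM (ger0_norm (expR_ge0 _)).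
have xV0 : 0 < x^-1 by rewrite invr_gt0.
have := hC _ (ltW xV0) => h.
rewrite expRN ler_pdivrMr ?expR_gt0// mulrAC -ler_pdivrMr ?exprn_gt0// -exprVn//.
Qed.

Lemma is_derive_flat p x :
  is_derive x (1 : R) (flat p) (flat ('X^2 * (p - p^`())) x).
Proof.
have [x0|x0|->] := ltgtP x 0.
- have e : \forall y \near x, cst 0 y = flat p y.
    near=> y; rewrite flat_le0//=.
    by near: y; apply: lt_le_nbhsl.
  apply: (near_eq_is_derive e).
  by rewrite flat_le0 ?ltW//; exact: is_derive_cst.
- have e : \forall y \near x, ((horner p \o GRing.inv) \* (expR \o (-%R \o GRing.inv))) y = flat p y.
    near=> y; rewrite /= flatE//.
    by near: y; apply: lt_nbhsr.
  apply: (near_eq_is_derive e).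
  have xn0 : id x != 0 by rewrite gt_eqF.
  have d1 : is_derive x (1 : R) GRing.inv (- x^-2).
    by have := is_deriveV xn0 (is_derive_id x (1 : R)); rewrite [_ *: _]mulr1.
  have d2 := is_derive1_comp (is_derive_poly p x^-1) d1.
  have d3 := is_derive1_comp (is_deriveNid (x^-1) (1 : R)) d1.
  have d4 : is_derive x (1 : R) (expR \o (-%R \o GRing.inv)) _ :=
    is_derive1_comp (is_derive_expR ((-%R \o GRing.inv) x)) d3.
  apply: (@is_derive_eq _ _ _ _ _ _ _ _ (is_deriveM d2 d4)).
  rewrite flatE// !hornerE /GRing.scale/= -exprVn; ring.
- have [C C0 hC] := flat_sq_bound p.
  rewrite flat_le0//; apply/is_derive1_caratheodory.
  exists (fun z => flat p z * z^-1); split; last by rewrite flat_le0// mul0r.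
    move=> z; rewrite (@flat_le0 _ 0)// !subr0.
    by have [->|z0] := eqVneq z 0; [rewrite flat_le0// mulr0|rewrite mulfVK].
  apply/cvgrPdist_le => e e0 /=; rewrite flat_le0// mul0r.
  have d0 : 0 < e / (C + 1) by rewrite divr_gt0//; lra.
  near=> z; rewrite sub0r normrN normrM normfV.
  have zd : `|z| <= e / (C + 1).
    by near: z; exact: (@nbhs0_le _ R).
  have [->|z0] := eqVneq z 0; first by rewrite normr0 invr0 mulr0 ltW.
  rewrite ler_pdivrMr ?normr_gt0// (le_trans (hC z))// -real_normK ?num_real// expr2 mulrA.
  rewrite ler_wpM2r// (@le_trans _ _ (C * (e / (C + 1)))) ?ler_wpM2l//.
  rewrite mulrA ler_pdivrMr; nra.
Unshelve. all: by end_near.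
Qed.

(** A class of smooth functions rich enough to contain cutoff functions. *)
Inductive elementary : (R -> R) -> Prop :=
| elementary_flat p s a : elementary (fun x => flat p (s * x + a))
| elementary_cst c : elementary (cst c)
| elementary_add f g : elementary f -> elementary g -> elementary (f \+ g)
| elementary_mul f g : elementary f -> elementary g -> elementary (f \* g)
| elementary_exp f : elementary f -> elementary (expR \o f).

Lemma elementary_smooth : elementary `<=` smooth.
Proof.
apply: smooth_coind => f; elim=> {f}.
- move=> p s a; exists (fun x => flat ('X^2 * (p - p^`())) (s * x + a) * s).
    apply: elementary_mul; first exact: elementary_flat.
    exact: elementary_cst.
  move=> x; have d : is_derive x (1 : R) (fun y => s * y + a) s.
    have := is_deriveD (is_deriveZ s (is_derive_id x (1:R))) (is_derive_cst a x (1:R)).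
    by rewrite addr0 [_ *: _]mulr1.
  by apply: is_derive1_comp d; exact: is_derive_flat.
- by move=> c; exists (cst 0) => [|x]; [exact: elementary_cst|exact: is_derive_cst].
- move=> f g ef [f' ef' df] eg [g' eg' dg]; exists (f' \+ g').
    exact: elementary_add.
  by move=> x; apply: is_deriveD.
- move=> f g ef [f' ef' df] eg [g' eg' dg]; exists ((f \* g') \+ (g \* f')).
    by apply: elementary_add; apply: elementary_mul.
  by move=> x; apply: is_deriveM.
- move=> f ef [f' ef' df]; exists ((expR \o f) \* f').
    by apply: elementary_mul => //; exact: elementary_exp.
  by move=> x; apply: is_derive1_comp.
Qed.

(** Smooth functions supported in [a, b] that increase to the indicator of
    ]a, b[. *)
Definition cutoff a b (n : nat) x : R :=
  1 - expR (- (n%:R * (flat 1 (x - a) * flat 1 (b - x)))).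

Lemma cutoff_smooth a b n : smooth (cutoff a b n).
Proof.
apply: elementary_smooth.
rewrite (_ : cutoff a b n = cst 1 \+ (cst (-1) \* (expR \o (cst (- n%:R) \*
  ((fun x => flat 1 (1 * x + - a)) \* (fun x => flat 1 ((-1) * x + b))))))).
  by repeat constructor.
apply/funext => x /=; rewrite /cutoff !mul1r !mulN1r; congr (1 - expR _).
by rewrite mulNr; congr (- (_ * (_ * flat _ _))); rewrite addrC.
Qed.

Lemma flat1_ge0 x : 0 <= flat 1 x.
Proof.
have [x0|x0] := leP x 0; first by rewrite flat_le0.
by rewrite flatE// hornerE mul1r expR_ge0.
Qed.

Lemma cutoff_out a b n x : ~~ (a < x < b) -> cutoff a b n x = 0.
Proof.
rewrite negb_and -!leNgt => h.
rewrite /cutoff (_ : flat 1 (x - a) * flat 1 (b - x) = 0) ?mulr0 ?oppr0 ?expR0 ?subrr//.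
by case/orP: h => h; [rewrite (@flat_le0 _ (x - a)) ?mul0r|rewrite (@flat_le0 _ (b - x)) ?mulr0]; rewrite ?subr_le0.
Qed.

Lemma cutoff_ge0_le1 a b n x : 0 <= cutoff a b n x <= 1.
Proof.
have h : 0 <= n%:R * (flat 1 (x - a) * flat 1 (b - x)) :> R.
  by rewrite !mulr_ge0 ?flat1_ge0.
rewrite /cutoff subr_ge0 gerBl expR_ge0 andbT.
by rewrite -[leRHS]expR0 ler_expR oppr_le0.
Qed.

Lemma cutoff_cvg a b x : cutoff a b n x @[n --> \oo] --> (\1_(`]a, b[) x : R).
Proof.
rewrite indicE; case: (boolP (a < x < b)) => h; last first.
  rewrite memNset/=; last by rewrite in_itv/=; exact/negP.
  by under eq_fun do rewrite cutoff_out//; exact: cvg_cst.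
rewrite mem_set/= ?in_itv//=; move/andP: h => [ax xb].
set c := flat 1 (x - a) * flat 1 (b - x).
have c0 : 0 < c.
  by rewrite mulr_gt0// flatE ?subr_gt0// hornerE mul1r expR_gt0.
rewrite -[X in _ --> X]subr0; apply: cvgB; first exact: cvg_cst.
rewrite (_ : (fun n => _) = (fun n => (expR (- c)) ^+ n)).
  by apply: cvg_expr; rewrite ger0_norm ?expR_ge0// -[ltRHS]expR0 ltr_expR oppr_lt0.
by apply/funext => n; rewrite -expRM_natl mulrN.
Qed.

Lemma cutoff_test a b n : 0 < a -> b < 1 -> test_function (cutoff a b n).
Proof.
move=> a0 b1; split; first exact: cutoff_smooth.
exists a, b; split => // x /negP h; apply: cutoff_out; apply: contra h.
by move=> /andP[/ltW -> /ltW ->].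
Qed.

Lemma smooth_measurable f k (D : set R) : measurable D -> smooth f ->
  measurable_fun D (derive1n k f).
Proof.
move=> mD /(smooth_continuous (k := k))/continuous_measurable_fun.
exact: measurable_funTS.
Qed.

End Smooth.

(** * Real integrals and the fundamental lemma of the calculus of variations *)

Section RealIntegral.
Context d (T : measurableType d) (R : realType) (mu : {measure set T -> \bar R}).

Lemma Rintegral_dominated (D : set T) (f_ : nat -> T -> R) (f g : T -> R) :
  measurable D -> (forall n, measurable_fun D (f_ n)) -> measurable_fun D f ->
  (forall x, D x -> f_ n x @[n --> \oo] --> f x) ->
  mu.-integrable D (EFin \o g) ->
  (forall n x, D x -> `|f_ n x| <= g x) ->
  \int[mu]_(x in D) f_ n x @[n --> \oo] --> \int[mu]_(x in D) f x.
Proof.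
move=> mD mf_ mf cf ig lg.
have [|||||intf _ c] := @dominated_convergence _ _ _ mu D mD
  (fun n x => (f_ n x)%:E) (EFin \o f) (EFin \o g).
- by move=> n; exact/measurable_EFinP.
- exact/measurable_EFinP.
- by apply/aeW => x Dx; apply/fine_cvgP; split; [exact: nearW|exact: cf].
- exact: ig.
- by apply/aeW => x n Dx; rewrite lee_fin lg.
move: c; rewrite -[X in _ --> X](fineK (integrable_fin_num mD intf)).
by move/fine_cvgP => [].
Qed.

(** Two integrals agree as soon as the integrands extended by 0 do. *)
Lemma Rintegral_restrict (D E : set T) (f g : T -> R) :
  (forall x, (f \_ D) x = (g \_ E) x) ->
  \int[mu]_(x in D) f x = \int[mu]_(x in E) g x.
Proof.
move=> h; rewrite Rintegral_mkcond [RHS]Rintegral_mkcond.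
by apply: eq_Rintegral => x _.
Qed.

End RealIntegral.

Section FundamentalLemma.
Context {R : realType}.
Local Notation mu := (@lebesgue_measure R).
Implicit Types (f g : R -> R) (a b x y : R).

Lemma locally_integrable_itv g a b : locally_integrable `]0, 1[ g ->
  0 < a -> b < 1 -> mu.-integrable `[a, b] (EFin \o g).
Proof.
move=> [mg _ ig] a0 b1.
have s : `[a, b] `<=` (`]0, 1[ : set R).
  by move=> x /=; rewrite !in_itv/= => /andP[ax xb]; apply/andP; split; lra.
apply/integrableP; split.
  by apply/measurable_EFinP; apply: measurable_funS mg.
by apply: ig => //; exact: segment_compact.
Qed.

Lemma cutoff_integral_cvg g a b : locally_integrable `]0, 1[ g ->
  0 < a -> b < 1 ->
  \int[mu]_(x in `[0, 1]) (g x * cutoff a b n x) @[n --> \oo] -->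
  \int[mu]_(x in `]a, b[) g x.
Proof.
move=> lg a0 b1.
have ig : mu.-integrable `]a, b[ (EFin \o g).
  apply: (integrableS _ _ _ (locally_integrable_itv lg a0 b1)) => //.
  by apply: subset_itv; rewrite bnd_simp.
have mg : measurable_fun `]a, b[ g by apply/measurable_EFinP; exact: (measurable_int mu).
rewrite (_ : (fun n => _) = (fun n => \int[mu]_(x in `]a, b[) (g x * cutoff a b n x))).
  apply: (@Rintegral_dominated _ _ _ mu _ _ _ (fun x => `|g x|)) => //.
  - move=> n; apply: measurable_funM => //.
    by apply: (@smooth_measurable _ _ 0) => //; exact: cutoff_smooth.
  - move=> x xab; rewrite -[X in _ --> X]mulr1.
    apply: cvgM; first exact: cvg_cst.
    rewrite [X in _ --> X](_ : 1 = \1_(`]a, b[) x); first exact: cutoff_cvg.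
    by rewrite indicE mem_set.
  - exact: integrable_norm.
  - move=> n x _; rewrite normrM ler_piMr//.
    by have /andP[h0 h1] := cutoff_ge0_le1 a b n x; rewrite ger0_norm.
apply/funext => n; apply: Rintegral_restrict => x; rewrite !patchE.
have [xab|xab] := boolP (a < x < b).
  rewrite !mem_set//= in_itv//=; move: xab => /andP[ax xb]; apply/andP; split; lra.
rewrite [x \in `]a, b[%classic]memNset/=; last by rewrite in_itv/=; exact/negP.
by rewrite cutoff_out// mulr0; case: ifP.
Qed.

(** A locally integrable function with null integrals over the intervals
    ]a, b[ vanishes almost everywhere, by differentiation of its integral. *)
Lemma integral0_ae0 g : locally_integrable `]0, 1[ g ->
  (forall a b, 0 < a -> b < 1 -> \int[mu]_(x in `]a, b[) g x = 0) ->
  {ae mu, forall x, x \in `]0, 1[ -> g x = 0}.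
Proof.
move=> lg g0.
pose a n : R := n.+3%:R^-1.
have a0 n : 0 < a n by rewrite invr_gt0.
have H n : {ae mu, forall x, a n < x < 1 - a n -> g x = 0}.
  pose D := `[a n, 1 - a n]%classic : set R.
  have mD : measurable D by exact: measurable_itv.
  have b1 : 1 - a n < 1 by rewrite gtrBl.
  have ig := locally_integrable_itv lg (a0 n) b1.
  have iD : mu.-integrable setT (EFin \o (g \_ D)).
    rewrite (_ : _ \o _ = (EFin \o g) \_ D).
      by apply/(integrable_mkcond _ _).1.
    by apply/funext => x; rewrite /= !patchE; case: ifP.
  have := @FTC1 R (g \_ D) (BLeft (a n)) _ _.
  case=> [y||].
  - exact: integrableS iD.
  - by apply: open_integrable_locally => //; exact: openT.
  move=> N [mN N0 sN]; exists N; split => // x /= /not_implyP[/andP[ax xb] gx].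
  apply: sN => /= h.
  have [|_] := h; first by rewrite lte_fin.
  rewrite /D patchE mem_set/=; last by rewrite in_itv/= !ltW.
  move=> e; apply: gx; rewrite -e derive1E.
  rewrite (near_eq_derive (f := fun=> _) (g := cst 0) (a := x)) ?derive_cst//.
  near=> y => /=.
  have ay : a n < y by near: y; exact: lt_nbhsr.
  have yb : y < 1 - a n by near: y; exact: lt_nbhsl.
  rewrite (@Rintegral_restrict _ _ _ mu `[a n, y] `[a n, y] _ g); last first.
    move=> z; rewrite !patchE; case: ifPn => // /set_mem/= /[!in_itv]/= /andP[az zy].
    by rewrite mem_set//= in_itv/= az/= (le_trans zy)// ltW.
  have ig' : mu.-integrable `[a n, y] (EFin \o g).
    by apply: integrableS ig => //; apply: subset_itv; rewrite bnd_simp// ltW.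
  rewrite -Rintegral_itv_obnd_cbnd; last first.
    by apply: integrableS ig' => //; apply: subset_itv; rewrite bnd_simp.
  rewrite -Rintegral_itv_bndo_bndc; last first.
    by apply: integrableS ig' => //; apply: subset_itv; rewrite bnd_simp.
  by apply: g0 => //; apply: lt_trans b1.
have := ae_foralln H; apply: filterS => x h; rewrite in_itv/= => /andP[x0 x1].
have [n hn] : exists n, a n < Num.min x (1 - x).
  have m0 : 0 < Num.min x (1 - x) by rewrite lt_min x0 subr_gt0.
  have := near_infty_natSinv_lt (PosNum m0) => -[N _ /(_ N (leqnn N))/= hN].
  exists N; apply: le_lt_trans hN; rewrite /a lef_pV2 ?posrE// ler_nat; lia.
by apply: (h n); move: hn; rewrite lt_min => /andP[? ?]; apply/andP; split; lra.
Unshelve. all: by end_near.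
Qed.

(** The fundamental lemma of the calculus of variations. *)
Lemma fundamental_lemma g : locally_integrable `]0, 1[ g ->
  (forall phi, test_function phi -> \int[mu]_(x in `[0, 1]) (g x * phi x) = 0) ->
  {ae mu, forall x, x \in `]0, 1[ -> g x = 0}.
Proof.
move=> lg h; apply: integral0_ae0 => // a b a0 b1.
have := cutoff_integral_cvg lg a0 b1.
under eq_fun => n do rewrite (h _ (cutoff_test n a0 b1)).
by move/(cvg_unique _ (cvg_cst _)) => ->.
Qed.

End FundamentalLemma.

(** * Square integrable functions on the unit interval *)

Section AlmostEverywhere.
Context d (T : measurableType d) (R : realType) (mu : {measure set T -> \bar R}).
Implicit Types p q r : T -> Prop.

Lemma ae_imp p q : (forall x, p x -> q x) ->
  {ae mu, forall x, p x} -> {ae mu, forall x, q x}.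
Proof. by move=> pq; apply: filterS => x; exact: pq. Qed.

Lemma ae_imp2 p q r : (forall x, p x -> q x -> r x) ->
  {ae mu, forall x, p x} -> {ae mu, forall x, q x} -> {ae mu, forall x, r x}.
Proof. by move=> pqr; apply: filterS2 => x; exact: pqr. Qed.

End AlmostEverywhere.

Section RealIntegrable.
Context d (T : measurableType d) (R : realType) (mu : {measure set T -> \bar R}).
Variables (D : set T) (mD : measurable D).
Implicit Types (f g : T -> R) (a : R).

Lemma integrable_lin a f g : mu.-integrable D (EFin \o f) ->
  mu.-integrable D (EFin \o g) ->
  mu.-integrable D (EFin \o (fun x => a * f x + g x)).
Proof.
move=> fi gi; have := integrableD mD (integrableZl mD a fi) gi.
by apply: eq_integrable => // x _ /=; rewrite EFinD EFinM.
Qed.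

Lemma le_integrableR f g : measurable_fun D f ->
  (forall x, D x -> `|f x| <= g x) -> mu.-integrable D (EFin \o g) ->
  mu.-integrable D (EFin \o f).
Proof.
move=> mf fg; apply: le_integrable => //; first exact/measurable_EFinP.
by move=> x Dx /=; rewrite lee_fin (le_trans (fg _ Dx))// ler_norm.
Qed.

Lemma eq_integrableR f g : (forall x, D x -> f x = g x) ->
  mu.-integrable D (EFin \o f) -> mu.-integrable D (EFin \o g).
Proof.
by move=> fg; apply: eq_integrable => // x /set_mem Dx /=; rewrite fg.
Qed.

Lemma integrable_scale a f : mu.-integrable D (EFin \o f) ->
  mu.-integrable D (EFin \o (fun x => a * f x)).
Proof.
by move=> fi; have := integrableZl mD a fi; apply: eq_integrable => // x _ /=; rewrite EFinM.
Qed.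

Lemma Rintegral_lin a f g : mu.-integrable D (EFin \o f) ->
  mu.-integrable D (EFin \o g) ->
  \int[mu]_(x in D) (a * f x + g x) =
  a * \int[mu]_(x in D) f x + \int[mu]_(x in D) g x.
Proof.
by move=> fi gi; rewrite RintegralD ?RintegralZl//; exact: integrable_scale.
Qed.

End RealIntegrable.

Section L2.
Context {R : realType}.
Local Notation mu := (@lebesgue_measure R).
Local Notation I01 := (`[0, 1]%classic : set R).
Implicit Types (f g h : R -> R) (a b t x y : R).

Lemma measurable_I01 : measurable (I01 : set (measurableTypeR R)).
Proof. exact: measurable_itv. Qed.
Hint Resolve measurable_I01 : core.

Lemma bounded_square_integrable f M : measurable_fun I01 f ->
  (forall x, 0 <= x <= 1 -> `|f x| <= M) -> square_integrable f.
Proof.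
move=> mf fM; split => //.
apply: (@measurable_bounded_integrable _ (measurableTypeR R) R mu (fun x => f x ^+ 2)) => //.
- by rewrite /= lebesgue_measure_itv/= lte_fin ltr01 sube0 ltry.
- exact: measurable_funX.
- exists (M ^+ 2); split; first exact: num_real.
  move=> y My x /= /[!in_itv]/= x01; rewrite ger0_norm ?sqr_ge0//.
  rewrite (le_trans _ (ltW My))// -[leLHS]real_normK ?num_real//.
  by rewrite ler_pXn2r// ?nnegrE ?(le_trans (normr_ge0 _) (fM x x01))// fM.
Qed.

Lemma square_integrableM f g : square_integrable f -> square_integrable g ->
  mu.-integrable I01 (EFin \o (fun x => f x * g x)).
Proof.
move=> [mf if2] [mg ig2].
apply: (@le_integrableR _ (measurableTypeR R) R mu _ _ _ (fun x => 1 * f x ^+ 2 + g x ^+ 2)) => //.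
- exact: measurable_funM.
- move=> x _ /=; rewrite normrM mul1r.
  rewrite -(real_normK (num_real (f x))) -(real_normK (num_real (g x))).
  have := sqr_ge0 (`|f x| - `|g x|); have := sqr_ge0 (`|f x| + `|g x|); nra.
- exact: (@integrable_lin _ (measurableTypeR R)).
Qed.

Lemma square_integrable_cst a : square_integrable (cst a : R -> R).
Proof.
by apply: (bounded_square_integrable (M := `|a|)) => //; exact: measurable_cst.
Qed.

Lemma square_integrable_integrable f : square_integrable f ->
  mu.-integrable I01 (EFin \o f).
Proof.
move=> sf; have := square_integrableM sf (square_integrable_cst 1).
by apply: eq_integrable => // x _ /=; rewrite mulr1.
Qed.

Lemma square_integrable_lin a f g : square_integrable f -> square_integrable g ->
  square_integrable (fun x => a * f x + g x).
Proof.
move=> sf sg; have [mf if2] := sf; have [mg ig2] := sg; split.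
  by apply: measurable_funD => //; apply: measurable_funM => //; exact: measurable_cst.
have ifg := square_integrableM sf sg.
apply: (@eq_integrableR _ (measurableTypeR R) _ _ _ _ (fun x => a ^+ 2 * f x ^+ 2 +
  (2 * a * (f x * g x) + g x ^+ 2))) => //; first by move=> x _ /=; ring.
by do 2 apply: (@integrable_lin _ (measurableTypeR R)) => //.
Qed.

Lemma square_integrableD f g : square_integrable f -> square_integrable g ->
  square_integrable (fun x => f x + g x).
Proof.
move=> sf sg; rewrite (_ : (fun x => _) = (fun x => 1 * f x + g x)).
  exact: square_integrable_lin.
by apply/funext => x; rewrite mul1r.
Qed.

Lemma square_integrableZ a f : square_integrable f ->
  square_integrable (fun x => a * f x).
Proof.
move=> sf; rewrite (_ : (fun x => _) = (fun x => a * f x + cst 0 x)).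
  by apply: square_integrable_lin => //; exact: square_integrable_cst.
by apply/funext => x; rewrite addr0.
Qed.

Lemma square_integrableB f g : square_integrable f -> square_integrable g ->
  square_integrable (fun x => f x - g x).
Proof.
move=> sf sg; rewrite (_ : (fun x => _) = (fun x => -1 * g x + f x)).
  exact: square_integrable_lin.
by apply/funext => x; rewrite mulN1r addrC.
Qed.

Lemma square_integrable_sum n (c : 'I_n -> R) (F : 'I_n -> R -> R) :
  (forall i, square_integrable (F i)) ->
  square_integrable (fun x => \sum_(i < n) c i * F i x).
Proof.
elim: n c F => [|n IH] c F sF.
  under eq_fun do rewrite big_ord0; exact: square_integrable_cst.
under eq_fun do rewrite big_ord_recl; apply: square_integrable_lin => //.
exact: IH.
Qed.

(** The inner product of L2([0, 1]), on functions that are not identified modulo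
    null sets. *)
Definition dot f g : R := \int[mu]_(x in `[0, 1]) (f x * g x).

Lemma L2sqnormE f : L2sqnorm f = dot f f.
Proof. by apply: eq_Rintegral => x _; rewrite expr2. Qed.

Lemma dotC f g : dot f g = dot g f.
Proof. by apply: eq_Rintegral => x _; rewrite mulrC. Qed.

Lemma dot_linl a f g h : square_integrable f -> square_integrable g ->
  square_integrable h -> dot (fun x => a * f x + g x) h = a * dot f h + dot g h.
Proof.
move=> sf sg sh; rewrite /dot -RintegralZl//; last exact: square_integrableM.
rewrite -RintegralD//; first by apply: eq_Rintegral => x _; ring.
- have := square_integrableM (square_integrableZ a sf) sh.
  by apply: eq_integrable => // x _ /=; rewrite mulrA.
- exact: square_integrableM.
Qed.

Lemma dot_linr a f g h : square_integrable f -> square_integrable g ->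
  square_integrable h -> dot h (fun x => a * f x + g x) = a * dot h f + dot h g.
Proof. by move=> sf sg sh; rewrite dotC dot_linl// !(dotC h). Qed.

Lemma dot0l f : dot (cst 0) f = 0.
Proof.
rewrite /dot; under eq_Rintegral do rewrite mul0r.
by rewrite Rintegral_cst// mul0r.
Qed.

Lemma dot_suml n (c : 'I_n -> R) (F : 'I_n -> R -> R) h :
  (forall i, square_integrable (F i)) -> square_integrable h ->
  dot (fun x => \sum_(i < n) c i * F i x) h = \sum_(i < n) c i * dot (F i) h.
Proof.
move=> + sh; elim: n c F => [|n IH] c F sF.
  by under eq_fun do rewrite big_ord0; rewrite big_ord0 dot0l.
under eq_fun do rewrite big_ord_recl; rewrite big_ord_recl -IH//.
by apply: dot_linl => //; exact: square_integrable_sum.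
Qed.

Lemma dot_ge0 f : 0 <= dot f f.
Proof. by apply: Rintegral_ge0 => x _; rewrite -expr2 sqr_ge0. Qed.

Lemma L2sqnorm_ge0 f : 0 <= L2sqnorm f.
Proof. by rewrite L2sqnormE dot_ge0. Qed.

Lemma cauchy_schwarz f g : square_integrable f -> square_integrable g ->
  dot f g ^+ 2 <= L2sqnorm f * L2sqnorm g.
Proof.
move=> sf sg; rewrite !L2sqnormE.
have H t : 0 <= t ^+ 2 * dot f f + 2 * t * dot f g + dot g g.
  have := dot_ge0 (fun x => t * f x + g x).
  have sfg := square_integrable_lin t sf sg.
  by rewrite dot_linl// !dot_linr// (dotC g f) => h; nra.
have f0 := dot_ge0 f; have g0 := dot_ge0 g.
have [f1|f1] := eqVneq (dot f f) 0.
  rewrite f1 mul0r; have [->|B0] := eqVneq (dot f g) 0; first by rewrite expr0n.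
  have := H (- (dot g g + 1) / (2 * dot f g)); rewrite f1.
  have -> : 2 * (- (dot g g + 1) / (2 * dot f g)) * dot f g = - (dot g g + 1) by field.
  lra.
have := H (- dot f g / dot f f).
have -> : (- dot f g / dot f f) ^+ 2 * dot f f + 2 * (- dot f g / dot f f) * dot f g + dot g g
  = dot g g - dot f g ^+ 2 / dot f f by field.
by rewrite subr_ge0 ler_pdivrMr ?lt_def ?f1// mulrC.
Qed.

Lemma L2sqnormD_le f g : square_integrable f -> square_integrable g ->
  L2sqnorm (fun x => f x + g x) <= 2 * L2sqnorm f + 2 * L2sqnorm g.
Proof.
move=> sf sg; have [_ i2f] := sf; have [_ i2g] := sg.
have i3 := @integrable_scale _ (measurableTypeR R) R mu _ measurable_I01 2 _ i2g.
rewrite /L2sqnorm -[2 * \int[mu]_(x in _) g x ^+ 2]RintegralZl//.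
rewrite -(@Rintegral_lin _ (measurableTypeR R))//; apply: le_Rintegral => //.
- by have [] := square_integrableD sf sg.
- exact: (@integrable_lin _ (measurableTypeR R)).
- by move=> x _; have := sqr_ge0 (f x - g x); nra.
Qed.

Lemma ae_neq_endpoints : {ae mu, forall x : R, x != 0 /\ x != 1}.
Proof.
have h (z : R) : mu.-negligible [set z].
  by exists [set z]; split => //; exact: lebesgue_measure_set1.
apply: negligibleS (negligibleU (h 0) (h 1)) => x /= /not_andP.
by case=> /negP; rewrite negbK => /eqP; [left|right].
Qed.

Lemma ae_oo_cc (p : R -> Prop) : {ae mu, forall x, x \in `]0, 1[ -> p x} ->
  {ae mu, forall x, I01 x -> p x}.
Proof.
move=> h; apply: ae_imp2 h ae_neq_endpoints => x h [x0 x1] /=.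
rewrite in_itv/= => /andP[h0 h1]; apply: h.
by rewrite in_itv/= !lt_def x0 h0/= eq_sym x1.
Qed.

(** Integrals over [0, 1] ignore null sets and the end points. *)
Lemma ae_Rintegral_eq f g : measurable_fun I01 f -> measurable_fun I01 g ->
  {ae mu, forall x, x \in `]0, 1[ -> f x = g x} ->
  \int[mu]_(x in `[0, 1]) f x = \int[mu]_(x in `[0, 1]) g x.
Proof.
move=> mf mg fg; rewrite /Rintegral; congr fine.
apply: ae_eq_integral => //; try exact/measurable_EFinP.
by apply: ae_imp (ae_oo_cc fg) => x h /h ->.
Qed.

Lemma ae_square_integrable f g : measurable_fun I01 g ->
  {ae mu, forall x, x \in `]0, 1[ -> f x = g x} ->
  square_integrable f -> square_integrable g.
Proof.
move=> mg fg [mf if2]; split => //; apply/integrableP; split.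
  by apply/measurable_EFinP; exact: measurable_funX.
have /integrableP[_] := if2; congr (_ < _)%E; apply: ae_eq_integral => //.
- by apply: measurableT_comp => //; apply/measurable_EFinP; exact: measurable_funX.
- by apply: measurableT_comp => //; apply/measurable_EFinP; exact: measurable_funX.
by apply: ae_imp (ae_oo_cc fg) => x h /h ->.
Qed.

End L2.
#[global] Hint Resolve measurable_I01 : core.

(** * The Taylor kernel *)

Section TaylorKernel.
Context {R : realType}.
Local Notation mu := (@lebesgue_measure R).
Local Notation I01 := (`[0, 1]%classic : set R).
Implicit Types (f g h phi : R -> R) (a b t x y : R) (k m : nat).

(** The kernel (t - x)_+^k / k! of Taylor's formula. *)
Definition tker k t x : R := if x < t then (t - x) ^+ k / k`!%:R else 0.

Lemma measurable_tker2 k :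
  measurable_fun setT (fun z : measurableTypeR R * measurableTypeR R => tker k z.1 z.2).
Proof.
apply: measurable_fun_ifT.
- by apply: measurable_fun_ltr.
- apply: measurable_funM; last exact: measurable_cst.
  by apply: measurable_funX; apply: measurable_funB.
- exact: measurable_cst.
Qed.

Lemma measurable_tker k t (D : set (measurableTypeR R)) : measurable D -> measurable_fun D (tker k t).
Proof.
move=> mD; apply: measurable_funTS.
exact: (measurable_comp measurableT _ (measurable_tker2 k) (measurable_pair1 t)).
Qed.

Lemma tker_ge0_le1 k t x : t <= 1 -> 0 <= x -> 0 <= tker k t x <= 1.
Proof.
move=> t1 x0; rewrite /tker; case: ifPn => [xt|_]; last by rewrite lexx ler01.
have tx : 0 <= t - x <= 1 by apply/andP; split; lra.
have [tx0 tx1] := andP tx.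
rewrite divr_ge0 ?exprn_ge0//= ler_pdivrMr ?ltr0n ?fact_gt0// mul1r.
by rewrite (le_trans (exprn_ile1 k tx0 tx1))// ler1n fact_gt0.
Qed.

Lemma tker_square_integrable k t : t <= 1 -> square_integrable (tker k t).
Proof.
move=> t1; apply: (bounded_square_integrable (M := 1)); first exact: measurable_tker.
by move=> x /andP[x0 x1]; have /andP[h0 h1] := tker_ge0_le1 k t1 x0; rewrite ger0_norm.
Qed.

Lemma tkerE k t x : x < t -> tker k t x = (t - x) ^+ k / k`!%:R.
Proof. by rewrite /tker => ->. Qed.

Lemma tker0 k t x : t <= x -> tker k t x = 0.
Proof. by rewrite /tker ltNge => ->. Qed.

Lemma tker_lipschitz k s t x : s <= 1 -> t <= 1 -> 0 <= x ->
  `|tker k.+1 s x - tker k.+1 t x| <= `|s - t|.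
Proof.
wlog st : s t / s <= t => [h s1 t1 x0|s1 t1 x0].
  have [st|/ltW ts] := leP s t; first exact: h.
  by rewrite distrC (distrC s); exact: h.
have [xs|sx] := ltP x s; last first.
  rewrite (tker0 _ sx) sub0r normrN.
  have [xt|tx] := ltP x t; last by rewrite tker0// normr0.
  rewrite tkerE// [leLHS]ger0_norm; last by rewrite divr_ge0// exprn_ge0// subr_ge0 ltW.
  rewrite ler_pdivrMr ?ltr0n ?fact_gt0// distrC ger0_norm ?subr_ge0//.
  have h0 : 0 <= t - x by lra.
  have h1 : t - x <= 1 by lra.
  apply: (@le_trans _ _ (t - x)).
    by rewrite exprS -[leRHS]mulr1 ler_wpM2l// exprn_ile1.
  apply: (@le_trans _ _ ((t - s) * 1)); first by rewrite mulr1; lra.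
  by rewrite ler_wpM2l ?subr_ge0// ler1n fact_gt0.
have xt := lt_le_trans xs st.
rewrite !tkerE// -mulrBl normrM [X in _ * X]ger0_norm ?invr_ge0//.
rewrite ler_pdivrMr ?ltr0n ?fact_gt0//.
have h0 : 0 <= s - x <= 1 by apply/andP; split; lra.
have h1 : 0 <= t - x <= 1 by apply/andP; split; lra.
have -> : s - t = (s - x) - (t - x) by ring.
move: (s - x) (t - x) h0 h1 => {xs xt st s1 t1 x0 s t x} a b /andP[a0 a1] /andP[b0 b1].
elim: k => [|k IH]; first by rewrite !expr1 mulr1.
rewrite (_ : a ^+ k.+2 - b ^+ k.+2 = a * (a ^+ k.+1 - b ^+ k.+1) + (a - b) * b ^+ k.+1); last first.
  by rewrite !exprS; ring.
rewrite (le_trans (ler_normD _ _))// !normrM (ger0_norm a0).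
have -> : (k.+2`!%:R : R) = k.+1%:R * k.+1`!%:R + k.+1`!%:R.
  by rewrite factS natrM -[k.+2%:R]natr1 mulrDl mul1r.
rewrite mulrDr lerD//.
  apply: (@le_trans _ _ (1 * (`|a - b| * k.+1`!%:R))); first by rewrite ler_pM.
  rewrite mul1r ler_wpM2l// ler_peMl// ler1n//.
rewrite ler_wpM2l// ger0_norm ?exprn_ge0// (le_trans (exprn_ile1 _ b0 b1))//.
by rewrite ler1n fact_gt0.
Qed.

End TaylorKernel.

(** * Test functions and iterated integrals *)

Section Taylor.
Context {R : realType}.
Local Notation mu := (@lebesgue_measure R).
Local Notation I01 := (`[0, 1]%classic : set R).
Implicit Types (f g h phi psi : R -> R) (a b t x y : R) (j k m : nat) (p : {poly R}).

Lemma within_continuousP01 f : (forall x, 0 <= x <= 1 ->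
    forall e : R, 0 < e -> exists2 r : R, 0 < r &
    forall y, 0 <= y <= 1 -> `|x - y| < r -> `|f x - f y| <= e) <->
  {within I01, continuous f}.
Proof.
split.
  move=> H; apply/subspace_continuousP => x /=; rewrite in_itv/= => x01.
  apply/cvgrPdist_le => e e0; have [r r0 hr] := H x x01 e e0.
  rewrite near_withinE; apply/nbhs_ballP; exists r => // y xy /=.
  by rewrite in_itv/= => y01; exact: hr.
move=> /subspace_continuousP H x x01 e e0.
have /cvgrPdist_le/(_ e e0) := H x x01.
rewrite near_withinE => /nbhs_ballP[r /= r0 hr]; exists r => // y y01 xy.
exact: hr.
Qed.

Lemma eq_within_continuous f g : (forall x, 0 <= x <= 1 -> f x = g x) ->
  {within I01, continuous f} -> {within I01, continuous g}.
Proof.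
move=> fg /within_continuousP01 H; apply/within_continuousP01 => x x01 e e0.
have [r r0 hr] := H x x01 e e0; exists r => // y y01 xy.
by rewrite -!fg//; exact: hr.
Qed.

Lemma continuous_measurable01 f : {within I01, continuous f} -> measurable_fun I01 f.
Proof. by move=> cf; apply: subspace_continuous_measurable_fun. Qed.

Lemma continuous_bounded a b f : {within `[a, b], continuous f} ->
  exists M : R, forall x, a <= x <= b -> `|f x| <= M.
Proof.
move=> cf; have cI : compact (`[a, b] : set R) by exact: segment_compact.
have [M [Mr hM]] := compact_bounded (continuous_compact cf cI).
exists (M + 1) => x x01; apply: (hM (M + 1)); first by rewrite ltrDl.
by exists x => //=; rewrite in_itv.
Qed.

Lemma continuous_square_integrable f : {within I01, continuous f} -> square_integrable f.
Proof.
move=> cf; have [M hM] := continuous_bounded cf.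
apply: (bounded_square_integrable (M := M)) => //.
exact: continuous_measurable01.
Qed.

Lemma continuous_Rintegrable a b f : {within `[a, b], continuous f} ->
  mu.-integrable `[a, b] (EFin \o f).
Proof. by move=> cf; apply: continuous_compact_integrable => //; exact: segment_compact. Qed.

Lemma derivable_everywhere_LR f a b : (forall x, derivable f x 1) ->
  derivable_oo_LRcontinuous f a b.
Proof.
move=> df; have cf : continuous f.
  by move=> x; apply/differentiable_continuous/derivable1_diffP.
by split => //; [apply: cvg_at_right_filter|apply: cvg_at_left_filter]; exact: cf.
Qed.

Lemma test_derive1n k phi : test_function phi -> test_function (derive1n k phi).
Proof.
elim: k => // k IH /IH [s [a [b [a0 b1 h]]]]; split.
  by rewrite derive1nS; apply: smooth_derive1.
exists a, b; split => // x xab; rewrite derive1nS derive1E.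
have : \forall y \near x, cst 0 y = derive1n k phi y.
  have [xa|ax] := ltP x a.
    near=> y; rewrite h//= => /andP[ay _].
    have : y < a by near: y; exact: lt_nbhsl.
    by rewrite ltNge ay.
  have bx : b < x by rewrite ltNge; apply/negP => xb; apply: xab; rewrite ax xb.
  near=> y; rewrite h//= => /andP[_ yb].
  have : b < y by near: y; exact: lt_nbhsr.
  by rewrite ltNge yb.
by move/near_eq_derive => <-; rewrite derive_cst.
Unshelve. all: by end_near.
Qed.

Lemma test_out phi x : test_function phi -> ~~ (0 < x < 1) -> phi x = 0.
Proof.
move=> [_ [a [b [a0 b1 h]]]] x01; apply: h => /andP[ax xb].
by move: x01; rewrite (lt_le_trans a0 ax) (le_lt_trans xb b1).
Qed.

Lemma test0 phi : test_function phi -> phi 0 = 0.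
Proof. by move/test_out; apply; rewrite ltxx. Qed.

Lemma test1 phi : test_function phi -> phi 1 = 0.
Proof. by move/test_out; apply; rewrite ltxx andbF. Qed.

Lemma test_smooth phi : test_function phi -> smooth phi.
Proof. by case. Qed.

Lemma test_continuous phi : test_function phi -> continuous phi.
Proof. by move=> /test_smooth/(smooth_continuous (k := 0)). Qed.

Lemma test_square_integrable phi : test_function phi -> square_integrable phi.
Proof.
by move=> /test_continuous cf; apply/continuous_square_integrable/continuous_subspaceT.
Qed.

Lemma derive1n_lin k a f g : smooth f -> smooth g ->
  derive1n k (fun x => a * f x + g x) = (fun x => a * derive1n k f x + derive1n k g x).
Proof.
move=> sf sg; elim: k => // k IH; rewrite derive1nS IH; apply/funext => x.
rewrite derive1E.
have := is_deriveD (is_deriveZ a (smooth_is_derive k x sf)) (smooth_is_derive k x sg).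
by move=> d; apply: (@derive_val _ _ _ _ _ _ _ d).
Qed.

Lemma smooth_lin a f g : smooth f -> smooth g -> smooth (fun x => a * f x + g x).
Proof.
move=> sf sg k x; rewrite derive1n_lin//.
have := is_deriveD (is_deriveZ a (smooth_is_derive k x sf)) (smooth_is_derive k x sg).
by move=> d; apply: (@ex_derive _ _ _ _ _ _ _ d).
Qed.

Lemma test_lin a phi psi : test_function phi -> test_function psi ->
  test_function (fun x => a * phi x + psi x).
Proof.
move=> [sf [c [d [c0 d1 h]]]] [sg [c' [d' [c'0 d'1 h']]]].
split; first exact: (@smooth_lin a phi psi sf sg).
exists (Num.min c c'), (Num.max d d'); split; first by rewrite lt_min c0.
  by rewrite gt_max d1.
move=> x /negP; rewrite negb_and -!ltNge lt_min gt_max => hx.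
rewrite h ?h' ?mulr0 ?addr0// => /andP[u v]; case/orP: hx => /andP[]; lra.
Qed.

(** The Taylor polynomial (t - x)^k / k!. *)
Definition tpoly k x : {poly R} := (k`!%:R^-1)%:P * ('X - x%:P) ^+ k.

Lemma tpolyE k t x : (tpoly k x).[t] = (t - x) ^+ k / k`!%:R.
Proof. by rewrite /tpoly !hornerE mulrC. Qed.

Lemma deriv_tpoly k x : (tpoly k.+1 x)^`() = tpoly k x.
Proof.
rewrite /tpoly derivCE deriv_exp derivXsubC mul1r/= mulrnAr -mulrnAl -polyCMn.
congr (_%:P * _); rewrite factS natrM invfM -[LHS]mulr_natl mulrA mulfV ?mul1r//.
Qed.

Lemma horner_continuous p : continuous (horner p).
Proof.
by move=> x; apply/differentiable_continuous/derivable1_diffP; exact: derivable_horner.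
Qed.

Lemma test_by_parts a p phi : 0 <= a -> a < 1 -> test_function phi ->
  \int[mu]_(t in `[a, 1]) (p.[t] * derive1 phi t) =
  - (p.[a] * phi a) - \int[mu]_(t in `[a, 1]) (p^`().[t] * phi t).
Proof.
move=> a0 a1 tphi; have sphi := test_smooth tphi.
rewrite (@Rintegration_by_parts _ (horner p) phi (horner p^`()) (derive1 phi))//.
- by rewrite (test1 tphi) mulr0 add0r.
- by apply: continuous_subspaceT; exact: horner_continuous.
- by apply: derivable_everywhere_LR => x; exact: derivable_horner.
- by move=> x _; rewrite derive1E; exact: derive_val.
- by apply: continuous_subspaceT; exact: (smooth_continuous (k := 1)).
- by apply: derivable_everywhere_LR => x; exact: (sphi 0).
Qed.

(** As a function of t, the kernel is the Taylor polynomial on ]x, 1] and 0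
    before. *)
Lemma tker_int k x psi : 0 <= x <= 1 -> continuous psi ->
  \int[mu]_(t in `[0, 1]) (tker k t x * psi t) =
  \int[mu]_(t in `[x, 1]) ((tpoly k x).[t] * psi t).
Proof.
move=> /andP[x0 x1] cpsi; rewrite -Rintegral_itv_obnd_cbnd; last first.
  apply: (@integrableS _ (measurableTypeR R) _ _ `[x, 1]) => //.
    by apply: subset_itv; rewrite bnd_simp.
  apply: continuous_Rintegrable; apply: continuous_subspaceT => y.
  by apply: cvgM; [exact: horner_continuous|exact: cpsi].
apply: Rintegral_restrict => t; rewrite !patchE tpolyE.
case: ifPn => [|]; rewrite ?inE ?notin_setE/= !in_itv/=.
  move=> /andP[t0 t1]; case: ifPn; rewrite ?inE ?notin_setE/= !in_itv/=.
    by move=> /andP[xt _]; rewrite tkerE.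
  by move=> /negP; rewrite t1 andbT -leNgt => tx; rewrite tker0// mul0r.
move=> h; rewrite ifF//; apply/negbTE; rewrite notin_setE/= in_itv/= => /andP[xt t1].
by apply: h; rewrite t1 andbT ltW// (le_lt_trans x0).
Qed.

(** Integration by parts against the Taylor kernel. *)
Lemma tker_by_parts k x phi : 0 <= x <= 1 -> test_function phi ->
  \int[mu]_(t in `[0, 1]) (tker k t x * derive1 phi t) =
  - (if k is k'.+1 then \int[mu]_(t in `[0, 1]) (tker k' t x * phi t) else phi x).
Proof.
move=> x01 tphi; have sphi := test_smooth tphi; have /andP[x0 x1] := x01.
have [x11|x11] := eqVneq x 1.
  have h k' f : \int[mu]_(t in `[0, 1]) (tker k' t x * f t) = 0.
    transitivity (\int[mu]_(t in `[0, 1]) (cst 0 t : R)).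
      apply: eq_Rintegral => t; rewrite inE/= in_itv/= => /andP[_ t1].
      by rewrite tker0 ?mul0r// x11.
    by rewrite Rintegral_cst// mul0r.
  by rewrite h; case: k => [|k]; rewrite ?h ?x11 ?(test1 tphi) oppr0.
have {x11}x1' : x < 1 by rewrite lt_neqAle x11.
rewrite tker_int//; last exact: (smooth_continuous (k := 1)).
rewrite test_by_parts//; case: k => [|k].
  rewrite tpolyE expr0 divr1 mul1r.
  rewrite [X in _ - X](_ : _ = 0) ?subr0//.
  under eq_Rintegral do rewrite /tpoly expr0 mulr1 derivC horner0 mul0r.
  by rewrite Rintegral_cst// mul0r.
rewrite tpolyE subrr expr0n/= mul0r mul0r oppr0 add0r deriv_tpoly tker_int//.
exact: test_continuous.
Qed.

(** The k-th iterated integral of g from 0. *)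
Definition Jint k g t : R :=
  if k is k'.+1 then \int[mu]_(x in `[0, 1]) (tker k' t x * g x) else g t.

Lemma JintS k g t : Jint k.+1 g t = dot (tker k t) g.
Proof. by []. Qed.

Lemma Jint_lin k a f g t : t <= 1 -> square_integrable f -> square_integrable g ->
  Jint k (fun x => a * f x + g x) t = a * Jint k f t + Jint k g t.
Proof.
move=> t1 sf sg; case: k => // k; rewrite !JintS.
by rewrite dot_linr//; exact: tker_square_integrable.
Qed.

Lemma L2sqnorm_bounded f M : measurable_fun I01 f ->
  (forall x, 0 <= x <= 1 -> `|f x| <= M) -> L2sqnorm f <= M ^+ 2.
Proof.
move=> mf fM; have [mf' if2] := bounded_square_integrable mf fM.
apply: (@le_trans _ _ (\int[mu]_(x in `[0, 1]) (cst (M ^+ 2) x))).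
  apply: le_Rintegral => //.
    by have [_] := square_integrable_cst M.
  move=> x /=; rewrite in_itv/= => x01; rewrite -[leLHS]real_normK ?num_real//.
  by rewrite ler_pXn2r// ?nnegrE ?(le_trans (normr_ge0 _) (fM x x01))// fM.
rewrite Rintegral_cst// [X in _ * fine X](_ : _ = 1%E) ?mulr1//.
by rewrite /= lebesgue_measure_itv/= lte_fin ltr01 sube0.
Qed.

Lemma Jint_bound k g t : 0 <= t <= 1 -> square_integrable g ->
  Jint k.+1 g t ^+ 2 <= L2sqnorm g.
Proof.
move=> /andP[t0 t1] sg; rewrite JintS.
apply: (le_trans (cauchy_schwarz (tker_square_integrable k t1) sg)).
rewrite -[leRHS]mul1r ler_wpM2r ?L2sqnorm_ge0// -(expr1n _ 2).
apply: L2sqnorm_bounded; first exact: measurable_tker.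
by move=> x /andP[x0 _]; have /andP[h0 h1] := tker_ge0_le1 k t1 x0; rewrite ger0_norm.
Qed.

Lemma Jint_continuous k g : square_integrable g -> {within I01, continuous Jint k.+1 g}.
Proof.
move=> sg; have ig := square_integrable_integrable sg.
case: k => [|k].
  have := @parameterized_integral_continuous _ 0 1 g ler01 ig.
  apply: eq_within_continuous => t /andP[t0 t1].
  rewrite /parameterized_integral -Rintegral_itv_bndo_bndc; last first.
    apply: (@integrableS _ (measurableTypeR R) _ _ `[0, 1]) ig => //.
    by apply: subset_itv; rewrite bnd_simp.
  apply: Rintegral_restrict => x; rewrite !patchE.
  case: ifPn; rewrite ?inE ?notin_setE/= !in_itv/=.
    move=> /andP[x0 xt]; rewrite mem_set/= ?in_itv/= ?x0/= ?(le_trans (ltW xt))//.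
    by rewrite tkerE// expr0 divr1 mul1r.
  move=> h; case: ifP => //; rewrite inE/= in_itv/= => /andP[x0 x1].
  rewrite tker0 ?mul0r// leNgt; apply/negP => xt; apply: h.
  by rewrite x0.
apply/within_continuousP01 => s /andP[s0 s1] e e0.
pose C := \int[mu]_(x in `[0, 1]) `|g x|.
have C0 : 0 <= C by apply: Rintegral_ge0.
exists (e / (C + 1)); first by rewrite divr_gt0//; lra.
move=> t /andP[t0 t1] st.
have itg r : r <= 1 -> mu.-integrable I01 (EFin \o (fun x => tker k.+1 r x * g x)).
  by move=> r1; apply: square_integrableM => //; exact: tker_square_integrable.
rewrite /Jint -RintegralB//; [|exact: itg|exact: itg].
have -> : \int[mu]_(x in `[0, 1]) (tker k.+1 s x * g x - tker k.+1 t x * g x) =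
   \int[mu]_(x in `[0, 1]) ((tker k.+1 s x - tker k.+1 t x) * g x).
  by apply: eq_Rintegral => x _; rewrite mulrBl.
have i2 : mu.-integrable I01 (EFin \o (fun x => (tker k.+1 s x - tker k.+1 t x) * g x)).
  by apply: square_integrableM => //; apply: square_integrableB; exact: tker_square_integrable.
apply: (le_trans (le_normr_Rintegral _ i2)) => //.
apply: (@le_trans _ _ (\int[mu]_(x in `[0, 1]) (`|s - t| * `|g x|))).
  apply: le_Rintegral => //.
  - exact: (integrable_norm i2).
  - by apply: (@integrable_scale _ (measurableTypeR R)) => //; exact: (integrable_norm ig).
  - move=> x /=; rewrite in_itv/= => /andP[x0 x1].
    by rewrite normrM ler_wpM2r// tker_lipschitz.
rewrite RintegralZl//; last exact: (integrable_norm ig).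
rewrite -/C; apply: (@le_trans _ _ (e / (C + 1) * C)); first by rewrite ler_wpM2r// ltW.
by rewrite mulrAC ler_pdivrMr; nra.
Qed.

Lemma Jint_square_integrable k g : square_integrable g -> square_integrable (Jint k g).
Proof.
by case: k => // k sg; apply: continuous_square_integrable; exact: Jint_continuous.
Qed.

End Taylor.

(** * Weak derivatives of polynomials plus iterated integrals *)

Section WeakDerivative.
Context {R : realType}.
Local Notation mu := (@lebesgue_measure R).
Local Notation I01 := (`[0, 1]%classic : set R).
Implicit Types (f g h phi psi : R -> R) (a b t x y : R) (j k m : nat) (p : {poly R}).

Lemma EFin_Rintegral (D : set R) f : measurable D -> mu.-integrable D (EFin \o f) ->
  (\int[mu]_(x in D) (f x)%:E)%E = (\int[mu]_(x in D) f x)%:E.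
Proof. by move=> mD fi; rewrite fineK//; exact: integrable_fin_num. Qed.

Lemma tker_square_integrable_l k x : 0 <= x -> square_integrable (fun t => tker k t x).
Proof.
move=> x0; apply: (bounded_square_integrable (M := 1)).
  apply: measurable_funTS.
  exact: (measurable_comp measurableT _ (measurable_tker2 k) (measurable_pair2 x)).
by move=> t /andP[_ t1]; have /andP[h0 h1] := tker_ge0_le1 k t1 x0; rewrite ger0_norm.
Qed.

(** Fubini for the kernel of the iterated integral. *)
Lemma Jint_fubini k g psi : square_integrable g -> square_integrable psi ->
  \int[mu]_(t in `[0, 1]) (Jint k.+1 g t * psi t) =
  \int[mu]_(x in `[0, 1]) (g x * \int[mu]_(t in `[0, 1]) (tker k t x * psi t)).
Proof.
move=> sg spsi.
pose g0 := g \_ I01; pose psi0 := psi \_ I01.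
have [mg _] := sg; have [mpsi _] := spsi.
have mg0 : measurable_fun setT g0 by apply/(measurable_restrictT _ _).1.
have mpsi0 : measurable_fun setT psi0 by apply/(measurable_restrictT _ _).1.
have ig0 : mu.-integrable setT (EFin \o g0).
  have := (integrable_mkcond _ measurable_I01).1 (square_integrable_integrable sg).
  by apply: eq_integrable => // x _ /=; rewrite /g0 !patchE; case: ifP.
have ipsi0 : mu.-integrable setT (EFin \o psi0).
  have := (integrable_mkcond _ measurable_I01).1 (square_integrable_integrable spsi).
  by apply: eq_integrable => // x _ /=; rewrite /psi0 !patchE; case: ifP.
pose F (z : measurableTypeR R * measurableTypeR R) : \bar R :=
  (tker k z.1 z.2 * (g0 z.2 * psi0 z.1))%:E.
have mF : measurable_fun setT F.
  apply/measurable_EFinP; apply: measurable_funM; first exact: measurable_tker2.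
  by apply: measurable_funM; apply: measurableT_comp.
have leF t x : (`|F (t, x)| <= `|psi0 t|%:E * `|g0 x|%:E)%E.
  rewrite /F/= -EFinM lee_fin !normrM [leRHS]mulrC -[leRHS]mul1r.
  rewrite /g0 /psi0 !patchE; case: ifPn; rewrite ?inE/= ?in_itv/= => h1; last first.
    by rewrite normr0 mul0r !mulr0.
  case: ifPn; rewrite ?inE/= ?in_itv/= => h2; last by rewrite normr0 !mulr0.
  have /andP[u v] : 0 <= tker k t x <= 1.
    by apply: tker_ge0_le1; [case/andP: h2|case/andP: h1].
  by rewrite ler_wpM2r// ger0_norm.
have iF : (mu \x mu)%E.-integrable setT F.
  apply/(@integrable12ltyP _ _ _ _ _ mu mu F mF).
  apply: (@le_lt_trans _ _ (\int[mu]_t (`|psi0 t|%:E * \int[mu]_x `|g0 x|%:E))%E).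
    apply: ge0_le_integral => //.
    - by move=> t _; apply: integral_ge0.
    - apply: (@measurable_fun_fubini_tonelli_F _ _ _ _ _ mu (fun z => `|F z|%E)) => //.
      exact: measurableT_comp.
    - apply: emeasurable_funM; last exact: measurable_cst.
      by apply/measurable_EFinP; exact: measurableT_comp.
    - move=> t _; rewrite -ge0_integralZl//; last first.
        by apply/measurable_EFinP; exact: measurableT_comp.
      apply: ge0_le_integral => //.
      + apply: measurableT_comp => //.
        exact: (measurableT_comp mF (measurable_pair1 t)).
      + apply: emeasurable_funM; first exact: measurable_cst.
        by apply/measurable_EFinP; exact: measurableT_comp.
  rewrite ge0_integralZr//; last 2 first.
  - by apply/measurable_EFinP; exact: measurableT_comp.
  - exact: integral_ge0.
  apply: lte_mul_pinfty; [exact: integral_ge0| |].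
  - rewrite ge0_fin_numE; last exact: integral_ge0.
    by have /integrableP[_] := ipsi0.
  - by have /integrableP[_] := ig0.
have inner (e : R -> R) c : mu.-integrable I01 (EFin \o e) ->
    (\int[mu]_x (c * (e \_ I01) x)%:E)%E = (c * \int[mu]_(x in `[0, 1]) e x)%:E.
  move=> ie; rewrite -RintegralZl// -EFin_Rintegral//; last exact: (@integrable_scale _ (measurableTypeR R)).
  rewrite [RHS]integral_mkcond; apply: eq_integral => x _.
  by rewrite !patchE; case: ifP; rewrite ?mulr0.
have := Fubini iF; rewrite /Rintegral => FF.
transitivity (fine (\int[mu]_t \int[mu]_x F (t, x))%E).
  congr fine; rewrite [LHS]integral_mkcond; apply: eq_integral => t _.
  rewrite patchE; case: ifPn => [|] h.
    have /andP[t0 t1] : 0 <= t <= 1 by move: h; rewrite inE/= in_itv.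
    rewrite mulrC -(inner (fun x => tker k t x * g x)); last first.
      exact: (square_integrableM (tker_square_integrable k t1) sg).
    apply: eq_integral => x _; rewrite /F/= /g0 /psi0 !patchE h; congr EFin.
    by case: ifP => _; [ring|rewrite mul0r !mulr0].
  rewrite integral0_eq// => x _; rewrite /F/= /psi0 patchE (negbTE h) !mulr0//.
rewrite FF; congr fine; rewrite [RHS]integral_mkcond; apply: eq_integral => x _.
rewrite patchE; case: ifPn => [|] h.
  have /andP[x0 x1] : 0 <= x <= 1 by move: h; rewrite inE/= in_itv.
  rewrite -/(Rintegral _ _ _) -(inner (fun t => tker k t x * psi t)); last first.
    exact: (square_integrableM (tker_square_integrable_l k x0) spsi).
  apply: eq_integral => t _; rewrite /F/= /g0 /psi0 !patchE h; congr EFin.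
  by case: ifP => _; [ring|rewrite !mulr0].
by rewrite integral0_eq// => t _; rewrite /F/= /g0 patchE (negbTE h) mul0r !mulr0.
Qed.

(** The weak derivative of an iterated integral is the previous one. *)
Lemma Jint_step k g phi : square_integrable g -> test_function phi ->
  \int[mu]_(t in `[0, 1]) (Jint k.+1 g t * derive1 phi t) =
  - \int[mu]_(t in `[0, 1]) (Jint k g t * phi t).
Proof.
move=> sg tphi; have sphi := test_square_integrable tphi.
rewrite (Jint_fubini k sg (test_square_integrable (test_derive1n 1 tphi))).
case: k => [|k].
  rewrite -mulN1r -RintegralZl//; last exact: square_integrableM.
  apply: eq_Rintegral => x; rewrite inE/= in_itv/= => x01.
  by rewrite tker_by_parts// mulN1r mulrN.
rewrite -mulN1r -RintegralZl//; last first.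
  by apply: square_integrableM => //; exact: Jint_square_integrable.
transitivity (\int[mu]_(t in `[0, 1]) (Jint k.+1 g t * (-1 * phi t))); last first.
  by apply: eq_Rintegral => t _; rewrite mulrCA.
rewrite (@Jint_fubini k g (fun t => -1 * phi t) sg (square_integrableZ (-1) sphi)).
apply: eq_Rintegral => x; rewrite inE/= in_itv/= => x01; have /andP[x0 _] := x01.
rewrite tker_by_parts//; congr (_ * _); rewrite -[LHS]mulN1r -RintegralZl//; last first.
  by apply: square_integrableM => //; exact: tker_square_integrable_l.
by apply: eq_Rintegral => t _; rewrite mulrCA.
Qed.

(** The same for polynomials. *)
Lemma poly_step p phi : test_function phi ->
  \int[mu]_(t in `[0, 1]) (p.[t] * derive1 phi t) =
  - \int[mu]_(t in `[0, 1]) (p^`().[t] * phi t).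
Proof. by move=> tphi; rewrite test_by_parts// (test0 tphi) mulr0 oppr0 add0r. Qed.

Lemma horner_square_integrable p : square_integrable (horner p).
Proof.
by apply/continuous_square_integrable/continuous_subspaceT/horner_continuous.
Qed.

(** The functions p + J_m g and their weak derivatives. *)
Definition taylor_fun m p g t : R := p.[t] + Jint m g t.

Lemma taylor_square_integrable m p g : square_integrable g ->
  square_integrable (taylor_fun m p g).
Proof.
move=> sg; apply: square_integrableD; first exact: horner_square_integrable.
exact: Jint_square_integrable.
Qed.

Lemma taylor_by_parts m p g j phi : (j <= m)%N -> square_integrable g ->
  test_function phi ->
  \int[mu]_(t in `[0, 1]) (taylor_fun m p g t * derive1n j phi t) =
  (-1) ^+ j * \int[mu]_(t in `[0, 1]) (taylor_fun (m - j) p^`(j) g t * phi t).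
Proof.
move=> + sg; elim: j phi => [|j IH] phi jm tphi.
  by rewrite subn0 expr0 mul1r.
rewrite derive1Sn IH ?(ltnW jm)//; last exact: (test_derive1n 1).
rewrite exprSr -mulrA mulN1r; congr (_ * _).
have tphi' := test_square_integrable (test_derive1n 1 tphi).
have sphi := test_square_integrable tphi.
rewrite -[(m - j)%N]prednK ?subn_gt0// -subnS.
have split_int (a : R -> R) (q : {poly R}) n : square_integrable a ->
   \int[mu]_(t in `[0, 1]) (taylor_fun n q g t * a t) =
   \int[mu]_(t in `[0, 1]) (q.[t] * a t) + \int[mu]_(t in `[0, 1]) (Jint n g t * a t).
  move=> sa; rewrite -RintegralD//.
  - by apply: eq_Rintegral => t _; rewrite mulrDl.
  - by apply: square_integrableM => //; exact: horner_square_integrable.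
  - by apply: square_integrableM => //; exact: Jint_square_integrable.
rewrite !split_int// poly_step// Jint_step// derivnS; ring.
Qed.

Lemma square_integrable_locally g : square_integrable g -> locally_integrable `]0, 1[ g.
Proof.
move=> sg; apply: open_integrable_locally; first exact: interval_open.
apply: (@integrableS _ (measurableTypeR R) _ _ I01) (square_integrable_integrable sg) => //.
by apply: subset_itv; rewrite bnd_simp.
Qed.

(** The j-th weak derivative of p + J_m g is the j-th derivative of p
    plus J_(m - j) g. *)
Lemma taylor_weak_derivative m p g j : (j <= m)%N -> square_integrable g ->
  is_weak_derivative j (taylor_fun m p g) (taylor_fun (m - j) p^`(j) g).
Proof.
move=> jm sg; split.
  by apply: square_integrable_locally; exact: taylor_square_integrable.
by move=> phi tphi; exact: taylor_by_parts.
Qed.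

Lemma locally_integrable_test g phi : locally_integrable `]0, 1[ g ->
  test_function phi -> mu.-integrable I01 (EFin \o (fun x => g x * phi x)).
Proof.
move=> lg tphi; have [_ [a [b [a0 b1 h]]]] := tphi.
have iab := locally_integrable_itv lg a0 b1.
have [M hM] : exists M : R, forall x, a <= x <= b -> `|phi x| <= M.
  by apply: continuous_bounded; apply: continuous_subspaceT; exact: test_continuous.
have i1 : mu.-integrable `[a, b] (EFin \o (fun x => g x * phi x)).
  apply: (@le_integrableR _ (measurableTypeR R) _ _ _ _ _ (fun x => M * `|g x|)) => //.
  - apply: measurable_funM; first by apply/measurable_EFinP; exact: (measurable_int mu).
    by apply: (@smooth_measurable _ _ 0) => //; exact: test_smooth.
  - move=> x /=; rewrite in_itv/= => xab.
    by rewrite normrM mulrC ler_wpM2r// hM.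
  - by apply: (@integrable_scale _ (measurableTypeR R)) => //; exact: integrable_norm.
apply/(integrable_mkcond _ measurable_I01).2.
have := (@integrable_mkcond _ (measurableTypeR R) _ _ _ _ _).1 i1.
move=> /(_ (measurable_itv _)).
apply: eq_integrable => // x _; rewrite !patchE.
have [xab|xab] := boolP (a <= x <= b).
  rewrite !mem_set//= in_itv/=; case/andP: xab => *; apply/andP; split; lra.
rewrite memNset/=; last by rewrite in_itv/=; exact/negP.
case: ifP => // _; rewrite h ?mulr0//; exact/negP.
Qed.

Lemma weak_derivative_unique j h g1 g2 : is_weak_derivative j h g1 ->
  is_weak_derivative j h g2 -> {ae mu, forall x, x \in `]0, 1[ -> g1 x = g2 x}.
Proof.
move=> [l1 e1] [l2 e2].
have := @fundamental_lemma _ (g1 \- g2) (locally_integrableB l1 l2).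
move=> H; apply: ae_imp (H _) => [x hx /hx /eqP|phi tphi].
  by rewrite subr_eq0 => /eqP.
have := e1 _ tphi; rewrite e2// => /(mulrI _) e.
transitivity (\int[mu]_(x in `[0, 1]) (g1 x * phi x) - \int[mu]_(x in `[0, 1]) (g2 x * phi x)).
  rewrite -RintegralB//; [|exact: locally_integrable_test|exact: locally_integrable_test].
  by apply: eq_Rintegral => x _; rewrite /= mulrBl.
by rewrite e ?subrr// unitrX// unitrN1.
Qed.

Lemma wderivP j h : (exists g, is_weak_derivative j h g) ->
  is_weak_derivative j h (wderiv j h).
Proof. by move=> [g hg]; rewrite /wderiv; apply: (@xgetPex _ (fun=> 0)); exists g. Qed.

(** The chosen weak derivative agrees with any other one. *)
Lemma wderiv_ae j h g : is_weak_derivative j h g ->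
  {ae mu, forall x, x \in `]0, 1[ -> wderiv j h x = g x}.
Proof. by move=> hg; exact: (weak_derivative_unique (wderivP (ex_intro _ g hg)) hg). Qed.

End WeakDerivative.

(** * The du Bois-Reymond lemma and Taylor's formula in the Sobolev space *)

Section DuBoisReymond.
Context {R : realType}.
Local Notation mu := (@lebesgue_measure R).
Local Notation I01 := (`[0, 1]%classic : set R).
Implicit Types (f g h r phi psi : R -> R) (a b t x y : R) (j k m : nat) (p : {poly R}).

(** A multiple of a cutoff function. *)
Lemma test_integral1 : exists2 rho : R -> R, test_function rho &
  \int[mu]_(x in `[0, 1]) rho x = 1.
Proof.
pose a : R := 4^-1; pose b : R := 3/4.
have a0 : 0 < a by rewrite /a; lra.
have b1 : b < 1 by rewrite /b; lra.
have := @cutoff_integral_cvg _ (cst 1) _ _ (square_integrable_locally (square_integrable_cst 1)) a0 b1.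
rewrite Rintegral_cst//= lebesgue_measure_itv/= lte_fin.
have ab : a < b by rewrite /a /b; lra.
rewrite ab -EFinB/= mul1r => h.
have [n hn] : exists n, 0 < \int[mu]_(x in `[0, 1]) (cst 1 x * cutoff a b n x).
  have d0 : 0 < b - a by rewrite subr_gt0.
  have /cvgr_gt/(_ 0 d0)[N _ hN] := h.
  by exists N; apply: hN => /=.
set c := \int[mu]_(x in _) _ in hn.
exists (fun x => c^-1 * cutoff a b n x + 0 * cutoff a b n x).
  have tz : test_function (fun x => 0 * cutoff a b n x + cutoff a b n x).
    by apply: test_lin; exact: cutoff_test.
  have := test_lin (c^-1) (cutoff_test n a0 b1) (test_lin (-1) (cutoff_test n a0 b1) (cutoff_test n a0 b1)).
  by congr test_function; apply/funext => x; ring.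
rewrite (_ : (fun x => _) = (fun x => c^-1 * (cst 1 x * cutoff a b n x))).
  rewrite RintegralZl//; first by rewrite -/c mulVf// gt_eqF.
  apply: square_integrableM; first exact: square_integrable_cst.
  by apply: test_square_integrable; exact: cutoff_test.
by apply/funext => x /=; ring.
Qed.

(** A test function is the derivative of a test function as soon as its
    integral vanishes. *)
Lemma test_antiderivative psi : test_function psi ->
  \int[mu]_(x in `[0, 1]) psi x = 0 ->
  exists2 phi, test_function phi & derive1 phi = psi.
Proof.
move=> tpsi psi0; have spsi := test_smooth tpsi.
have [_ [a [b [a0 b1 h]]]] := tpsi.
pose phi x := \int[mu]_(t in `[0, x]) psi t.
have ipsi x : mu.-integrable `[0, x] (EFin \o psi).
  by apply: continuous_Rintegrable; apply: continuous_subspaceT; exact: test_continuous.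
have phi_lt x : x < a -> phi x = 0.
  move=> xa; transitivity (\int[mu]_(t in `[0, x]) (cst 0 t : R)).
    apply: eq_Rintegral => t; rewrite inE/= in_itv/= => /andP[t0 tx].
    by apply: h => /andP[]; lra.
  by rewrite Rintegral_cst// mul0r.
have phi_gt x : b < x -> phi x = 0.
  move=> bx; rewrite /phi -psi0; apply: Rintegral_restrict => t; rewrite !patchE.
  have [|tb] := leP t b.
    move=> tb; congr (if _ then _ else _); apply/idP/idP; rewrite !inE/= !in_itv/=;
      by move=> /andP[t0 _]; apply/andP; split; lra.
  by rewrite h ?if_same// => /andP[]; lra.
have dphi x : is_derive x (1 : R) phi (psi x).
  have [xa|ax] := ltP x a.
    have e : \forall y \near x, cst 0 y = phi y.
      by near=> y; rewrite phi_lt//; near: y; exact: lt_nbhsl.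
    apply: (near_eq_is_derive e); rewrite h; first exact: is_derive_cst.
    by move=> /andP[]; lra.
  have x0 : 0 < x by lra.
  have xx : x < x + 1 by lra.
  have [d e] := @continuous_FTC1_closed _ psi 0 x (x + 1) xx (ipsi _) x0 (@test_continuous _ _ tpsi x).
  by move: (derivableP d); rewrite -derive1E e.
exists phi; last by apply/funext => x; rewrite derive1E; exact: derive_val.
split; first exact: smooth_antiderivative dphi.
exists a, b; split => // x /negP; rewrite negb_and -!ltNge => /orP[] H; [exact: phi_lt|exact: phi_gt].
Unshelve. all: by end_near.
Qed.

(** The du Bois-Reymond lemma: a function whose m-th weak derivative vanishes is
    almost everywhere a polynomial of degree less than m. *)
Lemma du_bois_reymond m r : square_integrable r ->
  (forall phi, test_function phi ->
    \int[mu]_(x in `[0, 1]) (r x * derive1n m phi x) = 0) ->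
  exists2 p : {poly R}, (size p <= m)%N & {ae mu, forall x, x \in `]0, 1[ -> r x = p.[x]}.
Proof.
elim: m r => [|m IH] r sr H.
  exists 0; first by rewrite size_poly0.
  apply: ae_imp (fundamental_lemma (square_integrable_locally sr) H) => x h /h ->.
  by rewrite horner0.
have [rho trho rho1] := test_integral1.
pose c := \int[mu]_(x in `[0, 1]) (r x * derive1n m rho x).
have sq0 : square_integrable (fun x => (tpoly m 0).[x]) by exact: horner_square_integrable.
(* r' is r up to a multiple of t^m / m!, chosen to be orthogonal to the m-th
   derivative of rho; this reduces all tests to those of integral 0 *)
pose r' x := (- ((-1) ^+ m * c)) * (tpoly m 0).[x] + r x.
have sr' : square_integrable r' by exact: square_integrable_lin.
have [|p sp hp] := IH r' sr'.
  move=> psi tpsi.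
  pose K := \int[mu]_(x in `[0, 1]) psi x.
  have tchi : test_function (fun x => (- K) * rho x + psi x) by exact: test_lin.
  have ssi f : test_function f -> mu.-integrable I01 (EFin \o f).
    by move=> tf; apply: square_integrable_integrable; exact: test_square_integrable.
  have chi0 : \int[mu]_(x in `[0, 1]) (- K * rho x + psi x) = 0.
    rewrite (@Rintegral_lin _ (measurableTypeR R))//; [|exact: ssi|exact: ssi].
    by rewrite rho1 mulr1 addNr.
  have [phi tphi dphi] := test_antiderivative tchi chi0.
  have := H phi tphi; rewrite derive1Sn dphi derive1n_lin; [|exact: test_smooth|exact: test_smooth].
  have s1 := test_square_integrable (test_derive1n m trho).
  have s2 := test_square_integrable (test_derive1n m tpsi).
  have -> : \int[mu]_(x in `[0, 1]) (r x * (- K * derive1n m rho x + derive1n m psi x)) =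
    dot r (fun x => - K * derive1n m rho x + derive1n m psi x) by [].
  rewrite dot_linr// -[dot r (derive1n m rho)]/c => e1.
  have -> : \int[mu]_(x in `[0, 1]) (r' x * derive1n m psi x) = dot r' (derive1n m psi) by [].
  rewrite dot_linl//.
  have -> : dot (fun x => (tpoly m 0).[x]) (derive1n m psi) = (-1) ^+ m * K.
    transitivity (\int[mu]_(x in `[0, 1]) (taylor_fun m (tpoly m 0) (cst 0) x * derive1n m psi x)).
      apply: eq_Rintegral => x _; congr (_ * _).
      rewrite /taylor_fun; case: (m) => [|m']; first by rewrite /= addr0.
      by rewrite JintS dotC dot0l addr0.
    rewrite taylor_by_parts//; last exact: square_integrable_cst.
    congr (_ * _); apply: eq_Rintegral => x _.
    rewrite subnn /taylor_fun/= addr0.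
    suff -> : (tpoly m (0 : R))^`(m) = 1 by rewrite hornerE mul1r.
    have tp k : (k <= m)%N -> (tpoly m (0 : R))^`(k) = tpoly (m - k) 0.
      elim: k => [|k IHk] km; first by rewrite subn0.
      by rewrite derivnS IHk ?(ltnW km)// -[(m - k)%N]prednK ?subn_gt0// deriv_tpoly -subnS.
    by rewrite tp// subnn /tpoly expr0 mulr1 invr1.
  have -> : - ((-1) ^+ m * c) * ((-1) ^+ m * K) = - (K * c).
    rewrite -mulrN mulrACA -exprMn mulrNN mulr1 expr1n; ring.
  by rewrite -e1; ring.
exists (p + ((-1) ^+ m * c) *: tpoly m 0).
  rewrite (leq_trans (size_polyD _ _))// geq_max (leq_trans sp)//=.
  rewrite (leq_trans (size_scale_leq _ _))// /tpoly mul_polyC (leq_trans (size_scale_leq _ _))//.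
  by rewrite subr0 size_polyXn.
apply: ae_imp hp => x h /h; rewrite hornerD hornerZ /r' => <-; ring.
Qed.

Lemma continuous_ae_eq f g : {within I01, continuous f} -> {within I01, continuous g} ->
  {ae mu, forall x, x \in `]0, 1[ -> f x = g x} ->
  forall x, 0 <= x <= 1 -> f x = g x.
Proof.
move=> cf cg fg x x01; apply/eqP/negPn/negP => fgx.
have e0 : 0 < `|f x - g x| / 3 by rewrite divr_gt0 ?normr_gt0 ?subr_eq0.
have [r1 r10 h1] := (within_continuousP01 f).2 cf x x01 _ e0.
have [r2 r20 h2] := (within_continuousP01 g).2 cg x x01 _ e0.
pose l := Num.max 0 (x - Num.min r1 r2); pose u := Num.min 1 (x + Num.min r1 r2).
have r0 : 0 < Num.min r1 r2 by rewrite lt_min r10.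
have /andP[x0 x1] := x01.
have lu : l < u.
  rewrite /l /u lt_min !gt_max; apply/andP; split; apply/andP; split; lra.
have [N [mN N0 sN]] := fg.
have lN : `]l, u[ `<=` N.
  move=> y /=; rewrite in_itv/= /l /u lt_min gt_max => /andP[/andP[y0 ly] /andP[y1 yu]].
  apply: sN => /= H.
  have y01 : 0 <= y <= 1 by rewrite !ltW.
  have xy : `|x - y| < Num.min r1 r2 by rewrite ltr_norml; apply/andP; split; lra.
  have [xy1 xy2] : `|x - y| < r1 /\ `|x - y| < r2.
    by move: xy; rewrite lt_min => /andP[].
  have := h1 y y01 xy1; have := h2 y y01 xy2; rewrite H ?in_itv/= ?y0//.
  have : `|f x - g x| <= `|f x - g y| + `|g x - g y|.
    rewrite -(normrN (g x - _)) (le_trans _ (ler_normD _ _))//.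
    by rewrite (_ : f x - g x = f x - g y - (g x - g y) + (g y - g y)) ?subrr ?addr0//; ring.
  by move: e0; lra.
have := le_measure mu _ _ lN; rewrite !inE => /(_ (measurable_itv _) mN).
rewrite /= N0 lebesgue_measure_itv/= lte_fin lu -EFinB lee_fin; lra.
Qed.

Lemma taylor_continuous m p g : square_integrable g ->
  {within I01, continuous taylor_fun m.+1 p g}.
Proof.
move=> sg; apply: (@within_continuousD _ _ _ _ (horner p) (Jint m.+1 g)).
  by apply: continuous_subspaceT; exact: horner_continuous.
exact: Jint_continuous.
Qed.

(** Taylor's formula in the Sobolev space. *)
Lemma sobolev_taylor m h : sobolev m.+1 h -> exists2 p : {poly R}, (size p <= m.+1)%N &
  forall t, 0 <= t <= 1 -> h t = taylor_fun m.+1 p (wderiv m.+1 h) t.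
Proof.
move=> [ch sh wh sg]; set g := wderiv m.+1 h in sg *.
have [lg hg] : is_weak_derivative m.+1 h g by apply: wderivP; apply: wh; rewrite ltnSn.
have sJ := Jint_square_integrable m.+1 sg.
have [phi tphi|p sp hp] := @du_bois_reymond m.+1 (fun x => h x - Jint m.+1 g x) (square_integrableB sh sJ).
  have sphi := test_square_integrable (test_derive1n m.+1 tphi).
  transitivity (\int[mu]_(x in `[0, 1]) (h x * derive1n m.+1 phi x) -
     \int[mu]_(x in `[0, 1]) (taylor_fun m.+1 0 g x * derive1n m.+1 phi x)).
    rewrite -RintegralB//; first by apply: eq_Rintegral => x _; rewrite mulrBl /taylor_fun horner0 add0r.
      exact: square_integrableM.
    by apply: square_integrableM => //; exact: taylor_square_integrable.
  rewrite taylor_by_parts// hg// subnn -mulrBr -[X in _ * (X - _)]/(Rintegral _ _ _).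
  rewrite [X in _ * X](_ : _ = 0) ?mulr0//; apply/eqP; rewrite subr_eq0; apply/eqP.
  by apply: eq_Rintegral => x _; rewrite /taylor_fun linear0 horner0 add0r.
exists p => //; apply: continuous_ae_eq => //; first exact: taylor_continuous.
by apply: ae_imp hp => x hx /hx e; rewrite /taylor_fun -e subrK.
Qed.

Lemma taylor_sobolev m p g : square_integrable g -> sobolev m.+1 (taylor_fun m.+1 p g).
Proof.
move=> sg; split.
- exact: taylor_continuous.
- exact: taylor_square_integrable.
- move=> j /andP[_ jm]; exists (taylor_fun (m.+1 - j) p^`(j) g).
  exact: taylor_weak_derivative.
have W := taylor_weak_derivative p (leqnn m.+1) sg.
have [[mw _ _] _] := wderivP (ex_intro _ _ W).
apply: (@ae_square_integrable _ (taylor_fun (m.+1 - m.+1) p^`(m.+1) g)).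
- exact: (measurable_fun_itv_cc mw).
- by apply: ae_imp (wderiv_ae W) => x h /h ->.
- exact: taylor_square_integrable.
Qed.

Lemma taylor_wderiv m p g : (size p <= m)%N -> square_integrable g ->
  {ae mu, forall x, x \in `]0, 1[ -> wderiv m (taylor_fun m p g) x = g x}.
Proof.
move=> sp sg; apply: ae_imp (wderiv_ae (taylor_weak_derivative p (leqnn m) sg)) => x h /h ->.
by rewrite subnn /taylor_fun/= (derivn_poly0 sp) horner0 add0r.
Qed.

End DuBoisReymond.

(** * The Sobolev space and its boundary operators *)

Section SobolevSpace.
Context {R : realType}.
Local Notation mu := (@lebesgue_measure R).
Local Notation I01 := (`[0, 1]%classic : set R).
Implicit Types (f g h u v : R -> R) (a t x y : R) (j k m : nat) (p q : {poly R}).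

Lemma weak_derivative_ext j h h' g : (forall t, 0 <= t <= 1 -> h t = h' t) ->
  is_weak_derivative j h g -> is_weak_derivative j h' g.
Proof.
move=> hh' [lg hg]; split => // phi tphi; rewrite -hg//.
by apply: eq_Rintegral => t; rewrite inE/= in_itv/= => t01; rewrite hh'.
Qed.

Lemma wderiv_ext j h h' : (forall t, 0 <= t <= 1 -> h t = h' t) ->
  wderiv j h = wderiv j h'.
Proof.
move=> hh'; rewrite /wderiv; congr xget; apply/seteqP; split => g /=.
  exact: weak_derivative_ext.
by apply: weak_derivative_ext => t t01; rewrite hh'.
Qed.

Lemma square_integrable_ext f g : (forall t, 0 <= t <= 1 -> f t = g t) ->
  square_integrable f -> square_integrable g.
Proof.
move=> fg [mf if2]; split.
  by apply: eq_measurable_fun mf => x; rewrite inE/= in_itv/= => /fg.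
by apply: (@eq_integrableR _ (measurableTypeR R)) if2 => //= x; rewrite in_itv/= => /fg ->.
Qed.

Lemma sobolev_ext m h h' : (forall t, 0 <= t <= 1 -> h t = h' t) ->
  sobolev m h -> sobolev m h'.
Proof.
move=> hh' [ch sh wh sg]; split.
- exact: eq_within_continuous ch.
- exact: square_integrable_ext sh.
- by move=> j /wh[g hg]; exists g; exact: weak_derivative_ext hg.
- by rewrite -(wderiv_ext m hh').
Qed.

Lemma Jint_cst0 k t : Jint k (cst 0) t = 0 :> R.
Proof. by case: k => // k; rewrite JintS dotC dot0l. Qed.

Lemma taylor_fun_lin m a p q f g t : t <= 1 -> square_integrable f -> square_integrable g ->
  taylor_fun m (a *: p + q) (fun x => a * f x + g x) t =
  a * taylor_fun m p f t + taylor_fun m q g t.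
Proof. by move=> t1 sf sg; rewrite /taylor_fun Jint_lin// hornerD hornerZ; ring. Qed.

(** The space H^(m + 1) consists of the sums of a polynomial of degree at most m
    and of an (m + 1)-th iterated integral of a square integrable function, up to
    the values outside [0, 1]. *)
Lemma sobolevP m h : sobolev m.+1 h <-> exists p g, [/\ (size p <= m.+1)%N,
  square_integrable g & forall t, 0 <= t <= 1 -> h t = taylor_fun m.+1 p g t].
Proof.
split=> [sh|[p [g [sp sg e]]]].
  have [p sp e] := sobolev_taylor sh; exists p, (wderiv m.+1 h); split => //.
  by case: sh.
by apply: (sobolev_ext (h := taylor_fun m.+1 p g)) => [t /e|]//; exact: taylor_sobolev.
Qed.

Lemma sobolev_lin m a u v : sobolev m.+1 u -> sobolev m.+1 v ->
  sobolev m.+1 (fun x => a * u x + v x).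
Proof.
move=> /sobolevP[p [f [sp sf eu]]] /sobolevP[q [g [sq sg ev]]].
apply/sobolevP; exists (a *: p + q), (fun x => a * f x + g x); split.
- rewrite (leq_trans (size_polyD _ _))// geq_max sq andbT.
  exact: leq_trans (size_scale_leq _ _) sp.
- exact: square_integrable_lin.
- by move=> t t01; rewrite taylor_fun_lin ?eu ?ev//; case/andP: t01.
Qed.

Lemma sobolevB m u v : sobolev m.+1 u -> sobolev m.+1 v -> sobolev m.+1 (u \- v).
Proof.
move=> su sv; rewrite (_ : u \- v = fun x => -1 * v x + u x); first exact: sobolev_lin.
by apply/funext => x /=; rewrite mulN1r addrC.
Qed.

Lemma sobolev0 m : sobolev m.+1 (cst 0 : R -> R).
Proof.
apply/sobolevP; exists 0, (cst 0); split; first by rewrite size_poly0.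
  exact: square_integrable_cst.
by move=> t _; rewrite /taylor_fun horner0 Jint_cst0 addr0.
Qed.

Lemma sobolev_poly m p : (size p <= m.+1)%N -> sobolev m.+1 (horner p).
Proof.
move=> sp; apply/sobolevP; exists p, (cst 0); split => //.
  exact: square_integrable_cst.
by move=> t _; rewrite /taylor_fun Jint_cst0 addr0.
Qed.

Lemma sobolev_Jint m g : square_integrable g -> sobolev m.+1 (Jint m.+1 g).
Proof.
move=> sg; apply/sobolevP; exists 0, g; split => //; first by rewrite size_poly0.
by move=> t _; rewrite /taylor_fun horner0 add0r.
Qed.

Lemma sobolev_wderiv_ae m h p g : (size p <= m)%N -> square_integrable g ->
  (forall t, 0 <= t <= 1 -> h t = taylor_fun m p g t) ->
  {ae mu, forall x, x \in `]0, 1[ -> wderiv m h x = g x}.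
Proof. by move=> sp sg e; rewrite (wderiv_ext m e); exact: taylor_wderiv. Qed.

Lemma sobolev_wderiv_si m h : sobolev m h -> square_integrable (wderiv m h).
Proof. by case. Qed.

Lemma ae_dot_eq f f' g g' : measurable_fun I01 f -> measurable_fun I01 f' ->
  measurable_fun I01 g -> measurable_fun I01 g' ->
  {ae mu, forall x, x \in `]0, 1[ -> f x = f' x} ->
  {ae mu, forall x, x \in `]0, 1[ -> g x = g' x} -> dot f g = dot f' g'.
Proof.
move=> mf mf' mg mg' ff' gg'; apply: ae_Rintegral_eq.
- exact: measurable_funM.
- exact: measurable_funM.
- by apply: ae_imp2 ff' gg' => x a b xI; rewrite a ?b.
Qed.

Lemma sqr_sum_le n (z : 'I_n -> R) : (\sum_(i < n) z i) ^+ 2 <= n%:R * \sum_(i < n) z i ^+ 2.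
Proof.
elim: n z => [|n IH] z; first by rewrite !big_ord0 expr0n mulr0.
rewrite !big_ord_recl; set x := z ord0.
set S := \sum_(i < n) z _; set T := \sum_(i < n) _.
have ST : S ^+ 2 <= n%:R * T := IH (fun i => z (lift ord0 i)).
have T0 : 0 <= T by apply: sumr_ge0 => i _; exact: sqr_ge0.
have [n0|n0] := posnP n.
  have S0 : S = 0.
    by apply/eqP; rewrite -sqrf_eq0 eq_le sqr_ge0 andbT (le_trans ST)// n0 mul0r.
  by rewrite S0 n0 addr0 mul1r lerDl.
have n1 : 0 < n%:R :> R by rewrite ltr0n.
have h : 0 <= n%:R * (n%:R * x ^+ 2 + T - 2 * x * S).
  have := sqr_ge0 (n%:R * x - S); nra.
have {}h : 0 <= n%:R * x ^+ 2 + T - 2 * x * S by move: h; rewrite pmulr_rge0.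
rewrite -natr1; nra.
Qed.

End SobolevSpace.

Section BoundaryOperator.
Context {R : realType}.
Local Notation mu := (@lebesgue_measure R).
Local Notation I01 := (`[0, 1]%classic : set R).
Implicit Types (f g h u v : R -> R) (a t x y : R) (p q : {poly R}).
Variables (m : nat) (B : 'I_m.+1 -> (R -> R) -> R) (hB : boundary_operator B).
Local Notation sob := (sobolev m.+1).

Lemma boundary0 j : B j (cst 0) = 0.
Proof.
have := boundary_linear hB (-1) (sobolev0 m) (sobolev0 m) j.
rewrite (_ : (fun x => _) = cst 0); first by rewrite mulN1r addNr.
by apply/funext => x /=; rewrite mulr0 addr0.
Qed.

Lemma boundaryB j u v : sob u -> sob v -> B j (u \- v) = B j u - B j v.
Proof.
move=> su sv; rewrite (_ : u \- v = fun x => -1 * v x + u x).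
  by rewrite (boundary_linear hB)// mulN1r addrC.
by apply/funext => x /=; rewrite mulN1r addrC.
Qed.

Lemma boundary_sum j n (c : 'I_n -> R) (F : 'I_n -> R -> R) : (forall i, sob (F i)) ->
  sob (fun x => \sum_(i < n) c i * F i x) /\
  B j (fun x => \sum_(i < n) c i * F i x) = \sum_(i < n) c i * B j (F i).
Proof.
elim: n c F => [|n IH] c F sF.
  under eq_fun do rewrite big_ord0; rewrite big_ord0 -[X in sob X]/(cst 0) -[X in B j X]/(cst 0).
  by rewrite boundary0; split => //; exact: sobolev0.
have [s e] := IH (fun i => c (lift ord0 i)) (fun i => F (lift ord0 i)) (fun i => sF _).
under eq_fun do rewrite big_ord_recl; rewrite big_ord_recl -e.
by split; [exact: sobolev_lin|exact: (boundary_linear hB)].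
Qed.

(** The weak derivatives of J_(m + 1) g up to order m + 1 are dominated by g. *)
Lemma L2sqnorm_wderiv_Jint g j : square_integrable g -> (j <= m.+1)%N ->
  L2sqnorm (wderiv j (Jint m.+1 g)) <= L2sqnorm g.
Proof.
move=> sg jm.
have W := taylor_weak_derivative 0 jm sg.
have e0 k : taylor_fun k 0 g = Jint k g.
  by apply/funext => t; rewrite /taylor_fun horner0 add0r.
have [[mw _ _] _] := wderivP (ex_intro _ _ W).
have ae := wderiv_ae W; rewrite linear0 !e0 in mw ae.
have sJ := Jint_square_integrable (m.+1 - j) sg.
have -> : L2sqnorm (wderiv j (Jint m.+1 g)) = L2sqnorm (Jint (m.+1 - j) g).
  rewrite !L2sqnormE; apply: ae_dot_eq => //; try exact: (measurable_fun_itv_cc mw).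
    by case: sJ.
  by case: sJ.
case: (m.+1 - j)%N sJ => [//|k] sJ.
rewrite -(sqr_sqrtr (L2sqnorm_ge0 g)); apply: L2sqnorm_bounded; first by case: sJ.
move=> t t01; rewrite -(ler_pXn2r (n := 2)) ?nnegrE ?sqrtr_ge0//.
by rewrite sqr_sqrtr ?L2sqnorm_ge0// real_normK ?num_real// Jint_bound.
Qed.

Lemma sobolev_norm_Jint g : square_integrable g ->
  sobolev_norm m.+1 (Jint m.+1 g) <= Num.sqrt (m.+2%:R * L2sqnorm g).
Proof.
move=> sg; rewrite /sobolev_norm ler_sqrt ?mulr_ge0 ?L2sqnorm_ge0//.
rewrite -natr1 mulrDl mul1r addrC lerD//.
  apply: (@le_trans _ _ (\sum_(1 <= j < m.+2) L2sqnorm g)).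
    rewrite big_nat [leRHS]big_nat; apply: ler_sum => j /andP[_ jm].
    exact: L2sqnorm_wderiv_Jint.
  by rewrite sumr_const_nat subn1 mulr_natl.
rewrite -[leRHS](sqr_sqrtr (L2sqnorm_ge0 g)); apply: L2sqnorm_bounded.
  by case: (Jint_square_integrable m.+1 sg).
move=> t t01; rewrite -(ler_pXn2r (n := 2)) ?nnegrE ?sqrtr_ge0//.
by rewrite sqr_sqrtr ?L2sqnorm_ge0// real_normK ?num_real// Jint_bound.
Qed.

Lemma sobolev_norm_ext h h' : (forall t, 0 <= t <= 1 -> h t = h' t) ->
  sobolev_norm m.+1 h = sobolev_norm m.+1 h'.
Proof.
move=> e; rewrite /sobolev_norm.
have -> : L2sqnorm h = L2sqnorm h'.
  by apply: eq_Rintegral => t; rewrite inE/= in_itv/= => /e ->.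
have E : wderiv^~ h = wderiv^~ h' by apply/funext => j; exact: wderiv_ext.
exact: (congr1 (fun D : nat -> R -> R =>
  Num.sqrt (L2sqnorm h' + \sum_(1 <= j < m.+2) L2sqnorm (D j))) E).
Qed.

(** The values of a function outside [0, 1] are invisible to B, because B is
    continuous and two functions that agree on [0, 1] are at distance 0. *)
Lemma boundary_ext u v j : sob u -> (forall t, 0 <= t <= 1 -> u t = v t) -> B j u = B j v.
Proof.
move=> su uv; have sv := sobolev_ext uv su.
apply/eqP; rewrite eq_sym -subr_eq0 -normr_le0; apply/ler_addgt0Pr => e e0; rewrite add0r.
have [r r0 hr] := boundary_continuous hB su e0.
apply/ltW/hr => //; apply: le_lt_trans r0.
rewrite (@sobolev_norm_ext _ (Jint m.+1 (cst 0))).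
  apply: (le_trans (sobolev_norm_Jint (square_integrable_cst 0))).
  by rewrite L2sqnormE dot0l mulr0 sqrtr0.
by move=> t t01; rewrite Jint_cst0 /= uv// subrr.
Qed.

Lemma boundary_Jint_lin j a f g : square_integrable f -> square_integrable g ->
  B j (Jint m.+1 (fun x => a * f x + g x)) = a * B j (Jint m.+1 f) + B j (Jint m.+1 g).
Proof.
move=> sf sg; rewrite -(boundary_linear hB); [|exact: sobolev_Jint|exact: sobolev_Jint].
apply: boundary_ext; first by apply: sobolev_Jint; exact: square_integrable_lin.
by move=> t /andP[_ t1]; rewrite Jint_lin.
Qed.

Lemma L2sqnormZ a g : square_integrable g -> L2sqnorm (fun x => a * g x) = a ^+ 2 * L2sqnorm g.
Proof.
move=> [_ ig]; rewrite /L2sqnorm -RintegralZl//.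
by apply: eq_Rintegral => x _; rewrite exprMn.
Qed.

(** A continuous linear operator is bounded; the argument g is rescaled to enter
    the neighbourhood of 0 given by continuity. *)
Lemma boundary_Jint_bound : exists2 K : R, 0 <= K & forall g j,
  square_integrable g -> B j (Jint m.+1 g) ^+ 2 <= K * L2sqnorm g.
Proof.
have [r r0 hr] := boundary_continuous hB (sobolev0 m) ltr01.
pose N : R := m.+2%:R; have N0 : 0 < N by rewrite ltr0n.
exists (N * 4 / r ^+ 2); first by rewrite divr_ge0 ?mulr_ge0 ?sqr_ge0 ?ltW.
move=> g j sg; have s0 := L2sqnorm_ge0 g; set s := L2sqnorm g in s0 *.
have r20 : 0 < r ^+ 2 by rewrite exprn_gt0.
suff H d : 0 < d -> B j (Jint m.+1 g) ^+ 2 <= N * 4 / r ^+ 2 * (s + d).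
  apply/ler_addgt0Pr => e e0.
  have := H (e / (N * 4 / r ^+ 2)); rewrite !divr_gt0 ?mulr_gt0// => /(_ isT).
  by rewrite mulrDr mulrCA mulfV ?mulr1// gt_eqF// divr_gt0// mulr_gt0.
move=> d0; pose D := Num.sqrt (N * (s + d)).
have sd : 0 < s + d by rewrite ltr_wpDl.
have D0 : 0 < D by rewrite sqrtr_gt0 mulr_gt0.
have D2 : D ^+ 2 = N * (s + d) by rewrite sqr_sqrtr// ltW// mulr_gt0.
(* the scaling a makes the norm of J (a g) at most r / 2 *)
pose a := r / 2 / D; have a0 : 0 < a by rewrite !divr_gt0.
have sag : square_integrable (fun x => a * g x + cst 0 x).
  by apply: square_integrable_lin => //; exact: square_integrable_cst.
have BJ : B j (Jint m.+1 (fun x => a * g x + cst 0 x)) = a * B j (Jint m.+1 g).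
  rewrite boundary_Jint_lin//; last exact: square_integrable_cst.
  rewrite (_ : Jint m.+1 (cst 0) = cst 0) ?boundary0 ?addr0//.
  by apply/funext => t; rewrite Jint_cst0.
have eag : (fun x => a * g x + cst 0 x) = (fun x => a * g x).
  by apply/funext => x /=; rewrite addr0.
have a2 : a ^+ 2 * (N * (s + d)) = r ^+ 2 / 4.
  rewrite -D2 /a; have Dn0 : D != 0 by rewrite gt_eqF.
  by field.
have lt1 : `|a * B j (Jint m.+1 g)| < 1.
  rewrite -BJ; have := hr _ (sobolev_Jint m sag) _ j; rewrite boundary0 subr0; apply.
  rewrite (_ : _ \- _ = Jint m.+1 (fun x => a * g x + cst 0 x)); last first.
    by apply/funext => t /=; rewrite subr0.
  apply: (le_lt_trans (sobolev_norm_Jint sag)).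
  rewrite eag L2sqnormZ// -/s -/N -[ltRHS](ger0_norm (ltW r0)) -sqrtr_sqr ltr_sqrt//.
  have := sqr_ge0 a; move: (a ^+ 2) a2 => X a2 X0.
  by have := mulr_ge0 (mulr_ge0 X0 (ltW N0)) (ltW d0); nra.
have {}lt1 : a ^+ 2 * B j (Jint m.+1 g) ^+ 2 <= 1.
  by rewrite -exprMn -real_normK ?num_real// exprn_ile1// ltW.
rewrite mulrAC ler_pdivlMr//.
have -> : r ^+ 2 = 4 * (a ^+ 2 * (N * (s + d))) by rewrite a2; field.
have -> : N * 4 * (s + d) = 4 * N * (s + d) * 1 by ring.
have -> : B j (Jint m.+1 g) ^+ 2 * (4 * (a ^+ 2 * (N * (s + d)))) =
  4 * N * (s + d) * (a ^+ 2 * B j (Jint m.+1 g) ^+ 2) by ring.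
by rewrite ler_wpM2l// !mulr_ge0// ltW.
Qed.

(** The matrix of B on the monomials of degree at most m. *)
Definition boundary_mx : 'M[R]_m.+1 := \matrix_(i, j) B j (horner 'X^i).

Lemma boundary_poly j p : (size p <= m.+1)%N ->
  B j (horner p) = \sum_(i < m.+1) p`_i * boundary_mx i j.
Proof.
move=> sp.
have sX (i : 'I_m.+1) : sob (horner ('X^i : {poly R})) by apply: sobolev_poly; rewrite size_polyXn.
transitivity (B j (fun x => \sum_(i < m.+1) p`_i * horner ('X^i : {poly R}) x)).
  congr (B j); apply/funext => x; rewrite (horner_coef_wide x sp).
  by apply: eq_bigr => i _; rewrite hornerXn.
have [_ ->] := boundary_sum j (fun i : 'I_m.+1 => p`_i) sX.
by apply: eq_bigr => i _; rewrite mxE.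
Qed.

Lemma boundary_mx_unit : boundary_mx \in unitmx.
Proof.
rewrite -row_free_unit -kermx_eq0; apply/eqP/row_matrixP => i; rewrite row0.
set c := row i _; have : c *m boundary_mx = 0.
  by apply/eqP; rewrite -sub_kermx row_sub.
move: c => c c0; pose p := \poly_(i < m.+1) c 0 (inord i).
have sp : (size p <= m.+1)%N by exact: size_poly.
have pi (k : 'I_m.+1) : p`_k = c 0 k by rewrite coef_poly ltn_ord inord_val.
have p0 : p = 0.
  apply: (boundary_ker_poly hB sp) => j; rewrite boundary_poly//.
  have /matrixP/(_ 0 j) := c0; rewrite !mxE => e; rewrite -[RHS]e.
  by apply: eq_bigr => k _; rewrite pi mxE.
by apply/rowP => k; rewrite mxE -pi p0 coef0.
Qed.

(** As B is injective on polynomials, it controls their coefficients. *)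
Lemma taylor_coef_bound : exists2 C : R, 0 <= C & forall p, (size p <= m.+1)%N ->
  forall i : 'I_m.+1, p`_i ^+ 2 <= C * \sum_j B j (horner p) ^+ 2.
Proof.
pose W := invmx boundary_mx.
exists (m.+1%:R * \sum_i \sum_j W j i ^+ 2).
  by rewrite mulr_ge0// sumr_ge0// => i _; rewrite sumr_ge0// => j _; exact: sqr_ge0.
move=> p sp i; pose b := \sum_j B j (horner p) ^+ 2; rewrite -/b.
have -> : p`_i = \sum_j B j (horner p) * W j i.
  have : (\row_k p`_k) *m boundary_mx *m W = \row_k p`_k.
    by rewrite -mulmxA mulmxV ?mulmx1//; exact: boundary_mx_unit.
  move/matrixP/(_ 0 i); rewrite [RHS]mxE => <-; rewrite mxE.
  apply: eq_bigr => j _; rewrite boundary_poly// mxE; congr (_ * _).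
  by apply: eq_bigr => k _; rewrite mxE.
rewrite (le_trans (sqr_sum_le _))// -mulrA ler_wpM2l//.
have b0 : 0 <= b by apply: sumr_ge0 => j _; exact: sqr_ge0.
rewrite [X in _ <= X * _](bigD1 i)//= mulrDl -[leLHS]addr0 lerD//; last first.
  by rewrite mulr_ge0// sumr_ge0// => k _; rewrite sumr_ge0// => j _; exact: sqr_ge0.
rewrite mulr_suml; apply: ler_sum => j _; rewrite exprMn mulrC ler_wpM2l ?sqr_ge0//.
by rewrite /b (bigD1 j)//= lerDl sumr_ge0// => k _; exact: sqr_ge0.
Qed.

(** The inner product of H^(m + 1) in terms of the functions under the iterated
    integrals. *)
Lemma sobolev_dot_taylor u v p q f g : (size p <= m.+1)%N -> (size q <= m.+1)%N ->
  square_integrable f -> square_integrable g ->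
  (forall t, 0 <= t <= 1 -> u t = taylor_fun m.+1 p f t) ->
  (forall t, 0 <= t <= 1 -> v t = taylor_fun m.+1 q g t) ->
  sobolev_dot B u v = dot f g + \sum_j B j u * B j v.
Proof.
move=> sp sq sf sg eu ev; rewrite /sobolev_dot; congr (_ + _).
have su : sob u by apply/sobolevP; exists p, f.
have sv : sob v by apply/sobolevP; exists q, g.
apply: ae_dot_eq; try by [case: sf | case: sg].
- by have [] := sobolev_wderiv_si su.
- by have [] := sobolev_wderiv_si sv.
- exact: sobolev_wderiv_ae eu.
- exact: sobolev_wderiv_ae ev.
Qed.

Lemma boundary_taylor j h p g : (size p <= m.+1)%N -> square_integrable g ->
  (forall t, 0 <= t <= 1 -> h t = taylor_fun m.+1 p g t) ->
  B j h = B j (horner p) + B j (Jint m.+1 g).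
Proof.
move=> sp sg e; rewrite -[X in X + _]mul1r -(boundary_linear hB); [|exact: sobolev_poly|exact: sobolev_Jint].
apply: boundary_ext; first by apply/sobolevP; exists p, g.
by move=> t t01; rewrite e// mul1r.
Qed.

Lemma sqrD_le (x y : R) : (x + y) ^+ 2 <= 2 * x ^+ 2 + 2 * y ^+ 2.
Proof. by have := sqr_ge0 (x - y); nra. Qed.

(** Evaluations are bounded for the norm attached to B. *)
Lemma evaluation_bound : exists2 C : R, 0 <= C & forall h t, sob h ->
  0 <= t <= 1 -> h t ^+ 2 <= C * sobolev_dot B h h.
Proof.
have [K K0 hK] := boundary_Jint_bound; have [C C0 hC] := taylor_coef_bound.
exists (2 * (m.+1%:R * (m.+1%:R * (C * (2 + m.+1%:R * (2 * K))))) + 2).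
  by rewrite addr_ge0// !(mulr_ge0, addr_ge0).
move=> h t sh t01; have /sobolevP[p [g [sp sg e]]] := sh.
rewrite (sobolev_dot_taylor sp sp sg sg e e).
set s := dot g g; have s0 : 0 <= s by exact: dot_ge0.
have hs : L2sqnorm g = s by exact: L2sqnormE.
pose b := \sum_j B j h ^+ 2.
have -> : \sum_j B j h * B j h = b by apply: eq_bigr => j _; rewrite expr2.
have b0 : 0 <= b by apply: sumr_ge0 => j _; exact: sqr_ge0.
rewrite e// (le_trans (sqrD_le _ _))// [leRHS]mulrDl lerD//; last first.
  by rewrite ler_wpM2l// (le_trans (Jint_bound m t01 sg))// hs lerDl.
rewrite -mulrA ler_wpM2l//.
have bp : \sum_j B j (horner p) ^+ 2 <= 2 * b + m.+1%:R * (2 * K) * s.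
  apply: (@le_trans _ _ (\sum_j (2 * B j h ^+ 2 + 2 * (K * s)))).
    apply: ler_sum => j _; have := boundary_taylor j sp sg e => ej.
    have -> : B j (horner p) = B j h + - B j (Jint m.+1 g) by rewrite ej addrK.
    by rewrite (le_trans (sqrD_le _ _))// lerD2l sqrrN ler_wpM2l// -hs hK.
  by rewrite big_split/= -mulr_sumr sumr_const card_ord -[X in _ + X]mulr_natl !mulrA.
rewrite (horner_coef_wide t sp) (le_trans (sqr_sum_le _))// -!mulrA ler_wpM2l//.
apply: (@le_trans _ _ (\sum_(i < m.+1) (C * (2 * b + m.+1%:R * (2 * K) * s)))).
  apply: ler_sum => i _; rewrite exprMn.
  apply: (@le_trans _ _ (p`_i ^+ 2 * 1)).
    have /andP[t0 t1] := t01; rewrite ler_wpM2l ?sqr_ge0// -exprM exprn_ile1//.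
  by rewrite mulr1 (le_trans (hC p sp i))// ler_wpM2l.
rewrite sumr_const card_ord -[leLHS]mulr_natl ler_wpM2l// ler_wpM2l//.
rewrite [leRHS]mulrDl lerD//; first by rewrite ler_wpM2l// lerDr.
by rewrite -!mulrA !ler_wpM2l// lerDl.
Qed.

(** Conversely, the norm attached to B is controlled by the coefficients of the
    polynomial and the L2 norm of the highest derivative. *)
Lemma sobolev_dot_bound : exists2 C : R, 0 <= C & forall h p g,
  (size p <= m.+1)%N -> square_integrable g ->
  (forall t, 0 <= t <= 1 -> h t = taylor_fun m.+1 p g t) ->
  sobolev_dot B h h <= C * (\sum_(i < m.+1) p`_i ^+ 2 + L2sqnorm g).
Proof.
have [K K0 hK] := boundary_Jint_bound.
pose b2 := \sum_j \sum_(i < m.+1) boundary_mx i j ^+ 2.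
have b20 : 0 <= b2 by rewrite sumr_ge0// => i _; rewrite sumr_ge0// => j _; exact: sqr_ge0.
exists (1 + m.+1%:R * (2 * (m.+1%:R * b2) + 2 * K)).
  by rewrite !(mulr_ge0, addr_ge0).
move=> h p g sp sg e; rewrite (sobolev_dot_taylor sp sp sg sg e e) -L2sqnormE.
set s := L2sqnorm g; have s0 : 0 <= s by exact: L2sqnorm_ge0.
pose c := \sum_(i < m.+1) p`_i ^+ 2; rewrite -/c; have c0 : 0 <= c by apply: sumr_ge0 => i _; exact: sqr_ge0.
rewrite mulrDl mul1r lerD ?lerDr//.
apply: (@le_trans _ _ (\sum_(j < m.+1) ((2 * (m.+1%:R * b2) + 2 * K) * (c + s)))); last first.
  by rewrite sumr_const card_ord -[leLHS]mulr_natl mulrA.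
apply: ler_sum => j _; rewrite -expr2 (boundary_taylor j sp sg e).
rewrite (le_trans (sqrD_le _ _))// [leRHS]mulrDl lerD//; last first.
  rewrite -mulrA ler_wpM2l// (le_trans (hK g j sg))// ler_wpM2l// lerDr//.
rewrite -mulrA ler_wpM2l// boundary_poly// (le_trans (sqr_sum_le _))// -mulrA ler_wpM2l//.
have bj : \sum_(i < m.+1) boundary_mx i j ^+ 2 <= b2.
  rewrite /b2 [leRHS](bigD1 j)//= lerDl sumr_ge0// => i _; rewrite sumr_ge0// => k _; exact: sqr_ge0.
have cs : c <= c + s by rewrite lerDl.
apply: (@le_trans _ _ (\sum_(i < m.+1) boundary_mx i j ^+ 2 * (c + s))).
  apply: ler_sum => i _; rewrite exprMn mulrC ler_wpM2l ?sqr_ge0//.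
  apply: le_trans cs; rewrite /c (bigD1 i)//= lerDl sumr_ge0// => k _; exact: sqr_ge0.
by rewrite -mulr_suml ler_wpM2r// addr_ge0.
Qed.

End BoundaryOperator.

(** * The Cholesky factor of the spline matrix is invertible *)

Section Cholesky.
Context {R : realType}.

(** Symmetric positive definite matrices. *)
Definition posdefmx n (A : 'M[R]_n) : Prop :=
  A^T = A /\ forall u : 'cV[R]_n, u != 0 -> 0 < (u^T *m A *m u) 0 0.

(** By induction, with the Schur complement of the first entry. *)
Lemma posdef_cholesky n (A : 'M[R]_n) : posdefmx A ->
  exists Q : 'M[R]_n, [/\ is_trig_mx Q^T, (forall i, 0 < Q i i) & Q^T *m Q = A].
Proof.
elim: n A => [|n IH] A [symA posA].
  exists A; split; [|by case|by rewrite [LHS]flatmx0 [RHS]flatmx0].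
  by apply/is_trig_mxP; case.
pose A' : 'M[R]_(1 + n) := A.
pose a := A 0 0; pose b : 'rV[R]_n := ursubmx A'.
have dlb : dlsubmx A' = b^T.
  by rewrite /b trmx_ursub (_ : A'^T = A').
have ula : ulsubmx A' = a%:M.
  by rewrite [LHS]mx11_scalar !mxE; congr (A _ _)%:M; apply/val_inj.
have eA : A' = block_mx a%:M b b^T (drsubmx A').
  by rewrite -ula -dlb submxK.
have posA' (u : 'cV[R]_(1 + n)) : u != 0 -> 0 < (u^T *m A' *m u) 0 0 by exact: posA.
have a0 : 0 < a.
  pose e : 'cV[R]_(1 + n) := col_mx 1 0.
  have e0 : e != 0.
    apply/eqP => /matrixP/(_ 0 0); rewrite !mxE; case: splitP => // k _.
    by rewrite !mxE !ord1 eqxx /= => /eqP; rewrite oner_eq0.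
  have := posA' e e0; rewrite eA tr_col_mx trmx1 trmx0 mul_row_block.
  rewrite !mul0mx !mul1mx !addr0 mul_row_col mulmx0 mulmx1 addr0.
  by rewrite !mxE eqxx mulr1n.
pose S : 'M[R]_n := drsubmx A' - a^-1 *: (b^T *m b).
have [|L [tL dL LL]] := IH S.
  split.
    rewrite /S linearB linearZ/= trmx_mul trmxK; congr (_ - _).
    by rewrite trmx_drsub (_ : A'^T = A').
  move=> y y0; pose w := b *m y; pose x : 'cV[R]_(1 + n) := col_mx (- a^-1 *: w) y.
  have x0 : x != 0.
    by apply: contra y0 => /eqP; rewrite -[0]vsubmxK => /eq_col_mx[_ ->]; rewrite linear0.
  have wT : y^T *m b^T = w^T by rewrite trmx_mul.
  have := posA' x x0; congr (0 < fun_of_matrix _ _ _).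
  rewrite eA /x tr_col_mx mul_row_block mul_row_col (_ : (_ *: w)^T = - a^-1 *: w^T); last first.
    by rewrite linearZ.
  rewrite mul_mx_scalar wT scalerA mulrN mulfV ?gt_eqF// scaleN1r addNr mul0mx add0r.
  rewrite mulmxDl -!scalemxAl -(mulmxA w^T b y) -/w /S mulmxBr mulmxBl -scalemxAr -scalemxAl.
  by rewrite (mulmxA y^T b^T b) wT -(mulmxA w^T b y) -/w addrC scaleNr.
have sa0 : 0 < Num.sqrt a by rewrite sqrtr_gt0.
suff : exists Q : 'M[R]_(1 + n), [/\ is_trig_mx Q^T, (forall i, 0 < Q i i) & Q^T *m Q = A'] by [].
exists (block_mx (Num.sqrt a)%:M ((Num.sqrt a)^-1 *: b) 0 L : 'M[R]_(1 + n)); split.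
- rewrite tr_block_mx is_trig_block_mx// trmx0 eqxx/= tL andbT.
  by apply/is_trig_mxP => i j; rewrite !ord1.
- move=> i; rewrite -(splitK i).
  case: (fintype.split _) => k /=; first by rewrite block_mxEul !mxE !ord1 eqxx mulr1n.
  by rewrite block_mxEdr.
- rewrite tr_block_mx mulmx_block trmx0 !mul0mx !addr0 -[RHS]/A' eA.
  rewrite tr_scalar_mx !mulmx0 !addr0 -scalar_mxM -expr2 sqr_sqrtr ?ltW//.
  rewrite mul_scalar_mx scalerA mulfV ?gt_eqF// scale1r linearZ/=.
  rewrite -[_ *: b^T *m _]scalemxAl mul_mx_scalar scalerA mulVf ?gt_eqF// scale1r.
  congr (block_mx _ _ _ _); rewrite LL /S -scalemxAl -scalemxAr scalerA.
  by rewrite -invfM -expr2 sqr_sqrtr ?ltW// addrC subrK.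
Qed.

Lemma cholesky_unit n (A : 'M[R]_n) : posdefmx A -> cholesky_tr A \in unitmx.
Proof.
move=> /posdef_cholesky exQ.
have [tQ dQ _] : [/\ is_trig_mx (cholesky_tr A)^T, (forall i, 0 < cholesky_tr A i i) &
    (cholesky_tr A)^T *m cholesky_tr A = A].
  exact: (@xgetPex _ 0 _ exQ).
rewrite -unitmx_tr unitmxE det_trig//; under eq_bigr do rewrite mxE.
by rewrite unitfE gt_eqF// prodr_gt0.
Qed.

End Cholesky.

Section Spline.
Context {R : realType}.
Local Notation mu := (@lebesgue_measure R).
Implicit Types (f g h u v : R -> R) (s : R) (p q : {poly R}).
Variables (m : nat) (tau : seq R) (lam : R).
Hypotheses (tau01 : forall t, t \in tau -> 0 <= t <= 1) (utau : uniq tau)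
  (stau : (m.+1 <= size tau)%N) (lam0 : 0 < lam).
Local Notation N := (size tau).
Local Notation sob := (sobolev m.+1).

Lemma grid01 (l : 'I_N) : 0 <= tau`_l <= 1.
Proof. by apply: tau01; rewrite mem_nth. Qed.

Lemma grid_le1 (l : 'I_N) : tau`_l <= 1.
Proof. by case/andP: (grid01 l). Qed.

(** A polynomial of degree at most m is determined by its values on the grid. *)
Lemma grid_poly0 p : (size p <= m.+1)%N -> (forall l : 'I_N, p.[tau`_l] = 0) -> p = 0.
Proof.
move=> sp p0; apply: (roots_geq_poly_eq0 (rs := tau)) => //; last exact: leq_trans stau.
apply/allP => t tt; have ht : (index t tau < N)%N by rewrite index_mem.
by have := p0 (Ordinal ht); rewrite /= nth_index// => /eqP.
Qed.

(** The kernel of the evaluation of (m + 1)-th iterated integrals at the l-th grid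
    point. *)
Definition gker (l : 'I_N) : R -> R := tker m tau`_l.

Lemma gker_si l : square_integrable (gker l).
Proof. exact/tker_square_integrable/grid_le1. Qed.

(** Linear combinations of these functions. *)
Definition gcomb (c : 'rV[R]_N) s : R := \sum_l c 0 l * gker l s.
(** The polynomial with given coefficients. *)
Definition pcomb (b : 'rV[R]_m.+1) : {poly R} := \poly_(i < m.+1) b 0 (inord i).

Lemma gcomb_si c : square_integrable (gcomb c).
Proof. by apply: square_integrable_sum => l; exact: gker_si. Qed.

Lemma size_pcomb b : (size (pcomb b) <= m.+1)%N.
Proof. exact: size_poly. Qed.

Lemma pcombE b t : (pcomb b).[t] = \sum_(i < m.+1) b 0 i * t ^+ i.
Proof.
rewrite (horner_coef_wide t (size_pcomb b)); apply: eq_bigr => i _.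
by rewrite coef_poly ltn_ord inord_val.
Qed.

(** The Gram matrix of the evaluations. *)
Definition gram : 'M[R]_N := \matrix_(k, l) dot (gker k) (gker l).
(** The monomials at the grid points. *)
Definition vander : 'M[R]_(N, m.+1) := \matrix_(l, i) tau`_l ^+ i.

Lemma gram_sym : gram^T = gram.
Proof. by apply/matrixP => k l; rewrite !mxE dotC. Qed.

Lemma dot_gcomb c f : square_integrable f ->
  dot (gcomb c) f = \sum_l c 0 l * dot (gker l) f.
Proof. by move=> sf; apply: dot_suml => // l; exact: gker_si. Qed.

Lemma dot_gcomb2 c d : dot (gcomb c) (gcomb d) = (c *m gram *m d^T) 0 0.
Proof.
rewrite dot_gcomb; last exact: gcomb_si.
rewrite mxE; under [RHS]eq_bigr do rewrite mxE big_distrl/=.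
rewrite exchange_big/=; apply: eq_bigr => k _.
rewrite dotC dot_gcomb; last exact: gker_si.
by rewrite mulr_sumr; apply: eq_bigr => l _; rewrite !mxE (dotC (gker l)); ring.
Qed.

Lemma pcomb_grid b (l : 'I_N) : (pcomb b).[tau`_l] = (b *m vander^T) 0 l.
Proof. by rewrite pcombE mxE; apply: eq_bigr => i _; rewrite !mxE. Qed.

Lemma Jint_gcomb_grid c (l : 'I_N) : Jint m.+1 (gcomb c) tau`_l = (c *m gram) 0 l.
Proof.
rewrite JintS -/(gker l) dotC dot_gcomb ?mxE; last exact: gker_si.
by apply: eq_bigr => k _; rewrite !mxE.
Qed.

(** The linear system solved by the coefficients of the smoothing spline. *)
Definition spline_system : 'M[R]_(N + m.+1) :=
  block_mx (gram + (N%:R * lam)%:M) vander vander^T 0.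

Lemma N_gt0 : 0 < N%:R :> R.
Proof. by rewrite ltr0n (leq_trans _ stau). Qed.

Lemma sqr_row_eq0 n (c : 'rV[R]_n) : (c *m c^T) 0 0 <= 0 -> c = 0.
Proof.
rewrite mxE => h.
have c0 : forall i, true -> 0 <= c 0 i * c^T i 0 by move=> i _; rewrite mxE -expr2 sqr_ge0.
have /eqP : \sum_j c 0 j * c^T j 0 = 0 by apply/eqP; rewrite eq_le h sumr_ge0.
rewrite psumr_eq0// => /allP h0; apply/rowP => i; rewrite mxE.
by have := h0 i (mem_index_enum i); rewrite /= mxE -expr2 sqrf_eq0 => /eqP.
Qed.

Lemma spline_system_unit : spline_system \in unitmx.
Proof.
rewrite -row_free_unit -kermx_eq0; apply/eqP/row_matrixP => i; rewrite row0.
set v := row i _; have : v *m spline_system = 0.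
  by apply/eqP; rewrite -sub_kermx row_sub.
rewrite -(hsubmxK v); move: (lsubmx v) (rsubmx v) => c b.
rewrite /spline_system mul_row_block mulmx0 addr0 -[0]hsubmxK => /eq_row_mx.
rewrite !linear0 => -[e1 e2].
have c0 : c = 0.
  apply: sqr_row_eq0.
  have : (c *m (gram + (N%:R * lam)%:M) + b *m vander^T) *m c^T = 0 by rewrite e1 mul0mx.
  rewrite mulmxDl -[b *m _ *m _]mulmxA -trmx_mul e2 trmx0 mulmx0 addr0.
  rewrite mulmxDr mulmxDl mul_mx_scalar -scalemxAl => /matrixP/(_ 0 0).
  rewrite mxE -dot_gcomb2 [X in _ + X]mxE [RHS]mxE.
  have := dot_ge0 (gcomb c); have := mulr_gt0 N_gt0 lam0.
  move: (dot _ _) ((c *m c^T) 0 0) (N%:R * lam) => A C D; nra.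
have b0 : pcomb b = 0.
  apply: grid_poly0 (size_pcomb b) _ => l.
  by move: e1; rewrite c0 mul0mx add0r pcomb_grid => ->; rewrite mxE.
rewrite c0; suff -> : b = 0 by rewrite row_mx0.
apply/rowP => k; have := congr1 (fun p : {poly R} => p`_k) b0.
by rewrite coef_poly ltn_ord inord_val coef0 mxE.
Qed.

(** The matrix mapping the data to the coefficients of its spline, with its two
    parts: the coefficients of the kernels and of the polynomial. *)
Definition spline_coefs : 'M[R]_(N, N + m.+1) :=
  row_mx 1%:M 0 *m invmx spline_system.
Definition coef_ker (x : 'cV[R]_N) : 'rV[R]_N := x^T *m lsubmx spline_coefs.
Definition coef_pol (x : 'cV[R]_N) : 'rV[R]_m.+1 := x^T *m rsubmx spline_coefs.

(** The two equations of the system: interpolation with a ridge term, and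
    orthogonality to polynomials. *)
Lemma spline_coefsP x :
  coef_ker x *m gram + coef_pol x *m vander^T = x^T - (N%:R * lam) *: coef_ker x /\
  coef_ker x *m vander = 0.
Proof.
have : spline_coefs *m spline_system = row_mx 1%:M 0.
  by rewrite /spline_coefs mulmxKV// spline_system_unit.
rewrite -{1}(hsubmxK spline_coefs) /spline_system mul_row_block mulmx0 addr0 => /eq_row_mx[e1 e2].
split; last by rewrite /coef_ker -mulmxA e2 mulmx0.
have := congr1 (mulmx x^T) e1; rewrite mulmx1 mulmxDr mulmxDr mulmxDr !mulmxA.
rewrite -/(coef_ker x) -/(coef_pol x) mul_mx_scalar => <-.
by rewrite addrAC addrK.
Qed.

(** The smoothing spline in closed form: a polynomial plus a combination of the
    kernels of the evaluations. *)
Definition spline_fun x : R -> R := taylor_fun m.+1 (pcomb (coef_pol x)) (gcomb (coef_ker x)).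

Lemma spline_grid x (l : 'I_N) : spline_fun x tau`_l = x l 0 - N%:R * lam * coef_ker x 0 l.
Proof.
rewrite /spline_fun /taylor_fun pcomb_grid Jint_gcomb_grid.
have [/matrixP/(_ 0 l) e _] := spline_coefsP x.
by move: e; rewrite !mxE addrC => ->.
Qed.

(** Orthogonality to polynomials turns a combination of evaluations into an inner
    product of highest derivatives. *)
Lemma spline_orth x h q f : (size q <= m.+1)%N -> square_integrable f ->
  (forall t, 0 <= t <= 1 -> h t = taylor_fun m.+1 q f t) ->
  \sum_l coef_ker x 0 l * h tau`_l = dot (gcomb (coef_ker x)) f.
Proof.
move=> sq sf e; rewrite dot_gcomb//.
under eq_bigr do rewrite e ?grid01// /taylor_fun mulrDr JintS.
rewrite big_split/= [X in X + _](_ : _ = 0) ?add0r//.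
under eq_bigr do rewrite (horner_coef_wide _ sq) mulr_sumr.
rewrite exchange_big/= big1// => i _.
have [_ /matrixP/(_ 0 i)] := spline_coefsP x; rewrite !mxE => ev.
transitivity (q`_i * (\sum_l coef_ker x 0 l * vander l i)); last by rewrite ev mulr0.
by rewrite mulr_sumr; apply: eq_bigr => l _; rewrite [vander _ _]mxE mulrCA.
Qed.

Lemma spline_objectiveE x h q f : (size q <= m.+1)%N -> square_integrable f ->
  (forall t, 0 <= t <= 1 -> h t = taylor_fun m.+1 q f t) ->
  spline_objective m.+1 lam x h =
  N%:R^-1 * (\sum_(l < N) (x l 0 - h tau`_l) ^+ 2) + lam * L2sqnorm f.
Proof.
move=> sq sf e; rewrite /spline_objective; congr (_ + _ * _).
have sh : sob h by apply/sobolevP; exists q, f.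
rewrite !L2sqnormE; have [mw _] := sobolev_wderiv_si sh; have [mf _] := sf.
by apply: ae_dot_eq => //; exact: sobolev_wderiv_ae e.
Qed.

(** The identity behind the optimality of the spline. *)
Lemma spline_pythagoras x h q f : (size q <= m.+1)%N -> square_integrable f ->
  (forall t, 0 <= t <= 1 -> h t = taylor_fun m.+1 q f t) ->
  spline_objective m.+1 lam x h = spline_objective m.+1 lam x (spline_fun x) +
  (N%:R^-1 * (\sum_(l < N) (h tau`_l - spline_fun x tau`_l) ^+ 2) +
   lam * L2sqnorm (fun s => f s - gcomb (coef_ker x) s)).
Proof.
move=> sq sf e; set g := gcomb _; have sg : square_integrable g by exact: gcomb_si.
have sp := size_pcomb (coef_pol x).
rewrite (spline_objectiveE _ sq sf e) (spline_objectiveE x sp sg (fun _ _ => erefl)).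
pose f' t := -1 * g t + f t.
have sf' : square_integrable f' by exact: square_integrable_lin.
have -> : L2sqnorm (fun s => f s - g s) = L2sqnorm f'.
  by apply: eq_Rintegral => t _; rewrite /f' mulN1r addrC.
have orth : \sum_l coef_ker x 0 l * (h tau`_l - spline_fun x tau`_l) = dot g f'.
  apply: (@spline_orth x (fun t => h t - spline_fun x t) (-1 *: pcomb (coef_pol x) + q)) => //.
    by rewrite (leq_trans (size_polyD _ _))// geq_max sq andbT (leq_trans (size_scale_leq _ _)).
  move=> t t01; have /andP[_ t1] := t01.
  by rewrite taylor_fun_lin// -e// /spline_fun mulN1r addrC.
have f'E t : f' t = -1 * g t + f t by [].
clearbody f'.
have fE : L2sqnorm f = L2sqnorm g + 2 * dot g f' + L2sqnorm f'.
  have -> : L2sqnorm f = L2sqnorm (fun t => 1 * g t + f' t).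
    by apply: eq_Rintegral => t _; rewrite f'E mul1r mulN1r addrA subrr add0r.
  rewrite !L2sqnormE dot_linl//; last exact: square_integrable_lin.
  by rewrite !dot_linr// (dotC f' g); ring.
have xE : \sum_(l < N) (x l 0 - h tau`_l) ^+ 2 =
  \sum_(l < N) (x l 0 - spline_fun x tau`_l) ^+ 2 +
  \sum_(l < N) (h tau`_l - spline_fun x tau`_l) ^+ 2 - 2 * (N%:R * lam) * dot g f'.
  rewrite -orth mulr_sumr -big_split/= -sumrB; apply: eq_bigr => l _.
  rewrite spline_grid; ring.
rewrite xE fE; have := N_gt0 => N0; field; exact: lt0r_neq0.
Qed.

Lemma dot_norm0 f g : square_integrable f -> square_integrable g -> L2sqnorm g = 0 -> dot f g = 0.
Proof.
move=> sf sg g0; apply/eqP; rewrite -sqrf_eq0 eq_le sqr_ge0 andbT.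
by rewrite (le_trans (cauchy_schwarz sf sg))// g0 mulr0.
Qed.

Lemma spline_fun_sobolev x : sob (spline_fun x).
Proof. by apply: taylor_sobolev; exact: gcomb_si. Qed.

(** The smoothing spline is the closed form above. *)
Lemma smoothing_splineE x t : 0 <= t <= 1 -> smoothing_spline m.+1 lam x t = spline_fun x t.
Proof.
have ex : exists h, sob h /\ forall g, sob g -> spline_objective m.+1 lam x h <= spline_objective m.+1 lam x g.
  exists (spline_fun x); split; first exact: spline_fun_sobolev.
  move=> g /sobolevP[q [f [sq sf e]]]; rewrite (spline_pythagoras x sq sf e) lerDl.
  by rewrite addr_ge0// mulr_ge0 ?invr_ge0 ?ler0n ?(ltW lam0) ?L2sqnorm_ge0// sumr_ge0// => l _; exact: sqr_ge0.
have : sob (smoothing_spline m.+1 lam x) /\ forall g, sob g ->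
  spline_objective m.+1 lam x (smoothing_spline m.+1 lam x) <= spline_objective m.+1 lam x g.
  exact: (@xgetPex _ (fun=> 0) _ ex).
set h := smoothing_spline _ _ _; move=> [/sobolevP[q [f [sq sf e]]] /(_ _ (spline_fun_sobolev x))].
rewrite (spline_pythagoras x sq sf e); set A := N%:R^-1 * _; set D := lam * _ => le0.
have A0 : 0 <= A by rewrite mulr_ge0 ?invr_ge0// sumr_ge0// => l _; exact: sqr_ge0.
have D0 : 0 <= D by rewrite mulr_ge0 ?(ltW lam0)// L2sqnorm_ge0.
have A1 : A = 0 by lra.
have D1 : D = 0 by lra.
have hg (l : 'I_N) : h tau`_l = spline_fun x tau`_l.
  move/eqP : A1; rewrite /A mulf_eq0 invr_eq0 gt_eqF ?N_gt0//=.
  rewrite psumr_eq0; last by move=> i _; exact: sqr_ge0.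
  by move=> /allP/(_ l (mem_index_enum l))/=; rewrite sqrf_eq0 subr_eq0 => /eqP.
move: D1 => /eqP; rewrite /D mulf_eq0 gt_eqF//= => /eqP n0.
have sg := gcomb_si (coef_ker x).
have J0 s : 0 <= s <= 1 -> Jint m.+1 f s = Jint m.+1 (gcomb (coef_ker x)) s.
  move=> /andP[_ s1]; apply/eqP; rewrite -subr_eq0 !JintS; apply/eqP.
  have := dot_norm0 (tker_square_integrable m s1) (square_integrableB sf sg) n0.
  move=> <-; rewrite [in RHS](_ : (fun s => f s - _) = (fun s => -1 * gcomb (coef_ker x) s + f s)).
    rewrite dot_linr//; last exact: tker_square_integrable.
    by rewrite mulN1r addrC.
  by apply/funext => y; rewrite mulN1r addrC.
have qp : q - pcomb (coef_pol x) = 0.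
  apply: grid_poly0 => [|l].
    by rewrite (leq_trans (size_polyD _ _))// size_polyN geq_max sq size_pcomb.
  have := hg l; rewrite e ?grid01// /spline_fun /taylor_fun J0 ?grid01//.
  by move/addIr => qe; rewrite !hornerE qe subrr.
move=> t01; rewrite e// /spline_fun /taylor_fun J0//; congr (_.[_] + _).
by apply/eqP; rewrite -subr_eq0 qp.
Qed.

Variables (B : 'I_m.+1 -> (R -> R) -> R) (hB : boundary_operator B).
Hypothesis indep : independent_of_evaluations B tau.

(** The values of B on the kernels of the evaluations. *)
Definition boundary_ker : 'M[R]_(N, m.+1) := \matrix_(l, j) B j (Jint m.+1 (gker l)).

Lemma boundary_gcomb j c : B j (Jint m.+1 (gcomb c)) = (c *m boundary_ker) 0 j.
Proof.
have [_ e] := boundary_sum hB j (c 0) (fun l => sobolev_Jint m (gker_si l)).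
rewrite mxE; transitivity (B j (fun x => \sum_l c 0 l * Jint m.+1 (gker l) x)).
  apply: (boundary_ext hB) => [|t /andP[_ t1]]; first exact: sobolev_Jint (gcomb_si c).
  rewrite JintS dotC dot_gcomb; last exact: tker_square_integrable.
  by apply: eq_bigr => l _; rewrite JintS dotC.
by rewrite e; apply: eq_bigr => l _; rewrite mxE.
Qed.

Lemma boundary_pcomb j b : B j (horner (pcomb b)) = (b *m boundary_mx B) 0 j.
Proof.
rewrite (boundary_poly hB j (size_pcomb b)) mxE; apply: eq_bigr => i _.
by rewrite coef_poly ltn_ord inord_val.
Qed.

(** The matrix mapping the data to the values of B on its spline. *)
Definition spline_boundary : 'M[R]_(N, m.+1) :=
  rsubmx spline_coefs *m boundary_mx B + lsubmx spline_coefs *m boundary_ker.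

Lemma boundary_spline j x : B j (spline_fun x) = (x^T *m spline_boundary) 0 j.
Proof.
rewrite (boundary_taylor hB j (size_pcomb (coef_pol x)) (gcomb_si (coef_ker x)) (fun _ _ => erefl)).
by rewrite boundary_pcomb boundary_gcomb /spline_boundary mulmxDr !mulmxA [RHS]mxE.
Qed.

(** The matrix of the inner products of splines. *)
Definition spline_gram : 'M[R]_N :=
  lsubmx spline_coefs *m gram *m (lsubmx spline_coefs)^T + spline_boundary *m spline_boundary^T.

Lemma spline_gramE x y : sobolev_dot B (smoothing_spline m.+1 lam x) (smoothing_spline m.+1 lam y)
  = (x^T *m spline_gram *m y) 0 0.
Proof.
have eB j z : B j (smoothing_spline m.+1 lam z) = B j (spline_fun z).
  by apply/esym/(boundary_ext hB); [exact: spline_fun_sobolev|move=> t /smoothing_splineE].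
rewrite (sobolev_dot_taylor B (size_pcomb (coef_pol x)) (size_pcomb (coef_pol y))
  (gcomb_si (coef_ker x)) (gcomb_si (coef_ker y)) (smoothing_splineE x) (smoothing_splineE y)).
rewrite /spline_gram mulmxDr mulmxDl mxE; congr (_ + _).
  rewrite dot_gcomb2 /coef_ker trmx_mul trmxK !mulmxA//.
under eq_bigr do rewrite !eB !boundary_spline.
rewrite mulmxA -(mulmxA (x^T *m spline_boundary)) [RHS]mxE; apply: eq_bigr => j _.
congr (_ * _); rewrite (_ : y^T *m _ = (spline_boundary^T *m y)^T) ?mxE//.
by rewrite trmx_mul trmxK.
Qed.

(** A spline of norm 0 is a polynomial killed by B, hence it vanishes; the
    independence of B from the evaluations then forces the data to vanish. *)
Lemma spline_gram_posdef : posdefmx spline_gram.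
Proof.
split.
  by rewrite /spline_gram linearD/= !trmx_mul !trmxK gram_sym !mulmxA.
move=> x x0; rewrite lt_neqAle -spline_gramE.
have eB j z : B j (smoothing_spline m.+1 lam z) = B j (spline_fun z).
  by apply/esym/(boundary_ext hB); [exact: spline_fun_sobolev|move=> t /smoothing_splineE].
rewrite (sobolev_dot_taylor B (size_pcomb (coef_pol x)) (size_pcomb (coef_pol x))
  (gcomb_si (coef_ker x)) (gcomb_si (coef_ker x)) (smoothing_splineE x) (smoothing_splineE x)).
have g0 := dot_ge0 (gcomb (coef_ker x)).
have b0 : 0 <= \sum_j B j (smoothing_spline m.+1 lam x) * B j (smoothing_spline m.+1 lam x).
  by apply: sumr_ge0 => j _; rewrite -expr2 sqr_ge0.
rewrite addr_ge0// andbT; apply: contra x0; rewrite eq_sym paddr_eq0// => /andP[/eqP g1 b1].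
have Bs j : B j (spline_fun x) = 0.
  move: b1; rewrite psumr_eq0; last by move=> i _; rewrite -expr2 sqr_ge0.
  by move=> /allP/(_ j (mem_index_enum j))/=; rewrite -expr2 sqrf_eq0 eB => /eqP.
have sg := gcomb_si (coef_ker x).
rewrite -L2sqnormE in g1.
have J0 s : 0 <= s <= 1 -> Jint m.+1 (gcomb (coef_ker x)) s = 0.
  by move=> /andP[_ s1]; rewrite JintS dot_norm0//; exact: tker_square_integrable.
have sfp t : 0 <= t <= 1 -> spline_fun x t = (pcomb (coef_pol x)).[t].
  by move=> t01; rewrite /spline_fun /taylor_fun J0// addr0.
have p0 : pcomb (coef_pol x) = 0.
  apply: (boundary_ker_poly hB (size_pcomb _)) => j.
  by rewrite -(boundary_ext hB j (spline_fun_sobolev x) sfp).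
have [|_ c0] := @indep (fun=> 0) (coef_ker x 0).
  move=> h /sobolevP[q [f [sq sf e]]]; rewrite big1 ?add0r; last by move=> j _; rewrite mul0r.
  by rewrite (spline_orth x sq sf e) dotC dot_norm0.
apply/eqP/colP => l; rewrite [RHS]mxE.
have := spline_grid x l; rewrite sfp ?grid01// p0 horner0 c0 mulr0 subr0.
by move=> <-.
Qed.

(** The transformation applied to the sampled functions is invertible. *)
Lemma spline_cholesky_unit : spline_cholesky B tau lam \in unitmx.
Proof.
rewrite /spline_cholesky; apply: cholesky_unit.
have [symG posG] := spline_gram_posdef.
have : [set M : 'M[R]_N | [/\ M^T = M, (forall u : 'cV[R]_N, u != 0 -> 0 < (u^T *m M *m u) 0 0) &
    forall u v : 'cV[R]_N,
      sobolev_dot B (smoothing_spline m.+1 lam u) (smoothing_spline m.+1 lam v) =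
      (u^T *m M *m v) 0 0]] (spline_mx B tau lam).
  apply: (@xgetPex _ 0); exists spline_gram; split => //; exact: spline_gramE.
by move=> [symM posM _]; split.
Qed.

End Spline.

(** * Events asymptotically determined by a sequence of observations *)

Section Approximation.
Import HBSimple HBNNSimple.
Context d (T : measurableType d) (R : realType) (P : probability T R).
Context d' (E : nat -> measurableType d') (Z : forall n, T -> E n).
Hypothesis mZ : forall n, measurable_fun setT (Z n).
Implicit Types (A B : set T).

(** The symmetric difference. *)
Definition symdiff A B : set T := (A `\` B) `|` (B `\` A).

Lemma measurable_symdiff A B : measurable A -> measurable B -> measurable (symdiff A B).
Proof. by move=> mA mB; apply: measurableU; exact: measurableD. Qed.

Lemma measurable_preimage n (C : set (E n)) : measurable C -> measurable (Z n @^-1` C).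
Proof. by move=> mC; rewrite -[X in measurable X]setTI; exact: mZ. Qed.
Hint Resolve measurable_preimage : core.

(** The known events: those that are, for every large n, an event about the
    observation Z_n up to a small probability. *)
Definition approximable : set (set T) := [set A | measurable A /\
  forall e : R, 0 < e -> exists N, forall n, (N <= n)%N ->
  exists2 C : set (E n), measurable C & (P (symdiff A (Z n @^-1` C)) < e%:E)%E].

Lemma symdiff_subU A B A' B' : symdiff (A `|` B) (A' `|` B') `<=` symdiff A A' `|` symdiff B B'.
Proof.
move=> x [[[h|h] /not_orP[h1 h2]]|[[h|h] /not_orP[h1 h2]]];
  by [left; left|right; left|left; right|right; right].
Qed.

Lemma approximableC A : approximable A -> approximable (~` A).
Proof.
move=> [mA h]; split; first exact: measurableC.
move=> e /h[N hN]; exists N => n /hN[C mC hC]; exists (~` C); first exact: measurableC.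
rewrite (_ : symdiff _ _ = symdiff A (Z n @^-1` C))//.
rewrite /symdiff preimage_setC !setDE !setCK setUC; congr (_ `|` _); exact: setIC.
Qed.

Lemma approximableU A B : approximable A -> approximable B -> approximable (A `|` B).
Proof.
move=> [mA hA] [mB hB]; split; first exact: measurableU.
move=> e e0; have e2 : 0 < e / 2 by rewrite divr_gt0.
have [N hN] := hA _ e2; have [N' hN'] := hB _ e2.
exists (maxn N N') => n; rewrite geq_max => /andP[/hN[C mC hC] /hN'[D mD hD]].
exists (C `|` D); first exact: measurableU.
have m1 := measurable_symdiff mA (measurable_preimage mC).
have m2 := measurable_symdiff mB (measurable_preimage mD).
apply: (@le_lt_trans _ _ (P (symdiff A (Z n @^-1` C)) + P (symdiff B (Z n @^-1` D)))%E).
  apply: le_trans (measureU2 _ _ _) => //; apply: le_measure; rewrite ?inE.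
  - by apply: measurable_symdiff; [exact: measurableU|apply: measurable_preimage; exact: measurableU].
  - exact: measurableU.
  - by rewrite preimage_setU; exact: symdiff_subU.
by rewrite (splitr e) EFinD; apply: lteD.
Qed.

(** A countable union is approximated by a finite one. *)
Lemma approximable_sigma : sigma_algebra setT approximable.
Proof.
have app0 : approximable set0.
  split => // e e0; exists 0%N => n _; exists set0 => //.
  by rewrite /symdiff preimage_set0 set0D setU0 measure0 lte_fin.
split => //; first by move=> A; rewrite setTD; exact: approximableC.
move=> F aF; have mF n : measurable (F n) by have [] := aF n.
have aU n : approximable (\big[setU/set0]_(i < n) F i).
  elim: n => [|n IH]; first by rewrite big_ord0.
  by rewrite big_ord_recr/=; exact: approximableU.
split; first exact: bigcupT_measurable.
move=> e e0; have e2 : 0 < e / 2 by rewrite divr_gt0.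
pose S n := \bigcup_k F k `\` \big[setU/set0]_(i < n) F i.
have mS n : measurable (S n).
  by apply: measurableD; [exact: bigcupT_measurable|exact: bigsetU_measurable].
have S0 : \bigcap_n S n = set0.
  apply/seteqP; split => // x /= h; have [[k _ Fk] _] := h 0%N I.
  have [_] := h k.+1 I; apply; rewrite big_ord_recr/=; by right.
have : P \o S @ \oo --> (0 : \bar R)%E.
  rewrite -(measure0 P) -S0; apply: nonincreasing_cvg_mu => //.
  - by rewrite (le_lt_trans (probability_le1 _ _))// ltry.
  - by rewrite S0.
  - move=> i j ij; apply/subsetPset; apply: setDS.
    rewrite -!bigcup_mkord => x [k /= ki Fk]; exists k => //=.
    exact: leq_trans ki ij.
move=> /fine_cvgP[fS /cvgrPdist_lt/(_ _ e2)[K _ hK]].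
have SK : (P (S K) < (e / 2)%:E)%E.
  have := hK K (leqnn K); rewrite /= sub0r normrN => h.
  rewrite -[P (S K)]fineK; last by rewrite fin_num_measure.
  by rewrite lte_fin (le_lt_trans (ler_norm _)).
have [_ /(_ _ e2)[N hN]] := aU K; exists N => n /hN[C mC hC]; exists C => //.
have mU : measurable (\big[setU/set0]_(i < K) F i) by exact: bigsetU_measurable.
have m1 := measurable_symdiff mU (measurable_preimage mC).
apply: (@le_lt_trans _ _ (P (S K) + P (symdiff (\big[setU/set0]_(i < K) F i) (Z n @^-1` C)))%E).
  apply: le_trans (measureU2 _ _ _) => //; apply: le_measure; rewrite ?inE.
  - by apply: measurable_symdiff; [exact: bigcupT_measurable|exact: measurable_preimage].
  - exact: measurableU.
  - move=> x [[Fx Cx]|[Cx Fx]].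
      have [h|h] := pselect ((\big[setU/set0]_(i < K) F i) x); last by left.
      by right; left.
    right; right; split => // h; apply: Fx; move: h; rewrite -bigcup_mkord => -[k _ h].
    by exists k.
by rewrite (splitr e) EFinD; apply: lteD.
Qed.

(** The sample space with the sigma-algebra of the known events. *)
Definition known := g_sigma_algebraType approximable.

Lemma known_measurable (A : set known) : measurable A <-> approximable A.
Proof.
by rewrite [X in X A <-> _](measurable_g_measurableTypeE approximable_sigma).
Qed.

Lemma known_measurable_fun d2 (T2 : measurableType d2) (f : T -> T2) :
  measurable_fun (setT : set known) f -> measurable_fun (setT : set T) f.
Proof. by move=> mf _ A mA; have /known_measurable[] := mf measurableT A mA. Qed.

(** A pointwise limit of functions of the Z_n is a known function. *)
Lemma known_cvg (U_ : forall n, E n -> R) (U : T -> R) :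
  (forall n, measurable_fun setT (U_ n)) ->
  (forall w, U_ n (Z n w) @[n --> \oo] --> U w) ->
  measurable_fun (setT : set known) U.
Proof.
move=> mU_ cU.
have mUZ n : measurable_fun setT (fun w => U_ n (Z n w)) by exact: measurableT_comp.
have mU : measurable_fun (setT : set T) U.
  by apply: (@measurable_fun_cvg _ _ _ _ (fun n w => U_ n (Z n w))).
apply: (measurability _ (RGenOInfty.measurableE R)) => //.
move=> /= _ [_ [c ->] <-]; rewrite setTI; apply/known_measurable; split.
  by rewrite -[X in measurable X]setTI; exact: mU.
move=> e e0; have e2 : 0 < e / 2 by rewrite divr_gt0.
pose a k : R := k.+1%:R^-1.
have a0 k : 0 < a k by rewrite invr_gt0.
(* the values of U just above c are unlikely *)
pose S k := U @^-1` `]c, c + a k].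
have mS k : measurable (S k) by rewrite -[X in measurable X]setTI; exact: mU.
have S0 : \bigcap_n S n = set0.
  apply/seteqP; split => // x /= h; have := h 0%N I; rewrite /S/= in_itv/= => /andP[cU0 _].
  have Uc : 0 < U x - c by rewrite subr_gt0.
  have := near_infty_natSinv_lt (PosNum Uc) => -[n _ /(_ n (leqnn n))/= hn].
  have := h n I; rewrite /S/= in_itv/= => /andP[_ h1].
  by have h2 : a n < U x - c by []; lra.
have /fine_cvgP[fS /cvgrPdist_lt/(_ _ e2)[K _ hK]] : P \o S @ \oo --> (0 : \bar R)%E.
  rewrite -(measure0 P) -S0; apply: nonincreasing_cvg_mu => //.
  - by rewrite (le_lt_trans (probability_le1 _ _))// ltry.
  - by rewrite S0.
  - move=> i j ij; apply/subsetPset => x; rewrite /S/= !in_itv/= => /andP[-> h]/=.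
    by rewrite (le_trans h)// lerD2l /a lef_pV2 ?posrE// ler_nat ltnS.
have SK : (P (S K) < (e / 2)%:E)%E.
  have := hK K (leqnn K); rewrite /= sub0r normrN => h.
  rewrite -[P (S K)]fineK; last by rewrite fin_num_measure.
  by rewrite lte_fin (le_lt_trans (ler_norm _)).
pose dl := a K / 2; have dl0 : 0 < dl by rewrite divr_gt0.
(* U_n (Z_n) is close to U for large n *)
pose D n := [set w | dl <= `|U_ n (Z n w) - U w|].
have mD n : measurable (D n).
  have m1 : measurable_fun setT (fun w => `|U_ n (Z n w) - U w|).
    by apply: measurableT_comp => //; exact: measurable_funB.
  have := m1 measurableT `[dl, +oo[%classic; rewrite setTI => /(_ (measurable_itv _)).
  by congr measurable; apply/seteqP; split => w /=; rewrite /D/= in_itv/= andbT.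
pose DD N := \bigcup_(n in [set n | (N <= n)%N]) D n.
have mDD N : measurable (DD N) by exact: bigcup_measurable.
have DD0 : \bigcap_n DD n = set0.
  apply/seteqP; split => // w /= h.
  have /cvgrPdist_lt/(_ _ dl0)[N _ hN] := cU w.
  have [n /= Nn] := h N I; rewrite /D/= => Dn.
  by have := hN n Nn; rewrite /= distrC ltNge Dn.
have /fine_cvgP[_ /cvgrPdist_lt/(_ _ e2)[N _ hN]] : P \o DD @ \oo --> (0 : \bar R)%E.
  rewrite -(measure0 P) -DD0; apply: nonincreasing_cvg_mu => //.
  - by rewrite (le_lt_trans (probability_le1 _ _))// ltry.
  - by rewrite DD0.
  - move=> i j ij; apply/subsetPset => x [n /= jn h]; exists n => //=.
    exact: leq_trans jn.
have DN : (P (DD N) < (e / 2)%:E)%E.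
  have := hN N (leqnn N); rewrite /= sub0r normrN => h.
  rewrite -[P (DD N)]fineK; last by rewrite fin_num_measure.
  by rewrite lte_fin (le_lt_trans (ler_norm _)).
exists N => n Nn; exists (U_ n @^-1` `]c + dl, +oo[).
  by rewrite -[X in measurable X]setTI; exact: mU_.
apply: (@le_lt_trans _ _ (P (S K) + P (DD N))%E).
  apply: le_trans (measureU2 _ _ _) => //; apply: le_measure; rewrite ?inE.
  - apply: measurable_symdiff; first by rewrite -[X in measurable X]setTI; exact: mU.
    apply: measurable_preimage; by rewrite -[X in measurable X]setTI; exact: mU_.
  - exact: measurableU.
  - move=> w; rewrite /symdiff/= !in_itv/= !andbT.
    have [h|h] := leP dl `|U_ n (Z n w) - U w|; first by right; exists n.
    move: h; rewrite ltr_norml => /andP[h1 h2].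
    have dlE : a K = dl + dl by rewrite /dl; lra.
    case=> [[cUw /negP]|[cUn /negP]]; rewrite -leNgt => h3.
      left; rewrite /S/= in_itv/= cUw/= dlE; lra.
    by exfalso; lra.
by rewrite (splitr e) EFinD; apply: lteD.
Qed.

Implicit Types f g : T -> R.

(** The mean square distance. *)
Definition mse f g : \bar R := (\int[P]_w ((f w - g w) ^+ 2)%:E)%E.

Lemma mse_ge0 f g : (0 <= mse f g)%E.
Proof. by apply: integral_ge0 => w _; rewrite lee_fin sqr_ge0. Qed.

Lemma measurable_mse f g : measurable_fun setT f -> measurable_fun setT g ->
  measurable_fun setT (fun w => ((f w - g w) ^+ 2)%:E).
Proof.
by move=> mf mg; apply/measurable_EFinP; apply: measurable_funX; exact: measurable_funB.
Qed.

(** Limits in mean square of functions of the Z_n. *)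
Definition L2_approximable f : Prop := forall e : R, 0 < e ->
  exists N, forall n, (N <= n)%N -> exists2 phi : E n -> R,
  measurable_fun setT phi & (mse f (phi \o Z n) < e%:E)%E.

Lemma mse_triangle f g h : measurable_fun setT f -> measurable_fun setT g ->
  measurable_fun setT h ->
  (mse f h <= 2%:E * (mse f g + mse g h))%E.
Proof.
move=> mf mg mh; rewrite /mse -ge0_integralD//; last 4 first.
- by move=> w _; rewrite lee_fin sqr_ge0.
- exact: measurable_mse.
- by move=> w _; rewrite lee_fin sqr_ge0.
- exact: measurable_mse.
rewrite -ge0_integralZl//; last 2 first.
- by apply: emeasurable_funD; exact: measurable_mse.
- by move=> w _; rewrite -EFinD lee_fin addr_ge0 ?sqr_ge0.
apply: ge0_le_integral => //.
- by move=> w _; rewrite lee_fin sqr_ge0.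
- exact: measurable_mse.
- apply: emeasurable_funM; first exact: measurable_cst.
  by apply: emeasurable_funD; exact: measurable_mse.
- move=> w _; rewrite -EFinD -EFinM lee_fin.
  by have := sqr_ge0 ((f w - g w) - (g w - h w)); nra.
Qed.

Lemma L2_approximable_lin a f g : measurable_fun setT f -> measurable_fun setT g ->
  L2_approximable f -> L2_approximable g -> L2_approximable (fun w => a * f w + g w).
Proof.
move=> mf mg hf hg e e0.
have a0 : 0 < 2 * a ^+ 2 + 1 by have := sqr_ge0 a; lra.
have e1 : 0 < e / 2 / (2 * a ^+ 2 + 1) by rewrite !divr_gt0.
have e2 : 0 < e / 4 by rewrite divr_gt0.
have [N hN] := hf _ e1; have [N' hN'] := hg _ e2.
exists (maxn N N') => n; rewrite geq_max => /andP[/hN[phi mphi h1] /hN'[psi mpsi h2]].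
exists (fun z => a * phi z + psi z).
  by apply: measurable_funD => //; apply: measurable_funM => //; exact: measurable_cst.
have mphiZ : measurable_fun setT (phi \o Z n) by exact: measurableT_comp.
have mpsiZ : measurable_fun setT (psi \o Z n) by exact: measurableT_comp.
apply: (@le_lt_trans _ _ ((2 * a ^+ 2)%:E * mse f (phi \o Z n) + 2%:E * mse g (psi \o Z n))%E).
  rewrite /mse -!ge0_integralZl//; last 5 first.
  - exact: measurable_mse.
  - by move=> w _; rewrite lee_fin sqr_ge0.
  - exact: measurable_mse.
  - by move=> w _; rewrite lee_fin sqr_ge0.
  - by rewrite lee_fin mulr_ge0// sqr_ge0.
  rewrite -ge0_integralD//; last 4 first.
  - by move=> w _; rewrite -EFinM lee_fin; apply: mulr_ge0; [apply: mulr_ge0 => //; exact: sqr_ge0|exact: sqr_ge0].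
  - by apply: emeasurable_funM; [exact: measurable_cst|exact: measurable_mse].
  - by move=> w _; rewrite -EFinM lee_fin; apply: mulr_ge0 => //; exact: sqr_ge0.
  - by apply: emeasurable_funM; [exact: measurable_cst|exact: measurable_mse].
  apply: ge0_le_integral => //.
  - by move=> w _; rewrite lee_fin sqr_ge0.
  - apply: measurable_mse; first by apply: measurable_funD => //; apply: measurable_funM => //; exact: measurable_cst.
    by apply: measurable_funD => //; apply: measurable_funM => //; exact: measurable_cst.
  - by apply: emeasurable_funD; (apply: emeasurable_funM; [exact: measurable_cst|exact: measurable_mse]).
  - move=> w _; rewrite -!EFinM -EFinD lee_fin /=.
    have := sqr_ge0 (a * (f w - phi (Z n w)) - (g w - psi (Z n w))); nra.
have f1 : mse f (phi \o Z n) \is a fin_num.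
  by rewrite ge0_fin_numE ?mse_ge0// (lt_trans h1)// ltry.
have f2 : mse g (psi \o Z n) \is a fin_num.
  by rewrite ge0_fin_numE ?mse_ge0// (lt_trans h2)// ltry.
have g1 : 0 <= fine (mse f (phi \o Z n)) by rewrite fine_ge0// mse_ge0.
move: h1 h2 g1; rewrite -(fineK f1) -(fineK f2) -!EFinM -EFinD !lte_fin /=.
move: (fine _) (fine _) => x y; rewrite ltr_pdivlMr// => h1 h2 x0; nra.
Qed.

Lemma L2_approximable_indic A : approximable A -> L2_approximable (\1_A).
Proof.
move=> [mA hA] e /hA[N hN]; exists N => n /hN[C mC hC]; exists (\1_C) => //.
rewrite (_ : mse _ _ = P (symdiff A (Z n @^-1` C)))//.
have mS := measurable_symdiff mA (measurable_preimage mC).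
rewrite -[X in _ = P X]setIT -integral_indic//; apply: eq_integral => w _.
congr EFin; rewrite /= !indicE.
have [Aw|Aw] := pselect (A w); have [Cw|Cw] := pselect (C (Z n w)).
- rewrite (mem_set Aw) (mem_set Cw) memNset ?subrr ?expr0n//= => -[[_ /(_ Cw)]|[_ /(_ Aw)]]//.
- by rewrite (mem_set Aw) (memNset Cw) mem_set ?subr0 ?expr1n//; left.
- by rewrite (memNset Aw) (mem_set Cw) mem_set ?sub0r ?sqrrN ?expr1n//; right.
- by rewrite (memNset Aw) (memNset Cw) memNset ?subrr ?expr0n//= => -[[/Aw]|[/Cw]].
Qed.

Lemma L2_approximable_lim f : measurable_fun setT f ->
  (forall e : R, 0 < e -> exists g, [/\ measurable_fun setT g, L2_approximable g &
     (mse f g < e%:E)%E]) -> L2_approximable f.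
Proof.
move=> mf H e e0; have e4 : 0 < e / 4 by rewrite divr_gt0.
have [g [mg hg fg]] := H _ e4; have [N hN] := hg _ e4.
exists N => n /hN[phi mphi h]; exists phi => //.
have mphiZ : measurable_fun setT (phi \o Z n) by exact: measurableT_comp.
apply: (le_lt_trans (mse_triangle mf mg mphiZ)).
have f1 : mse f g \is a fin_num by rewrite ge0_fin_numE ?mse_ge0// (lt_trans fg)// ltry.
have f2 : mse g (phi \o Z n) \is a fin_num by rewrite ge0_fin_numE ?mse_ge0// (lt_trans h)// ltry.
move: fg h; rewrite -(fineK f1) -(fineK f2) -EFinD -EFinM !lte_fin; lra.
Qed.

Lemma L2_approximable_cst0 : L2_approximable (cst 0).
Proof.
move=> e e0; exists 0%N => n _; exists (cst 0); first exact: measurable_cst.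
by rewrite /mse; under eq_integral do rewrite /= subrr expr0n; rewrite integral0 lte_fin.
Qed.

Lemma L2_approximable_sum k (a : 'I_k -> R) (F : 'I_k -> set T) :
  (forall i, approximable (F i)) ->
  L2_approximable (fun w => \sum_(i < k) a i * \1_(F i) w) /\
  measurable_fun setT (fun w => \sum_(i < k) a i * \1_(F i) w).
Proof.
move=> aF; have mF i : measurable (F i) by have [] := aF i.
elim: k a F aF mF => [|k IH] a F aF mF.
  under eq_fun do rewrite big_ord0.
  by split; [exact: L2_approximable_cst0|exact: measurable_cst].
under eq_fun do rewrite big_ord_recl.
have [h mh] := IH (fun i => a (lift ord0 i)) (fun i => F (lift ord0 i)) (fun i => aF _) (fun i => mF _).
split.
  apply: (L2_approximable_lin _ _ _ _ h) => //; exact: L2_approximable_indic.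
apply: measurable_funD => //; apply: measurable_funM => //; exact: measurable_cst.
Qed.

(** By approximation from below by simple functions. *)
Lemma known_L2_ge0 f : measurable_fun (setT : set known) f -> (forall w, 0 <= f w) ->
  (\int[P]_w ((f w) ^+ 2)%:E < +oo)%E -> L2_approximable f.
Proof.
move=> mkf f0 foo; have mf := known_measurable_fun mkf.
pose a : nat -> {nnsfun known >-> R} := nnsfun_approx measurableT (proj2 (measurable_EFinP _ _) mkf).
have ca (w : known) : a k w @[k --> \oo] --> f w.
  by have /fine_cvgP[_] := @cvg_nnsfun_approx _ known R _ measurableT (EFin \o f)
    (proj2 (measurable_EFinP _ _) mkf) (fun w _ => f0 w) w I.
have la k (w : known) : a k w <= f w.
  have nd : nondecreasing_seq (a ^~ w).
    move=> i j ij; have := @nd_nnsfun_approx _ known R _ measurableT (EFin \o f)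
      (proj2 (measurable_EFinP _ _) mkf) _ _ ij.
    by move=> /lefP.
  have := nondecreasing_cvgn_le nd (cvgP _ (ca w)) k.
  by rewrite (cvg_lim _ (ca w)).
have ma k : measurable_fun (setT : set T) (a k).
  by apply: known_measurable_fun; exact: measurable_funPT.
have aa k : L2_approximable (a k).
  rewrite (funext (fimfunEord (a k)) : (a k : T -> R) = _).
  apply: (proj1 (L2_approximable_sum _ _)) => i; apply/known_measurable.
  by rewrite -[X in measurable X]setTI; exact: (measurable_funPT (a k)).
apply: L2_approximable_lim => // e e0.
have if2 : P.-integrable setT (EFin \o (fun w => f w ^+ 2)).
  apply/integrableP; split; first by apply/measurable_EFinP; exact: measurable_funX.
  by under eq_integral do rewrite /= ger0_norm ?sqr_ge0//.
have [|||||_ _] := @dominated_convergence _ _ _ P setT measurableT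
  (fun k w => ((f w - a k w) ^+ 2)%:E) (cst 0%E) (EFin \o (fun w => f w ^+ 2)).
- by move=> k; exact: measurable_mse.
- exact: measurable_cst.
- apply: aeW => w _; apply/fine_cvgP; split; first exact: nearW.
  rewrite [X in _ --> X](_ : _ = (f w - f w) ^+ 2); last by rewrite subrr expr0n.
  apply: (cvg_comp _ (fun x : R => x ^+ 2)); last exact: exprn_continuous.
  by apply: cvgB => //; exact: cvg_cst.
- exact: if2.
- apply: aeW => w k _; rewrite /= lee_fin ger0_norm ?sqr_ge0// ler_pXn2r ?nnegrE ?subr_ge0//.
  by rewrite lerBlDr lerDl.
rewrite integral_cst// mul0e => /fine_cvgP[[N1 _ fN] /cvgrPdist_lt/(_ _ e0)[N _ hN]].
exists (a (maxn N1 N)); split => //.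
have := hN (maxn N1 N) (leq_maxr _ _); have := fN (maxn N1 N) (leq_maxl _ _).
rewrite /= sub0r normrN => fn h; rewrite /mse -(fineK fn) lte_fin.
by rewrite (le_lt_trans (ler_norm _)).
Qed.

(** Square integrable known functions are limits in mean square of functions of
    the Z_n. *)
Lemma known_L2 f : measurable_fun (setT : set known) f ->
  (\int[P]_w ((f w) ^+ 2)%:E < +oo)%E -> L2_approximable f.
Proof.
move=> mkf foo; have mf := known_measurable_fun mkf.
have le2 (g : T -> R) : measurable_fun setT g -> (forall w, 0 <= g w <= `|f w|) ->
    (\int[P]_w ((g w) ^+ 2)%:E < +oo)%E.
  move=> mg gf; apply: le_lt_trans foo; apply: ge0_le_integral => //.
  - by move=> w _; rewrite lee_fin sqr_ge0.
  - by apply/measurable_EFinP; exact: measurable_funX.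
  - by apply/measurable_EFinP; exact: measurable_funX.
  - move=> w _; have /andP[g0 g1] := gf w.
    by rewrite lee_fin -[leRHS]real_normK ?num_real// ler_pXn2r ?nnegrE.
have mp : measurable_fun (setT : set known) (fun w => Num.max (f w) 0).
  by apply: measurable_maxr => //; exact: measurable_cst.
have mn : measurable_fun (setT : set known) (fun w => Num.max (- f w) 0).
  apply: measurable_maxr; last exact: measurable_cst.
  exact: measurableT_comp.
have ap : L2_approximable (fun w => Num.max (f w) 0).
  apply: known_L2_ge0 => //; first by move=> w; rewrite le_max lexx orbT.
  apply: le2; first exact: known_measurable_fun mp.
  by move=> w; rewrite le_max lexx orbT ge_max ler_norm normr_ge0.
have an : L2_approximable (fun w => Num.max (- f w) 0).
  apply: known_L2_ge0 => //; first by move=> w; rewrite le_max lexx orbT.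
  apply: le2; first exact: known_measurable_fun mn.
  by move=> w; rewrite le_max lexx orbT ge_max -normrN ler_norm normr_ge0.
have := L2_approximable_lin (-1) (known_measurable_fun mn) (known_measurable_fun mp) an ap.
congr L2_approximable; apply/funext => w.
case: (leP 0 (f w)) => h; case: (leP 0 (- f w)) => h'; lra.
Qed.

End Approximation.

(** * Step functions and finitely coded approximations *)

Section Cells.
Context {R : realType}.
Local Notation mu := (@lebesgue_measure R).
Local Notation I01 := (`[0, 1]%classic : set R).
Implicit Types (f g : R -> R) (n i : nat).

(** The indicator of [i / (n + 1), (i + 1) / (n + 1)[, written with the kernel of
    order 0 so that its inner products are differences of integrals from 0. *)
Definition cell n i (x : R) : R :=
  tker 0 (i.+1%:R / n.+1%:R) x - tker 0 (i%:R / n.+1%:R) x.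

Lemma tker0E (t x : R) : tker 0 t x = (x < t)%R%:R.
Proof. by rewrite /tker expr0 fact0 divr1; case: ifP. Qed.

Lemma cellE n i x : 0 <= x -> cell n i x = (i == Num.truncn (x * n.+1%:R))%:R.
Proof.
move=> x0; have n0 : 0 < n.+1%:R :> R by [].
rewrite /cell !tker0E !ltr_pdivlMr//.
have y0 : 0 <= x * n.+1%:R by rewrite mulr_ge0// ltW.
move: y0 (truncn_itv y0); set y := x * _; set k := Num.truncn y => y0 /andP[k1 k2].
case: (ltngtP i k) => [ik|ki|->].
- rewrite ltNge (le_trans _ k1) ?ler_nat//= ltNge (le_trans _ k1) ?ler_nat ?(ltnW ik)//= subrr//.
- rewrite (lt_le_trans k2) ?ler_nat ?(leqW ki)//.
  by rewrite (lt_le_trans k2) ?ler_nat// subrr.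
- by rewrite k2 ltNge k1 subr0.
Qed.

(** At x, only the cell with index the integer part of (n + 1) x is active. *)
Lemma cell_sum n (a : nat -> R) x : 0 <= x < 1 ->
  \sum_(i < n.+1) a i * cell n i x = a (Num.truncn (x * n.+1%:R)).
Proof.
move=> /andP[x0 x1]; have n0 : 0 < n.+1%:R :> R by [].
have y0 : 0 <= x * n.+1%:R by rewrite mulr_ge0// ltW.
have kn : (Num.truncn (x * n.+1%:R) < n.+1)%N.
  have /andP[k1 _] := truncn_itv y0.
  rewrite -(@ltr_nat R); apply: (le_lt_trans k1).
  by rewrite -[ltRHS]mul1r ltr_pM2r.
rewrite (bigD1 (Ordinal kn))//= cellE// eqxx mulr1 big1 ?addr0// => i.
by rewrite -val_eqE/= cellE// => /negPf ->; rewrite mulr0.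
Qed.

Lemma itv_grid n i : (i <= n.+1)%N -> 0 <= (i%:R / n.+1%:R : R) <= 1.
Proof.
by move=> h; rewrite divr_ge0//= ler_pdivrMr ?ltr0Sn// mul1r ler_nat.
Qed.

Lemma cell_square_integrable n i : (i < n.+1)%N -> square_integrable (cell n i).
Proof.
move=> h; rewrite /cell; apply: (@square_integrableB _ (tker 0 _) (tker 0 _)).
  by apply: tker_square_integrable; have /andP[] := @itv_grid n i.+1 h.
by apply: tker_square_integrable; have /andP[] := @itv_grid n i (ltnW h).
Qed.

Lemma dot_tker0 (t : R) : 0 <= t <= 1 -> dot (tker 0 t) (cst 1) = t.
Proof.
move=> /andP[t0 t1]; rewrite /dot.
have -> : \int[mu]_(x in `[0, 1]) (tker 0 t x * cst 1 x) =
    \int[mu]_(x in `[0, 1]) (\1_(`]-oo, t[%classic : set R) x).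
  apply: eq_Rintegral => x _; rewrite tker0E mulr1 indicE; congr (_%:R).
  by rewrite mem_setE in_itv.
rewrite /Rintegral integral_indic//.
have -> : `]-oo, t[%classic `&` `[0, 1]%classic = `[0, t[%classic :> set R.
  apply/seteqP; split => x /=; rewrite !in_itv/=.
    by move=> [h /andP[-> _]].
  by move=> /andP[h1 h2]; rewrite h1 h2/= (le_trans (ltW h2)).
have := lebesgue_measure_itv `[0, t[ => /= ->.
rewrite lte_fin; case: ltP => h /=; first by rewrite subr0.
by apply/eqP; rewrite eq_le t0 h.
Qed.

Lemma dot_cell n i j : (i < n.+1)%N -> (j < n.+1)%N ->
  dot (cell n i) (cell n j) = (i == j)%:R / n.+1%:R :> R.
Proof.
move=> hi hj.
have h1 : dot (cell n i) (cst 1) = n.+1%:R^-1 :> R.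
  have si t : t \in [:: i; i.+1] -> square_integrable (tker 0 (t%:R / n.+1%:R) : R -> R).
    move=> ht; apply: tker_square_integrable.
    have [] // := andP (@itv_grid n t _).
    by move: ht; rewrite !inE => /orP[]/eqP ->//; exact: ltnW.
  rewrite (_ : cell n i = fun x => -1 * tker 0 (i%:R / n.+1%:R) x + tker 0 (i.+1%:R / n.+1%:R) x);
    last by apply/funext => x; rewrite /cell; ring.
  rewrite dot_linl; last 3 first.
  - by apply: si; rewrite inE eqxx.
  - by apply: si; rewrite !inE eqxx orbT.
  - exact: square_integrable_cst.
  rewrite !dot_tker0 ?itv_grid//; last exact: ltnW.
  by rewrite -natr1; lra.
case: (eqVneq i j) => [<-|ij].
  rewrite mul1r -[RHS]h1 /dot; apply: eq_Rintegral => x.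
  rewrite inE/= in_itv/= => /andP[x0 _].
  by rewrite cellE//; case: (_ == _); rewrite ?mul0r ?mulr1.
rewrite mul0r -[RHS](dot0l (cst 0)) /dot; apply: eq_Rintegral => x.
rewrite inE/= in_itv/= => /andP[x0 _].
rewrite !cellE// mul0r; case: eqP => [hi'|]; case: eqP => [hj'|]; rewrite ?mulr0 ?mul0r//.
by move: ij; rewrite hi' hj' eqxx.
Qed.

Lemma L2sqnorm_cells n (a : 'I_n.+1 -> R) g : square_integrable g ->
  L2sqnorm (fun x => g x - \sum_(i < n.+1) a i * cell n i x) =
  L2sqnorm g + \sum_(i < n.+1) (a i ^+ 2 / n.+1%:R - 2 * a i * dot (cell n i) g).
Proof.
move=> sg.
have sc (i : 'I_n.+1) : square_integrable (cell n i : R -> R) by exact: cell_square_integrable.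
pose S x := \sum_(i < n.+1) a i * cell n i x.
have sS : square_integrable S by exact: square_integrable_sum.
rewrite !L2sqnormE.
rewrite (_ : (fun x => _) = fun x => -1 * S x + g x); last by apply/funext => x; rewrite /S; ring.
have sl : square_integrable (fun x => -1 * S x + g x) by exact: square_integrable_lin.
rewrite (@dot_linl _ (-1) S g _ sS sg sl) !(@dot_linr _ (-1) S g _ sS sg)//.
rewrite (dotC g S) /S !(@dot_suml _ _ a (fun i : 'I_n.+1 => cell n i))//.
have -> : \sum_(i < n.+1) a i * dot (cell n i) (fun x => \sum_(i < n.+1) a i * cell n i x) =
    \sum_(i < n.+1) a i ^+ 2 / n.+1%:R.
  apply: eq_bigr => i _; rewrite dotC (@dot_suml _ _ a (fun i : 'I_n.+1 => cell n i))//.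
  rewrite (bigD1 i)//= dot_cell// eqxx mul1r big1 ?addr0; first by ring.
  by move=> j; rewrite -val_eqE/= => ij; rewrite dot_cell// (negPf ij) mul0r mulr0.
rewrite sumrB [X in _ = _ + (_ - X)](eq_bigr (fun i : 'I_n.+1 => 2 * (a i * dot (cell n i) g))); last by move=> i _; ring.
by rewrite -mulr_sumr; ring.
Qed.

(** The average of g over the i-th cell. *)
Definition cell_avg n g (i : nat) : R := n.+1%:R * dot (cell n i) g.

(** The averages give the best approximation by a step function: the excess of
    another step function is its squared distance to theirs. *)
Lemma L2sqnorm_cell_avg n (a : 'I_n.+1 -> R) g : square_integrable g ->
  L2sqnorm (fun x => g x - \sum_(i < n.+1) a i * cell n i x) =
  L2sqnorm (fun x => g x - \sum_(i < n.+1) cell_avg n g i * cell n i x) +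
  \sum_(i < n.+1) (a i - cell_avg n g i) ^+ 2 / n.+1%:R.
Proof.
move=> sg; rewrite (L2sqnorm_cells _ sg) (@L2sqnorm_cells n (fun i : 'I_n.+1 => cell_avg n g i) g sg).
rewrite -addrA -big_split/=; congr (_ + _); apply: eq_bigr => i _; rewrite /cell_avg.
have : n.+1%:R != 0 :> R by []; move: (n.+1%:R : R) => N N0; by field.
Qed.

(** The left end of the cell of x, or 0 outside [0, 1[; functions of it are the
    step functions. *)
Definition cell_left n (x : R) : R := \sum_(i < n.+1) i%:R / n.+1%:R * cell n i x.

Lemma measurable_cell n i : measurable_fun (setT : set (measurableTypeR R)) (cell n i).
Proof. by apply: measurable_funB; exact: measurable_tker. Qed.

Lemma measurable_cell_left n : measurable_fun (setT : set (measurableTypeR R)) (cell_left n).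
Proof.
apply: measurable_sum => i; apply: measurable_funM; first exact: measurable_cst.
exact: measurable_cell.
Qed.

Lemma cell_left_out n x : x < 0 \/ 1 <= x -> cell_left n x = 0.
Proof.
move=> h; rewrite /cell_left big1// => i _; rewrite /cell !tker0E.
have /andP[a0 a1] := @itv_grid n i.+1 (ltn_ord i).
have /andP[b0 b1] := @itv_grid n i (ltnW (ltn_ord i)).
case: h => h; first by rewrite !(lt_le_trans h)// subrr mulr0.
by rewrite !ltNge !(le_trans _ h)// subrr mulr0.
Qed.

Lemma cell_left_cvg x : cell_left n x @[n --> \oo] --> (if (0 <= x < 1) then x else 0).
Proof.
have [/andP[x0 x1]|h] := boolP (0 <= x < 1); last first.
  rewrite (_ : (fun n => _) = cst 0); first exact: cvg_cst.
  apply/funext => n; rewrite cell_left_out//; move: h; rewrite negb_and -ltNge -leNgt.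
  by move=> /orP.
apply/cvgrPdist_lt => e e0.
have := near_infty_natSinv_lt (PosNum e0); apply: filterS => n /= hn.
rewrite /cell_left (@cell_sum n (fun i => i%:R / n.+1%:R)) ?x0//.
have n0 : 0 < n.+1%:R :> R by [].
have y0 : 0 <= x * n.+1%:R by rewrite mulr_ge0// ltW.
have /andP[k1 k2] := truncn_itv y0.
rewrite -ler_pdivrMr// in k1; rewrite -ltr_pdivlMr// -natr1 mulrDl mul1r in k2.
by rewrite ger0_norm ?subr_ge0// ltrBlDl (lt_trans k2)// ltrD2l.
Qed.

(** Step functions over the cells are dense in L2. *)
Lemma step_approx f (e : R) : square_integrable f -> 0 < e ->
  exists N, forall n, (N <= n)%N -> exists a : 'I_n.+1 -> R,
  L2sqnorm (fun x => f x - \sum_(i < n.+1) a i * cell n i x) < e.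
Proof.
move=> [mf if2] e0.
pose P : probability (measurableTypeR R) R := uniform_prob (@ltr01 R).
pose Z n : measurableTypeR R -> measurableTypeR R := cell_left n.
have mZ n : measurable_fun setT (Z n) by exact: measurable_cell_left.
pose U x : R := if 0 <= x < 1 then x else 0.
have kU : measurable_fun (setT : set (known P Z)) U.
  by apply: (known_cvg mZ (U_ := fun=> id)) => // x; exact: cell_left_cvg.
pose F := f \_ I01.
have mF : measurable_fun (setT : set (measurableTypeR R)) F.
  by apply/(measurable_restrictT _ measurable_I01).
have kF : measurable_fun (setT : set (known P Z)) (F \o U) by exact: measurableT_comp.
have mFU : measurable_fun (setT : set (measurableTypeR R)) (F \o U).
  exact: (known_measurable_fun mZ kF).
have FU : {ae mu, forall x, I01 x -> F (U x) = f x}.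
  apply: ae_imp ae_neq_endpoints => x [_ x1]; rewrite /= in_itv/= => /andP[x0 x1'].
  have x1'' : x < 1 by rewrite lt_neqAle x1.
  by rewrite /U x0 x1''/= /F patchE mem_set//= in_itv/= x0.
have h1 : (\int[P]_x ((F \o U) x ^+ 2)%:E < +oo)%E.
  rewrite integral_uniform; last 2 first.
  - by apply/measurable_EFinP; exact: measurable_funX.
  - by move=> x; rewrite lee_fin sqr_ge0.
  rewrite subr0 invr1 mul1e.
  have -> : (\int[mu]_(x in I01) ((F \o U) x ^+ 2)%:E = \int[mu]_(x in I01) (f x ^+ 2)%:E)%E.
    apply: ae_eq_integral => //.
    - by apply/measurable_EFinP; apply: measurable_funX; exact: measurable_funTS.
    - by apply/measurable_EFinP; exact: measurable_funX.
    - by apply: ae_imp FU => x h Ix; rewrite /= h.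
  by have /integrableP[_] := if2; under eq_integral do rewrite gee0_abs ?lee_fin ?sqr_ge0//.
have [N hN] := known_L2 mZ kF h1 e0.
exists N => n /hN[phi mphi]; rewrite /mse integral_uniform; last 2 first.
- apply/measurable_EFinP; apply: measurable_funX; apply: measurable_funB => //.
  exact: measurableT_comp.
- by move=> x; rewrite lee_fin sqr_ge0.
rewrite subr0 invr1 mul1e => h; exists (fun i => phi (i%:R / n.+1%:R)).
set S := fun x => _.
have mS : measurable_fun I01 S.
  apply: measurable_funB => //; apply: (@measurable_sum _ (measurableTypeR R)) => i.
  apply: measurable_funM; first exact: measurable_cst.
  apply: measurable_funTS; exact: measurable_cell.
have E : (\int[mu]_(x in I01) (((F \o U) x - (phi \o Z n) x) ^+ 2)%:E =
          \int[mu]_(x in I01) (S x ^+ 2)%:E)%E.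
  apply: ae_eq_integral => //.
  - apply/measurable_EFinP; apply: measurable_funX; apply: measurable_funB.
      exact: measurable_funTS.
    by apply: measurable_funTS; exact: measurableT_comp.
  - by apply/measurable_EFinP; exact: measurable_funX.
  - apply: ae_imp2 FU ae_neq_endpoints => x h' [_ x1] Ix; rewrite /= h'//.
    move: Ix; rewrite /= in_itv/= => /andP[x0 x1'].
    have x01 : 0 <= x < 1 by rewrite x0 lt_neqAle x1.
    rewrite /S (@cell_sum n (fun i => phi (i%:R / n.+1%:R)))// /Z /cell_left.
    by rewrite (@cell_sum n (fun i => i%:R / n.+1%:R)).
rewrite E in h; have S0 : (0 <= \int[mu]_(x in I01) (S x ^+ 2)%:E)%E.
  by apply: integral_ge0 => x _; rewrite lee_fin sqr_ge0.
by rewrite -lte_fin /L2sqnorm /Rintegral fineK// ge0_fin_numE// (lt_trans h)// ltry.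
Qed.

Lemma cell_avg_cvg g (e : R) : square_integrable g -> 0 < e ->
  exists N, forall n, (N <= n)%N ->
  L2sqnorm (fun x => g x - \sum_(i < n.+1) cell_avg n g i * cell n i x) < e.
Proof.
move=> sg /(step_approx sg)[N hN]; exists N => n /hN[a]; apply: le_lt_trans.
rewrite (L2sqnorm_cell_avg a sg) lerDl; apply: sumr_ge0 => i _.
by rewrite divr_ge0// sqr_ge0.
Qed.

(** Rounding to a multiple of 1/(n+1). *)
Definition round_to n (y : R) : R := (Num.floor (y * n.+1%:R))%:~R / n.+1%:R.

Lemma round_to_dist n y : (round_to n y - y) ^+ 2 <= n.+1%:R^-1.
Proof.
have n0 : 0 < n.+1%:R :> R by [].
have i1 : n.+1%:R^-1 <= 1 :> R by rewrite invf_le1// ler1n.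
have /andP[h1] := floor_itv (y * n.+1%:R).
rewrite -ler_pdivrMr// in h1; rewrite -ltr_pdivlMr// intrD mulrDl mul1r => h2.
have i0 : 0 < n.+1%:R^-1 :> R by rewrite invr_gt0.
rewrite -/(round_to n y) in h1 h2; move: (n.+1%:R^-1) i1 i0 h2 => z z1 z0 h2.
have : 0 <= y - round_to n y by lra.
have : y - round_to n y <= z by lra.
move: (round_to n y) => q h3 h4; nra.
Qed.

(** The approximation of the function with Taylor polynomial p and m-th
    derivative g, on n+1 cells, with rounded coefficients. *)
Definition coarse_poly n m (p : {poly R}) : {poly R} := \poly_(i < m) round_to n p`_i.
Definition coarse_step n g (x : R) : R :=
  \sum_(i < n.+1) round_to n (cell_avg n g i) * cell n i x.
Definition coarse n m p g : R -> R := taylor_fun m (coarse_poly n m p) (coarse_step n g).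

Lemma coarse_step_square_integrable n g : square_integrable (coarse_step n g).
Proof.
apply: (@square_integrable_sum _ _ (fun i : 'I_n.+1 => round_to n (cell_avg n g i)) (fun i : 'I_n.+1 => cell n i)).
by move=> i; exact: cell_square_integrable.
Qed.

Lemma coarse_step_cvg g (e : R) : square_integrable g -> 0 < e ->
  exists N, forall n, (N <= n)%N -> L2sqnorm (fun x => g x - coarse_step n g x) < e.
Proof.
move=> sg e0; have e2 : 0 < e / 2 by rewrite divr_gt0.
have [N hN] := cell_avg_cvg sg e2.
have [N' _ hN'] := near_infty_natSinv_lt (PosNum e2).
exists (maxn N N') => n; rewrite geq_max => /andP[/hN h1 /hN'/= h2].
rewrite /coarse_step (@L2sqnorm_cell_avg n (fun i : 'I_n.+1 => round_to n (cell_avg n g i)) g sg).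
rewrite (splitr e); apply: ltrD => //.
apply: le_lt_trans h2.
apply: (@le_trans _ _ (\sum_(i < n.+1) (n.+1%:R^-1 / n.+1%:R))).
  by apply: ler_sum => i _; apply: ler_wpM2r; rewrite ?invr_ge0//; exact: round_to_dist.
by rewrite sumr_const card_ord -(mulr_natr (n.+1%:R^-1 / n.+1%:R)) -mulrA mulVf ?mulr1.
Qed.

End Cells.

Section Coarse.
Context {R : realType}.
Variables (m : nat) (B : 'I_m.+1 -> (R -> R) -> R) (hB : boundary_operator B).

(** The coarse approximations converge for the norm attached to B. *)
Lemma coarse_cvg (h : R -> R) (p : {poly R}) (g : R -> R) : (size p <= m.+1)%N -> square_integrable g ->
  (forall t, 0 <= t <= 1 -> h t = taylor_fun m.+1 p g t) -> forall e : R, 0 < e ->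
  exists N, forall n, (N <= n)%N ->
  sobolev_dot B (h \- coarse n m.+1 p g) (h \- coarse n m.+1 p g) < e.
Proof.
move=> sp sg hE e e0; have [C C0 hC] := sobolev_dot_bound hB.
have e1 : 0 < e / (C + 1) / 2 by rewrite !divr_gt0// ltr_wpDl.
have [N hN] := coarse_step_cvg sg e1.
have e2 : 0 < e / (C + 1) / 2 / m.+1%:R by rewrite divr_gt0.
have [N' _ hN'] := near_infty_natSinv_lt (PosNum e2).
exists (maxn N N') => n; rewrite geq_max => /andP[/hN h1 /hN'/= h2].
set c := coarse_poly n m.+1 p; set s := coarse_step n g.
have ss : square_integrable s by exact: coarse_step_square_integrable.
have sgs : square_integrable (fun x => g x - s x) by exact: square_integrableB.
have sc : (size (p - c)%R <= m.+1)%N.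
  rewrite (leq_trans (size_polyD _ _))// size_polyN geq_max sp/=; exact: size_poly.
have hT t : 0 <= t <= 1 ->
    (h \- coarse n m.+1 p g) t = taylor_fun m.+1 (p - c) (fun x => g x - s x) t.
  move=> t01; rewrite /= hE// /coarse -/c -/s.
  have /andP[_ t1] := t01.
  rewrite (_ : (fun x => g x - s x) = fun x => -1 * s x + g x); last first.
    by apply/funext => x; ring.
  rewrite (_ : p - c = -1 *: c + p); last by rewrite scaleN1r addrC.
  by rewrite taylor_fun_lin//; ring.
apply: (le_lt_trans (hC _ _ _ sc sgs hT)).
have h4 : \sum_(i < m.+1) (p - c)`_i ^+ 2 <= e / (C + 1) / 2.
  apply: (@le_trans _ _ (\sum_(i < m.+1) n.+1%:R^-1)).
    apply: ler_sum => i _; rewrite coefB coef_poly ltn_ord -sqrrN opprB.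
    exact: round_to_dist.
  rewrite sumr_const card_ord -(mulr_natr (n.+1%:R^-1)) -ler_pdivlMr//; exact: ltW.
have h5 : C * (\sum_(i < m.+1) (p - c)`_i ^+ 2 + L2sqnorm (fun x => g x - s x)) <=
   C * (e / (C + 1)).
  by apply: ler_wpM2l => //; rewrite (splitr (e / (C + 1))); apply: lerD => //; exact: ltW.
apply: (le_lt_trans h5).
rewrite mulrA ltr_pdivrMr; last by rewrite ltr_wpDl.
by rewrite mulrC ltr_pM2l// ltrDl.
Qed.

End Coarse.

(** * Recovering derivatives from evaluations *)

Section LeftDerivative.
Context {R : realType}.
Local Notation mu := (@lebesgue_measure R).
Implicit Types (g : R -> R) (q : {poly R}).

(** The length of a step to the left of t that stays inside [0, t]. *)
Definition left_step (t : R) n : R := t / n.+1%:R.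

Lemma left_step_cvg t : t - left_step t n @[n --> \oo] --> t.
Proof.
rewrite -[X in _ --> X]subr0; apply: cvgB; first exact: cvg_cst.
rewrite -[X in _ --> X](mulr0 t); apply: cvgM; first exact: cvg_cst.
exact: cvg_harmonic.
Qed.

Lemma left_step_gt0 t n : 0 < t -> 0 < left_step t n.
Proof. by move=> t0; rewrite divr_gt0. Qed.

Lemma left_step_le t n : 0 < t -> left_step t n <= t.
Proof. by move=> t0; rewrite ler_pdivrMr// ler_peMr ?ler1n// ltW. Qed.

Lemma horner_left_derivative q t : 0 < t ->
  (q.[t] - q.[t - left_step t n]) / left_step t n @[n --> \oo] --> q^`().[t].
Proof.
move=> t0; have /factor_theorem[r hr] : root (q - (q.[t])%:P) t.
  by rewrite /root !hornerE subrr.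
have rt : q^`().[t] = r.[t].
  have := congr1 (fun p => p^`().[t]) hr.
  by rewrite derivB derivC subr0 derivM derivXsubC !hornerE subrr mulr0 add0r.
rewrite rt (_ : (fun n => _) = fun n => r.[t - left_step t n]).
  by apply: continuous_cvg; [exact: horner_continuous|exact: left_step_cvg].
apply/funext => n; have := congr1 (horner^~ (t - left_step t n)) hr.
have := left_step_gt0 n t0; rewrite !hornerE /=.
move: (left_step t n) => y y0 h; have -> : q.[t] - q.[t - y] = r.[t - y] * y.
  by move: h; set A := r.[_]; set C := q.[t - y] => h; lra.
by rewrite mulfK// gt_eqF.
Qed.

(** At x = t both sides vanish, because the kernel of order 0 is 0 there. *)
Lemma tker_left_derivative k t x : 0 < t ->
  (tker k.+1 t x - tker k.+1 (t - left_step t n) x) / left_step t n @[n --> \oo]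
    --> tker k t x.
Proof.
move=> t0; have [tx|xt] := leP t x.
  rewrite (tker0 k tx) (_ : (fun n => _) = cst 0); first exact: cvg_cst.
  apply/funext => n; rewrite (tker0 k.+1 tx) tker0 ?subrr ?mul0r//.
  by rewrite (le_trans _ tx)// gerBl ltW// left_step_gt0.
rewrite (tkerE k xt) -tpolyE -deriv_tpoly.
apply: (@cvg_trans _ (((tpoly k.+1 x).[t] - (tpoly k.+1 x).[t - left_step t n]) / left_step t n
   @[n --> \oo])); last exact: horner_left_derivative.
have near_t : \forall n \near \oo, x < t - left_step t n.
  have tx : 0 < t - x by rewrite subr_gt0.
  have /cvgrPdist_lt/(_ _ tx) := @left_step_cvg t; apply: filterS => n.
  by move=> /(le_lt_trans (ler_norm _)); lra.
by apply: near_eq_cvg; apply: filterS near_t => n h; rewrite (tkerE k.+1 xt) (tkerE k.+1 h) !tpolyE.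
Qed.

Lemma Jint_left_derivative k g t : 0 < t <= 1 -> square_integrable g ->
  (Jint k.+2 g t - Jint k.+2 g (t - left_step t n)) / left_step t n @[n --> \oo]
    --> Jint k.+1 g t.
Proof.
move=> /andP[t0 t1] sg; have [mg _] := sg.
have l0 n := left_step_gt0 n t0.
have l1 n : t - left_step t n <= 1 by rewrite (le_trans _ t1)// gerBl ltW.
have stk n : square_integrable (tker k.+1 (t - left_step t n)) by exact: tker_square_integrable.
have st : square_integrable (tker k.+1 t) by exact: tker_square_integrable.
pose D n x := (tker k.+1 t x - tker k.+1 (t - left_step t n) x) / left_step t n.
have -> : (fun n => (Jint k.+2 g t - Jint k.+2 g (t - left_step t n)) / left_step t n) =
    fun n => \int[mu]_(x in `[0, 1]) (D n x * g x).
  apply/funext => n; rewrite !JintS.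
  have -> : D n = fun x => - (left_step t n)^-1 * tker k.+1 (t - left_step t n) x +
       (fun x => (left_step t n)^-1 * tker k.+1 t x + (fun=> 0) x) x.
    by apply/funext => x; rewrite /D; ring.
  have s1 : square_integrable (fun x => (left_step t n)^-1 * tker k.+1 t x + (fun=> 0) x).
    by apply: square_integrable_lin => //; exact: square_integrable_cst.
  rewrite -/(dot _ g) (@dot_linl _ _ _ _ _ (stk n) s1 sg).
  rewrite (@dot_linl _ _ _ _ _ st (square_integrable_cst 0) sg) dot0l; ring.
rewrite JintS /dot.
apply: (@Rintegral_dominated _ (measurableTypeR R) _ mu _ _ _ (fun x => `|g x|)) => //.
- move=> n; apply: measurable_funM => //; apply: measurable_funM => //.
  by apply: measurable_funB; exact: measurable_tker.
- by apply: measurable_funM => //; exact: measurable_tker.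
- move=> x _; apply: cvgM; last exact: cvg_cst.
  exact: tker_left_derivative.
- by have := square_integrable_integrable sg => /integrable_norm.
- move=> n x; rewrite /= in_itv/= => /andP[x0 _]; rewrite normrM ler_piMl//.
  rewrite /D normrM normfV [X in _ / X]gtr0_norm// ler_pdivrMr// mul1r.
  by rewrite (le_trans (tker_lipschitz _ _ _ _))// opprB addrC subrK gtr0_norm.
Qed.

(** By dominated convergence, as difference quotients of the kernels are bounded
    by 1. *)
Lemma taylor_left_derivative k q g t : 0 < t <= 1 -> square_integrable g ->
  (taylor_fun k.+2 q g t - taylor_fun k.+2 q g (t - left_step t n)) / left_step t n
    @[n --> \oo] --> taylor_fun k.+1 q^`() g t.
Proof.
move=> t01 sg; have /andP[t0 _] := t01.
have := cvgD (horner_left_derivative (q := q) t0) (Jint_left_derivative (k := k) t01 sg).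
set F := (F in F @ _) => h.
rewrite (_ : (fun n => _) = F); first exact: h.
by apply/funext => n; rewrite /F /taylor_fun fctE; ring.
Qed.

End LeftDerivative.

(** * Borel sets of the Sobolev space are generated by evaluations *)

Section SobolevMeasurable.
Context {R : realType}.
Variables (m : nat) (B : 'I_m.+1 -> (R -> R) -> R) (hB : boundary_operator B).
Local Notation sob := (@sobolev R m.+1).

(** A triangle inequality for the square of the norm. *)
Lemma sobolev_dotB_le u v w : sob u -> sob v -> sob w ->
  sobolev_dot B (u \- w) (u \- w) <=
  2 * sobolev_dot B (u \- v) (u \- v) + 2 * sobolev_dot B (v \- w) (v \- w).
Proof.
move=> su sv sw.
have suv := sobolevB su sv; have svw := sobolevB sv sw; have suw := sobolevB su sw.
have [p [f [sp sf uvE]]] := proj1 (sobolevP _ _) suv.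
have [q [g [sq sg vwE]]] := proj1 (sobolevP _ _) svw.
have uwE t : 0 <= t <= 1 -> (u \- w) t = taylor_fun m.+1 (1 *: p + q) (fun x => 1 * f x + g x) t.
  move=> t01; have /andP[_ t1] := t01.
  rewrite taylor_fun_lin// -(uvE _ t01) -(vwE _ t01) /=; ring.
have spq : (size (1 *: p + q)%R <= m.+1)%N.
  by rewrite scale1r (leq_trans (size_polyD _ _))// geq_max sp.
have sfg : square_integrable (fun x => 1 * f x + g x) by exact: square_integrable_lin.
rewrite (sobolev_dot_taylor B spq spq sfg sfg uwE uwE).
rewrite (sobolev_dot_taylor B sp sp sf sf uvE uvE) (sobolev_dot_taylor B sq sq sg sg vwE vwE).
have h1 : dot (fun x => 1 * f x + g x) (fun x => 1 * f x + g x) <= 2 * dot f f + 2 * dot g g.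
  have -> : (fun x => 1 * f x + g x) = (fun x => f x + g x) by apply/funext => x; rewrite mul1r.
  by rewrite -!L2sqnormE; exact: L2sqnormD_le.
have h2 : \sum_j B j (u \- w) * B j (u \- w) <=
   2 * (\sum_j B j (u \- v) * B j (u \- v)) + 2 * \sum_j B j (v \- w) * B j (v \- w).
  rewrite !mulr_sumr -big_split/=; apply: ler_sum => j _.
  rewrite !(boundaryB hB)//.
  have := sqr_ge0 ((B j u - B j v) - (B j v - B j w)); nra.
by move: h1 h2; set a := dot _ _; set b := \sum_j _; lra.
Qed.

Lemma sobolev_dotBC u v : sob u -> sob v ->
  sobolev_dot B (u \- v) (u \- v) = sobolev_dot B (v \- u) (v \- u).
Proof.
move=> su sv.
have suv := sobolevB su sv; have [p [f [sp sf uvE]]] := proj1 (sobolevP _ _) suv.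
have vuE t : 0 <= t <= 1 -> (v \- u) t = taylor_fun m.+1 (-1 *: p + 0) (fun x => -1 * f x + 0) t.
  move=> t01; have /andP[_ t1] := t01.
  have s0 : square_integrable (fun=> 0 : R) by exact: square_integrable_cst.
  rewrite (@taylor_fun_lin _ m.+1 (-1) p 0 f (fun=> 0) t t1 sf s0) -(uvE _ t01).
  by rewrite /taylor_fun Jint_cst0 horner0 /=; ring.
have sp' : (size (-1 *: p + 0)%R <= m.+1)%N by rewrite addr0 scaleN1r size_polyN.
have sf' : square_integrable (fun x => -1 * f x + 0).
  by apply: (@square_integrable_lin _ (-1) f (fun=> 0)) => //; exact: square_integrable_cst.
rewrite (sobolev_dot_taylor B sp sp sf sf uvE uvE) (sobolev_dot_taylor B sp' sp' sf' sf' vuE vuE).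
congr (_ + _).
  by apply: eq_Rintegral => x _; ring.
by apply: eq_bigr => j _; rewrite !(boundaryB hB)//; ring.
Qed.

Context dS (S : measurableType dS) (h : S -> R -> R).
Hypothesis sh : forall w, sob (h w).
Hypothesis mh : forall t, 0 <= t <= 1 -> measurable_fun setT (fun w => h w t).

Section Representation.
Variables (p : S -> {poly R}) (g : S -> R -> R).
Hypothesis sp : forall w, (size (p w) <= m.+1)%N.
Hypothesis sg : forall w, square_integrable (g w).
Hypothesis hE : forall w t, 0 <= t <= 1 -> h w t = taylor_fun m.+1 (p w) (g w) t.

Let H j w t := taylor_fun (m.+1 - j) (p w)^`(j) (g w) t.

(** Derivatives are limits of difference quotients, to the left at positive points
    and by continuity at 0. *)
Lemma measurable_taylor_derivative j t : (j <= m)%N -> 0 <= t <= 1 ->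
  measurable_fun setT (fun w => H j w t).
Proof.
elim: j t => [|j IH] t jm t01.
  rewrite (_ : (fun w => _) = fun w => h w t); first exact: mh.
  by apply/funext => w; rewrite hE// /H subn0 derivn0.
have km : (m.+1 - j = (m.+1 - j.+2).+2)%N by lia.
have km1 : (m.+1 - j.+1 = (m.+1 - j.+2).+1)%N by lia.
have pos s : 0 < s <= 1 -> measurable_fun setT (fun w => H j.+1 w s).
  move=> s01; have /andP[s0 s1] := s01.
  apply: (@measurable_fun_cvg _ _ _ _
    (fun n w => (H j w s - H j w (s - left_step s n)) / left_step s n)).
    move=> n; apply: measurable_funM; last exact: measurable_cst.
    apply: measurable_funB; apply: IH; rewrite ?(ltnW jm) ?(ltW s0)//.
    rewrite subr_ge0 left_step_le// (le_trans _ s1)// gerBl ltW//; exact: left_step_gt0.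
  move=> w _; rewrite /H km km1 derivnS; exact: taylor_left_derivative.
have [t0|t0] := eqVneq t 0; last first.
  by apply: pos; rewrite lt_neqAle eq_sym t0; move/andP: t01 => [-> ->].
apply: (@measurable_fun_cvg _ _ _ _ (fun n w => H j.+1 w n.+1%:R^-1)).
  by move=> n; apply: pos; rewrite invr_gt0 ltr0Sn/= invf_le1// ler1n.
move=> w _; rewrite t0 /H km1.
have /within_continuousP01 c := @taylor_continuous _ (m.+1 - j.+2) (p w)^`(j.+1) _ (sg w).
apply/cvgrPdist_le => e e0; have [r r0 hr] := c 0 (ltac:(by rewrite lexx ler01)) e e0.
have := near_infty_natSinv_lt (PosNum r0); apply: filterS => n /= hn.
have n0 : 0 <= n.+1%:R^-1 :> R by rewrite invr_ge0.
by apply: hr; [rewrite n0 invf_le1// ler1n|rewrite sub0r normrN ger0_norm].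
Qed.

(** The coefficients of the polynomial are the derivatives at 0, up to factorials. *)
Lemma measurable_taylor_coef i : (i <= m)%N -> measurable_fun setT (fun w => (p w)`_i).
Proof.
move=> im; rewrite (_ : (fun w => _) = fun w => i`!%:R^-1 * H i w 0).
  apply: measurable_funM; first exact: measurable_cst.
  by apply: measurable_taylor_derivative; rewrite ?lexx ?ler01.
apply/funext => w; rewrite /H /taylor_fun subSn// [Jint _ _ _]/=.
have -> : \int[lebesgue_measure]_(x in `[0, 1]) (tker (m - i) 0 x * g w x) = 0.
  rewrite -[RHS](dot0l (g w)) /dot; apply: eq_Rintegral => x.
  by rewrite inE/= in_itv/= => /andP[x0 _]; rewrite tker0.
rewrite addr0 horner_coef0 coef_derivn addn0 ffactnn -[X in _ * X]mulr_natl mulKf//.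
Qed.

(** The integral of the highest derivative over a cell is an increment of the
    derivative of order m. *)
Lemma measurable_cell_avg n i : (i < n.+1)%N -> measurable_fun setT (fun w => cell_avg n (g w) i).
Proof.
move=> ni; apply: measurable_funM; first exact: measurable_cst.
rewrite (_ : (fun w => _) = fun w => H m w (i.+1%:R / n.+1%:R) - H m w (i%:R / n.+1%:R)).
  have h1 := @itv_grid R n i.+1 ni; have h2 := @itv_grid R n i (ltnW ni).
  by apply: measurable_funB; apply: measurable_taylor_derivative.
apply/funext => w; rewrite /H /taylor_fun subSn// subnn.
have -> : (p w)^`(m) = ((p w)^`(m)`_0)%:P.
  apply/polyP => k; rewrite coefC; case: eqP => [->//|/eqP k0].
  rewrite coef_derivn nth_default ?mul0rn//.
  by rewrite (leq_trans (sp w))// -addn1 leq_add2l lt0n.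
rewrite !hornerC !JintS.
rewrite (_ : cell n i = fun x => -1 * tker 0 (i%:R / n.+1%:R) x + tker 0 (i.+1%:R / n.+1%:R) x);
  last by apply/funext => x; rewrite /cell; ring.
rewrite dot_linl//; first by ring.
- by apply: tker_square_integrable; have /andP[] := @itv_grid R n i (ltnW ni).
- by apply: tker_square_integrable; have /andP[] := @itv_grid R n i.+1 ni.
Qed.

Let code_type n : countType := ({ffun 'I_m.+1 -> int} * {ffun 'I_n.+1 -> int})%type.

Let code n w : code_type n :=
  ([ffun i : 'I_m.+1 => Num.floor ((p w)`_i * n.+1%:R)],
   [ffun i : 'I_n.+1 => Num.floor (cell_avg n (g w) i * n.+1%:R)]).

Let decode n (c : code_type n) : R -> R :=
  taylor_fun m.+1 (\poly_(i < m.+1) ((c.1 (inord i))%:~R / n.+1%:R))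
    (fun x => \sum_(i < n.+1) ((c.2 i)%:~R / n.+1%:R) * cell n i x).

Let codeK n w : decode (code n w) = coarse n m.+1 (p w) (g w).
Proof.
rewrite /decode /coarse /coarse_poly /coarse_step /round_to; congr (taylor_fun _ _ _).
  by apply/polyP => i; rewrite !coef_poly; case: ifP => // im; rewrite ffunE inordK.
by apply/funext => x; apply: eq_bigr => i _; rewrite ffunE.
Qed.

Let measurable_floor_eq (f : S -> R) (z : int) : measurable_fun setT f ->
  measurable [set w | Num.floor (f w) = z].
Proof.
move=> mf; rewrite (_ : [set w | _] = f @^-1` `[z%:~R, (z + 1)%:~R[).
  by rewrite -[X in measurable X]setTI; exact: mf.
apply/seteqP; split => w /=; rewrite in_itv/=.
  by move=> <-; exact: floor_itv.
by move=> hz; exact: floor_def.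
Qed.

(** The coarse approximations take countably many values, described by integer
    codes. *)
Lemma measurable_coarse n (U : set (R -> R)) :
  measurable [set w | U (coarse n m.+1 (p w) (g w))].
Proof.
rewrite (_ : [set w | _] = \bigcup_(c in [set: code_type n])
    [set w | U (decode c) /\ code n w = c]).
  apply: countable_bigcupT_measurable; first exact: countableP.
  move=> c; have [Uc|Uc] := pselect (U (decode c)); last first.
    by rewrite (_ : [set w | _] = set0)//; apply/seteqP; split => w // [].
  rewrite (_ : [set w | _] =
    (\bigcap_(i in [set: 'I_m.+1]) [set w | Num.floor ((p w)`_i * n.+1%:R) = c.1 i]) `&`
    (\bigcap_(i in [set: 'I_n.+1]) [set w | Num.floor (cell_avg n (g w) i * n.+1%:R) = c.2 i])).
    apply: measurableI; apply: fin_bigcap_measurable => // i _; apply: measurable_floor_eq.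
      by apply: measurable_funM; [apply: measurable_taylor_coef; rewrite -ltnS|exact: measurable_cst].
    by apply: measurable_funM; [exact: measurable_cell_avg|exact: measurable_cst].
  apply/seteqP; split => w /=.
    by move=> [_ <-]; split => i _ /=; rewrite ffunE.
  move=> [h1 h2]; split => //; rewrite [c]surjective_pairing; congr pair; apply/ffunP => i; rewrite ffunE.
    exact: h1.
  exact: h2.
apply/seteqP; split => w /=.
  by move=> Uw; exists (code n w) => //=; rewrite codeK.
by move=> [c _ [Uc ec]]; rewrite -codeK ec.
Qed.

End Representation.

(** Random functions in H^(m + 1) whose evaluations are measurable are Borel
    measurable: membership of an open set O is decided by the coarse
    approximations, which eventually lie well inside O exactly when the function
    is in O. *)
Lemma sobolev_measurable O : sobolev_open B O -> measurable (h @^-1` O).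
Proof.
move=> [Osob Oopen].
have rep w : exists pg : {poly R} * (R -> R), [/\ (size pg.1 <= m.+1)%N,
    square_integrable pg.2 &
    forall t, 0 <= t <= 1 -> h w t = taylor_fun m.+1 pg.1 pg.2 t].
  by have [p [g [sp sg hE]]] := proj1 (sobolevP _ _) (sh w); exists (p, g).
have [pg hpg] := choice rep.
have sp w : (size (pg w).1 <= m.+1)%N by have [] := hpg w.
have sg w : square_integrable (pg w).2 by have [] := hpg w.
have hE w t : 0 <= t <= 1 -> h w t = taylor_fun m.+1 (pg w).1 (pg w).2 t.
  by have [_ _] := hpg w; exact.
pose C n w := coarse n m.+1 (pg w).1 (pg w).2.
have sC n w : sob (C n w) by apply: taylor_sobolev; exact: coarse_step_square_integrable.
pose U k := [set u | sob u /\ forall v, sob v ->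
  sobolev_dot B (v \- u) (v \- u) < k.+1%:R^-1 -> O v].
rewrite (_ : h @^-1` O = \bigcup_k \bigcup_N \bigcap_(n in [set n | (N <= n)%N]) [set w | U k (C n w)]).
  apply: bigcupT_measurable => k; apply: bigcupT_measurable => N.
  apply: bigcap_measurable; first by exists N => /=.
  by move=> n _; exact: (@measurable_coarse (fun w => (pg w).1) (fun w => (pg w).2) sp sg hE).
apply/seteqP; split => w /=.
  move=> /Oopen[e e0 he].
  have e1 : 0 < e ^+ 2 / 4 by rewrite divr_gt0// exprn_gt0.
  have [k _ /(_ k (leqnn k))/= hk] := near_infty_natSinv_lt (PosNum e1).
  have k0 : 0 < k.+1%:R^-1 :> R by rewrite invr_gt0.
  have [N hN] := coarse_cvg hB (sp w) (sg w) (hE w) k0.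
  exists k => //; exists N => // n /hN hn; split => // v sv hv.
  apply: he => //; rewrite -[ltRHS](gtr0_norm e0) -sqrtr_sqr ltr_sqrt ?exprn_gt0//.
  have := sobolev_dotB_le sv (sC n w) (sh w); rewrite (sobolev_dotBC (sC n w) (sh w)).
  rewrite /C in hv *; move: hv hn hk; set a := k.+1%:R^-1.
  by move: (sobolev_dot B _ _) (sobolev_dot B _ _) (sobolev_dot B _ _) => x y z; lra.
move=> [k _ [N _ hN]].
have k0 : 0 < k.+1%:R^-1 :> R by rewrite invr_gt0.
have [N' hN'] := coarse_cvg hB (sp w) (sg w) (hE w) k0.
have [_ hU] := hN (maxn N N') (leq_maxl _ _).
by apply: hU => //; exact: (hN' _ (leq_maxr _ _)).
Qed.

End SobolevMeasurable.

(** * Independence and averaging over the learning sample *)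

Section Independence.
Context {R : realType} d (T : measurableType d) (P : probability T R).
Context d' (E : measurableType d').

Lemma measurable_box n (A : 'I_n -> set E) : (forall i, measurable (A i)) ->
  measurable [set t : n.-tuple E | forall i, A i (tnth t i)].
Proof.
move=> mA; rewrite (_ : [set t | _] =
    \bigcap_(i in [set: 'I_n]) ((fun t : n.-tuple E => tnth t i) @^-1` A i)).
  apply: fin_bigcap_measurable => // i _; rewrite -[X in measurable X]setTI.
  exact: measurable_tnth.
by apply/seteqP; split => t /= h; [move=> i _; exact: h|move=> i; exact: h].
Qed.

(** Products of measurable sets, as sets of tuples. *)
Definition boxes n : set (set (n.-tuple E)) := [set S | exists2 A : 'I_n -> set E,
  (forall i, measurable (A i)) & S = [set t | forall i, A i (tnth t i)]].

Lemma measurable_tupleE n : (@measurable _ (n.-tuple E)) = <<s @boxes n >>.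
Proof.
apply/seteqP; split => S; last first.
  apply: smallest_sub; first exact: sigma_algebra_measurable.
  by move=> _ [A mA ->]; exact: measurable_box.
move=> mS.
have : measurable_fun setT (id : g_sigma_algebraType (@boxes n) -> n.-tuple E).
  apply/measurable_fun_tnthP => i _ A mA; rewrite setTI.
  apply: sub_sigma_algebra; exists (fun j => if j == i then A else setT).
    by move=> j; case: ifP.
  apply/seteqP; split => t /=; last by move=> /(_ i); rewrite eqxx.
  by move=> h j; case: eqP => [->|].
by move=> /(_ measurableT S mS); rewrite setTI.
Qed.

Lemma measurable_fun_tuple d2 (T2 : measurableType d2) (D : set T2) n (f : T2 -> n.-tuple E) :
  measurable D -> (forall i, measurable_fun D (fun x => tnth (f x) i)) -> measurable_fun D f.
Proof.
move=> mD mf; apply: (measurability _ (measurable_tupleE n)).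
move=> _ [_ [A mA ->] <-].
rewrite (_ : _ `&` _ = D `&` \bigcap_(i in [set: 'I_n]) (D `&` (fun x => tnth (f x) i) @^-1` A i)).
  apply: measurableI => //; apply: fin_bigcap_measurable => // i _; exact: mf.
apply/seteqP; split => x /=; first by move=> [Dx h]; split => // i _; split => //; exact: h.
by move=> [Dx h]; split => // i; have [] := h i I.
Qed.

Lemma boxes_setI n : setI_closed (@boxes n).
Proof.
move=> _ _ [A mA ->] [A' mA' ->]; exists (fun i => A i `&` A' i).
  by move=> i; exact: measurableI.
apply/seteqP; split => t /=; first by move=> [h h'] i; split.
by move=> h; split => i; have [] := h i.
Qed.

(** An event that is independent of the boxes is independent of the tuple. *)
Lemma indep_boxes n (W : T -> n.-tuple E) (Q : set T) : measurable_fun setT W ->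
  measurable Q ->
  (forall A : 'I_n -> set E, (forall i, measurable (A i)) ->
    P (W @^-1` [set t | forall i, A i (tnth t i)] `&` Q) =
    (P (W @^-1` [set t | forall i, A i (tnth t i)]) * P Q)%E) ->
  forall S, measurable S -> P (W @^-1` S `&` Q) = (P (W @^-1` S) * P Q)%E.
Proof.
move=> mW mQ hbox S mS.
have mWS S' : measurable S' -> measurable (W @^-1` S').
  by move=> mS'; rewrite -[X in measurable X]setTI; exact: mW.
pose H := [set S : set (n.-tuple E) | measurable S /\
  P (W @^-1` S `&` Q) = (P (W @^-1` S) * P Q)%E].
suff : <<s @boxes n >> `<=` H by rewrite -measurable_tupleE => /(_ _ mS) [].
have Pfin A : measurable A -> P A \is a fin_num by move=> mA; exact: fin_num_measure.
apply: lambda_system_subset => //; first exact: boxes_setI.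
  split => //.
  - by split => //; rewrite preimage_setT setTI probability_setT mul1e.
  - move=> A A' AA' [mA hA] [mA' hA']; split; first exact: measurableD.
    have -> : W @^-1` (A `\` A') = W @^-1` A `\` W @^-1` A' by [].
    have E1 : (W @^-1` A `\` W @^-1` A') `&` Q = (W @^-1` A `&` Q) `\` (W @^-1` A' `&` Q).
      apply/seteqP; split => w /=; first by move=> [[h1 h2] h3]; split => // -[].
      by move=> [[h1 h2] h3]; do ![split => //]; move=> h4; apply: h3.
    rewrite E1 !measureD; rewrite ?(le_lt_trans (probability_le1 _ _)) ?ltry//;
      try (by apply: measurableI => //; exact: mWS); try exact: mWS.
    have -> : W @^-1` A `&` W @^-1` A' = W @^-1` A'.
      by apply/setIidPr => w; exact: AA'.
    have -> : (W @^-1` A `&` Q) `&` (W @^-1` A' `&` Q) = W @^-1` A' `&` Q.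
      by apply/setIidPr => w [h1 h2]; split => //; exact: AA'.
    rewrite [X in (X - _)%E]hA [X in (_ - X)%E]hA' muleBl//; first exact: Pfin.
    by apply: fin_num_adde_defr; apply: Pfin; exact: mWS.
  - move=> F ndF hF; have mF i : measurable (F i) by have [] := hF i.
    split; first exact: bigcupT_measurable.
    have c1 : P \o (fun i => W @^-1` F i `&` Q) @ \oo --> P (\bigcup_i (W @^-1` F i `&` Q)).
      apply: nondecreasing_cvg_mu.
      - by move=> i; apply: measurableI => //; exact: mWS.
      - by apply: bigcupT_measurable => i; apply: measurableI => //; exact: mWS.
      - move=> i j ij; apply/subsetPset; apply: setSI => w.
        by have /subsetPset := ndF _ _ ij; apply.
    have c2 : P \o (fun i => W @^-1` F i) @ \oo --> P (\bigcup_i (W @^-1` F i)).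
      apply: nondecreasing_cvg_mu.
      - by move=> i; exact: mWS.
      - by apply: bigcupT_measurable => i; exact: mWS.
      - move=> i j ij; apply/subsetPset => w.
        by have /subsetPset := ndF _ _ ij; apply.
    have c3 : (fun i => P (W @^-1` F i) * P Q)%E @ \oo --> (P (\bigcup_i (W @^-1` F i)) * P Q)%E.
      by apply: cvgeMr => //; exact: Pfin.
    rewrite preimage_bigcup setI_bigcupl.
    apply: (cvg_unique _ c1); first exact: ereal_hausdorff.
    rewrite /= (_ : P \o _ = fun i => P (W @^-1` F i) * P Q)%E//.
    by apply/funext => i /=; have [_ ->] := hF i.
move=> _ [A mA ->]; split; first exact: measurable_box.
exact: hbox.
Qed.

(** An observation is independent of the tuple of the n other ones. *)
Lemma independent_tuple (Z : T -> E) (Zs : nat -> T -> E) n (A : set (n.-tuple E)) (C : set E) :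
  measurable_fun setT Z -> (forall i, measurable_fun setT (Zs i)) ->
  mutually_independent P (fun o : option nat => if o is Some i then Zs i else Z) ->
  measurable A -> measurable C ->
  P ((fun w => [tuple Zs i w | i < n]) @^-1` A `&` Z @^-1` C) =
  (P ((fun w => [tuple Zs i w | i < n]) @^-1` A) * P (Z @^-1` C))%E.
Proof.
move=> mZ mZs ind mA mC; apply: indep_boxes => //.
- apply/measurable_fun_tnthP => i; rewrite (_ : _ \o _ = Zs i)//.
  by apply/funext => w; rewrite /= tnth_mktuple.
- by rewrite -[X in measurable X]setTI; exact: mZ.
move=> {A mA} A mA.
pose A' (o : option nat) : set E := if o is Some i
  then (if insub i is Some j then A j else setT) else C.
have mA' o : measurable (A' o).
  by case: o => //= i; case: insubP => // j _ _; exact: mA.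
pose s := map Some (iota 0 n).
have us : uniq s by rewrite map_inj_uniq ?iota_uniq// => x y [].
have usN : uniq (None :: s).
  by rewrite /= us andbT; apply/mapP => -[].
have h1 := ind s A' us mA'; have h2 := ind (None :: s) A' usN mA'.
set V := fun w => _.
have E1 : V @^-1` [set t | forall i, A i (tnth t i)] =
    \bigcap_(o in [set` s]) ((if o is Some i then Zs i else Z) @^-1` A' o).
  apply/seteqP; split => w /=.
    move=> h o /mapP[k]; rewrite mem_iota add0n => /= hin -> /=.
    by rewrite insubT/=; have := h (Ordinal hin); rewrite /V tnth_mktuple.
  move=> h i; have := h (Some (val i)); rewrite /V tnth_mktuple /= valK; apply.
  by apply/mapP; exists (val i) => //; rewrite mem_iota add0n ltn_ord.
have E2 : V @^-1` [set t | forall i, A i (tnth t i)] `&` Z @^-1` C =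
    \bigcap_(o in [set` (None :: s)]) ((if o is Some i then Zs i else Z) @^-1` A' o).
  rewrite E1; apply/seteqP; split => w /=.
    move=> [h Cw] o; rewrite [X in X -> _]/= inE => /orP[/eqP ->//|]; exact: h.
  move=> h; split; last by have := h None; apply; rewrite /= inE eqxx.
  by move=> o os; apply: h; rewrite /= inE os orbT.
by rewrite E2 h2 E1 h1 big_cons muleC.
Qed.

(** Independent copies remain so after a transformation. *)
Lemma independent_copies_map d2 (E2 : measurableType d2) (f : E -> E2)
    (Z : T -> E) (Zs : nat -> T -> E) : measurable_fun setT f ->
  independent_copies P Z Zs ->
  independent_copies P (f \o Z) (fun i => f \o Zs i).
Proof.
move=> mf [id ind].
have mpre A : measurable A -> measurable (f @^-1` A).
  by move=> mA; rewrite -[X in measurable X]setTI; exact: mf.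
split => [i A mA|s A us mA].
  exact: (id i (f @^-1` A) (mpre _ mA)).
have preo (o : option nat) : (if o is Some i then f \o Zs i else f \o Z) @^-1` A o =
    (if o is Some i then Zs i else Z) @^-1` (f @^-1` A o) by case: o.
rewrite (eq_bigcapr (fun o _ => preo o)) (ind s (fun o => f @^-1` A o) us); last first.
  by move=> o; exact: mpre.
by apply: eq_bigr => o _; rewrite preo.
Qed.

End Independence.

Section Fubini.
Context {R : realType} d (T : measurableType d) (P : probability T R).
Context d1 (E1 : measurableType d1) d2 (E2 : measurableType d2).

(** Integrating over two independent variables separately or jointly. *)
Lemma RV_fubini (W : {RV P >-> E1}) (Z : {RV P >-> E2}) (F : E1 * E2 -> \bar R) :
  measurable_fun setT F -> (forall x, (0 <= F x)%E) ->
  (forall A C, measurable A -> measurable C ->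
    P (W @^-1` A `&` Z @^-1` C) = (P (W @^-1` A) * P (Z @^-1` C))%E) ->
  (\int[P]_w \int[P]_w' F (W w, Z w') = \int[P]_w F (W w, Z w))%E.
Proof.
move=> mF F0 ind.
have mWZ : measurable_fun setT (fun w => (W w, Z w)) by exact: measurable_fun_pair.
pose WZ : {RV P >-> (E1 * E2)%type} := HB.pack (fun w => (W w, Z w))
  (isMeasurableFun.Build _ _ _ _ (fun w => (W w, Z w)) mWZ).
have -> : (\int[P]_w F (W w, Z w) = \int[distribution P WZ]_z F z)%E.
  by rewrite ge0_integral_distribution.
have E0 : (\int[distribution P WZ]_z F z =
    \int[(distribution P W \x distribution P Z)]_z F z)%E.
  apply: eq_measure_integral => A mA _; apply/esym.
  by apply: product_measure_unique.
rewrite E0 fubini_tonelli1//.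
rewrite ge0_integral_distribution//; last 2 first.
- exact: measurable_fun_fubini_tonelli_F.
- by move=> x; apply: integral_ge0.
apply: eq_integral => w _; rewrite /= /fubini_F ge0_integral_distribution//.
by apply: measurableT_comp => //; exact: measurable_pair1.
Qed.

End Fubini.

Section Risk.
Context {R : realType} d (T : measurableType d) (P : probability T R).
Variable c : learning_problem.
Implicit Types F Y : T -> R.

(** The pointwise loss whose expectation is the risk. *)
Definition loss (y v : R) : R :=
  match c with Classification => (y != v)%:R | Regression => (y - v) ^+ 2 end.

Lemma loss_ge0 y v : 0 <= loss y v.
Proof. by rewrite /loss; case: c; rewrite ?sqr_ge0. Qed.

Lemma measurable_loss d' (S : measurableType d') (f g : S -> R) :
  measurable_fun setT f -> measurable_fun setT g ->
  measurable_fun setT (fun w => loss (f w) (g w)).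
Proof.
move=> mf mg; rewrite /loss; case: c; last first.
  by apply: measurable_funX; exact: measurable_funB.
have mfg : measurable_fun setT (f \- g) by exact: measurable_funB.
have mA : measurable ((f \- g) @^-1` [set 0]).
  by rewrite -[X in measurable X]setTI; exact: mfg.
rewrite (_ : (fun w => _) = \1_(~` ((f \- g) @^-1` [set 0]))).
  by apply: measurable_indic; exact: measurableC.
apply/funext => w; rewrite indicE; congr (_%:R); apply/esym.
have [h|h] := eqVneq (f w) (g w).
  by rewrite memNset//=; apply; rewrite h subrr.
by rewrite mem_set//= => /eqP; rewrite subr_eq0; exact/negP.
Qed.

Lemma riskE F Y : measurable_fun setT F -> measurable_fun setT Y ->
  risk c P F Y = (\int[P]_w (loss (F w) (Y w))%:E)%E.
Proof.
move=> mF mY; have := measurable_loss mF mY; rewrite /risk /loss; case: c => ml; last first.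
  by rewrite unlock.
have E1 : (fun w => (F w != Y w)%:R) = \1_[set w | F w <> Y w] :> (T -> R).
  apply/funext => w; rewrite indicE; congr (_%:R).
  by have [h|/eqP h] := eqVneq (F w) (Y w); [rewrite memNset|rewrite mem_set].
have mA : measurable [set w | F w <> Y w].
  rewrite (_ : [set w | _] = (fun w => (F w != Y w)%:R : R) @^-1` [set 1]).
    by rewrite -[X in measurable X]setTI; exact: ml.
  apply/seteqP; split => w /=; first by move/eqP => ->.
  by case: eqP => // _ /eqP; rewrite eq_sym oner_eq0.
rewrite -[X in P X = _]setIT -integral_indic//; apply: eq_integral => w _; congr EFin.
by have := congr1 (fun f => f w) E1.
Qed.

Lemma measurable_labels : measurable (@labels R c).
Proof. by rewrite /labels; case: c => //; exact: measurableU. Qed.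

Section Scheme.
Variables (psi : @multivariate_scheme R) (psi_scheme : is_scheme c psi).
Variables (p n : nat) (p1 : (1 <= p)%N).

Lemma measurable_labelled :
  measurable [set z : n.-tuple (p.-tuple R * R) * p.-tuple R | labelled_by (labels c) z.1].
Proof.
pose A (i : 'I_n) : set (p.-tuple R * R) := setT `*` labels c.
have mA i : measurable (A i) by apply: measurableX => //; exact: measurable_labels.
rewrite (_ : [set z | _] = fst @^-1` [set t | forall i, A i (tnth t i)]).
  by rewrite -[X in measurable X]setTI; apply: measurable_fst => //; exact: measurable_box.
by apply/seteqP; split => z /= h i; [split => //; exact: h|have [] := h i].
Qed.

Variables (U : {RV P >-> p.-tuple R}) (V : {RV P >-> R})
    (Us : nat -> {RV P >-> p.-tuple R}) (Vs : nat -> {RV P >-> R}).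
Hypothesis V_label : forall w, labels c (V w).
Hypothesis Vs_label : forall i w, labels c (Vs i w).
Hypothesis copies :
  independent_copies P (fun w => (U w, V w)) (fun i w => (Us i w, Vs i w)).

Let D w := [tuple (Us i w, Vs i w) | i < n].

(** As the learning sample is independent of (U, V), averaging the conditional
    risk gives the joint risk. *)
Lemma expected_conditional_risk :
  (\int[P]_w risk c P (fun w' => psi (D w) (U w')) V)%E =
  risk c P (fun w => psi (D w) (U w)) V.
Proof.
have [psi_label mpsi] := psi_scheme n p1.
have mD : measurable_fun setT D.
  apply/measurable_fun_tnthP => i; rewrite (_ : _ \o _ = fun w => (Us i w, Vs i w)).
    exact: measurable_fun_pair.
  by apply/funext => w; rewrite /= /D tnth_mktuple.
have mUV : measurable_fun setT (fun w => (U w, V w)) by exact: measurable_fun_pair.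
have Dl w : labelled_by (labels c) (D w) by move=> i; rewrite /D tnth_mktuple; exact: Vs_label.
pose L := [set z : n.-tuple (p.-tuple R * R) * p.-tuple R | labelled_by (labels c) z.1].
pose psi0 := (fun z => psi z.1 z.2) \_ L.
have mpsi0 : measurable_fun setT psi0.
  by apply/(measurable_restrictT _ measurable_labelled).
have psi0E w u : psi0 (D w, u) = psi (D w) u.
  by rewrite /psi0 patchE mem_set//; exact: Dl.
pose F (z : n.-tuple (p.-tuple R * R) * (p.-tuple R * R)) : \bar R :=
  (loss (psi0 (z.1, z.2.1)) z.2.2)%:E.
have mF : measurable_fun setT F.
  apply/measurable_EFinP; apply: measurable_loss.
    apply: (measurableT_comp mpsi0); apply: measurable_fun_pair => //.
    exact: (measurableT_comp measurable_fst).
  exact: (measurableT_comp measurable_snd).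
have F0 z : (0 <= F z)%E by rewrite lee_fin loss_ge0.
pose W : {RV P >-> n.-tuple (p.-tuple R * R)} := HB.pack D (isMeasurableFun.Build _ _ _ _ D mD).
pose Z : {RV P >-> (p.-tuple R * R)%type} := HB.pack (fun w => (U w, V w))
  (isMeasurableFun.Build _ _ _ _ (fun w => (U w, V w)) mUV).
have ind A C : measurable A -> measurable C ->
    P (W @^-1` A `&` Z @^-1` C) = (P (W @^-1` A) * P (Z @^-1` C))%E.
  have [_ hind] := copies.
  apply: (@independent_tuple _ _ _ P _ _ (fun w => (U w, V w)) (fun i w => (Us i w, Vs i w)) n A C mUV) => //.
  by move=> i; exact: measurable_fun_pair.
have := RV_fubini mF F0 ind; rewrite /F /W /Z /= => h.
rewrite riskE; last 2 first.
- rewrite (_ : (fun w => _) = fun w => psi0 (D w, U w)); last by apply/funext => w; rewrite psi0E.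
  by apply: (measurableT_comp mpsi0); exact: measurable_fun_pair.
- by [].
transitivity (\int[P]_w (loss (psi0 (D w, U w)) (V w))%:E)%E; last first.
  by apply: eq_integral => w _; rewrite psi0E.
rewrite -h; apply: eq_integral => w _; rewrite riskE//; last first.
  rewrite (_ : (fun w' => _) = fun w' => psi0 (D w, U w')); last by apply/funext => w'; rewrite psi0E.
  apply: (measurableT_comp mpsi0); exact: measurable_fun_pair.
by apply: eq_integral => w' _; rewrite psi0E.
Qed.

End Scheme.
End Risk.

(** * Measurability of the transformation of a function *)

Section Evaluation.
Context {R : realType}.
Variables (m : nat) (B : 'I_m.+1 -> (R -> R) -> R) (hB : boundary_operator B).
Local Notation sob := (@sobolev R m.+1 : set (sobolev_borel B)).

Lemma measurable_sobolev : measurable sob.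
Proof. by apply: sub_sigma_algebra; split => // u su; exists 1. Qed.

(** Evaluations are continuous by [evaluation_bound]. *)
Lemma measurable_evaluation (t : R) : 0 <= t <= 1 -> measurable_fun sob (fun h => h t).
Proof.
move=> t01; apply: (measurability _ (RGenOInfty.measurableE R)) => /=.
move=> _ [_ [a ->] <-]; apply: sub_sigma_algebra; split => [u []//|u [su]].
rewrite /= in_itv/= andbT => au.
have [C C0 hC] := evaluation_bound hB.
have C1 : 0 < C + 1 by rewrite ltr_wpDl.
exists ((u t - a) / (C + 1)); first by rewrite divr_gt0// subr_gt0.
move=> v sv; set s := Num.sqrt _ => hs; split => //=; rewrite in_itv/= andbT.
have := hC _ _ (sobolevB sv su) t01; rewrite /=.
have s0 : 0 <= s by exact: sqrtr_ge0.
have : sobolev_dot B (v \- u) (v \- u) <= s ^+ 2.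
  rewrite /s; case: (leP 0 (sobolev_dot B (v \- u) (v \- u))) => h; first by rewrite sqr_sqrtr.
  by rewrite (le_trans (ltW h))// sqr_ge0.
move: (sobolev_dot _ _ _) => q qs hq.
move: hs; rewrite ltr_pdivlMr// => hs.
rewrite ltNge; apply/negP => va.
have h1 : 0 <= s * (C + 1) by rewrite mulr_ge0// ltW.
have h2 : (s * (C + 1)) ^+ 2 < (v t - u t) ^+ 2.
  by rewrite -[ltRHS]sqrrN opprB ltr_pXn2r ?nnegrE//; lra.
have h3 : C * q <= C * s ^+ 2 by exact: ler_wpM2l.
have h4 : C * s ^+ 2 <= (s * (C + 1)) ^+ 2.
  by have := sqr_ge0 s; have := sqr_ge0 (C * s); nra.
lra.
Qed.

Variable tau : seq R.
Hypothesis tau01 : forall t, t \in tau -> 0 <= t <= 1.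

Lemma measurable_sample : measurable_fun sob (sample tau).
Proof.
apply: measurable_fun_tuple; first exact: measurable_sobolev.
move=> i; rewrite (_ : (fun x => _) = fun h : R -> R => h tau`_i).
  by apply: measurable_evaluation; apply: tau01; exact: mem_nth.
by apply/funext => h; rewrite /sample tnth_mktuple.
Qed.

Lemma measurable_mulmx_tuple p (Q : 'M[R]_p) :
  measurable_fun setT (mulmx_tuple Q).
Proof.
apply/measurable_fun_tnthP => i.
rewrite (_ : _ \o _ = fun x : p.-tuple R => \sum_(j < p) Q i j * tnth x j).
  apply: measurable_sum => j; apply: measurable_funM; first exact: measurable_cst.
  exact: measurable_tnth.
apply/funext => x; rewrite /= tnth_mktuple mxE; apply: eq_bigr => j _.
by rewrite mxE.
Qed.

Lemma measurable_transform Q : measurable_fun sob (fun h => mulmx_tuple Q (sample tau h)).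
Proof. by apply: measurableT_comp; [exact: measurable_mulmx_tuple|exact: measurable_sample]. Qed.

End Evaluation.

(** * Grids that become dense *)

Section Grid.
Context {R : realType}.
Implicit Types (tau : seq R).

(** By induction along the grid, a point between two neighbours is at distance at
    most their gap from the second one. *)
Lemma nearest_point (s : seq R) (x0 t e : R) : s != [::] -> x0 <= t <= 1 ->
  (forall g, g \in pairmap (fun s t => t - s) x0 (rcons s 1) -> g <= e) ->
  exists2 y, y \in s & `|t - y| <= e.
Proof.
elim: s x0 => // y s IH x0 _ /andP[x0t t1] /= gap.
have [ty|yt] := leP t y.
  exists y; first by rewrite inE eqxx.
  rewrite ler0_norm ?subr_le0// opprB.
  have := gap (y - x0); rewrite inE eqxx => /(_ isT); lra.
have [s0|s0] := eqVneq s [::].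
  exists y; first by rewrite inE eqxx.
  rewrite gtr0_norm ?subr_gt0//.
  by have := gap (1 - y); rewrite s0 /= !inE eqxx orbT => /(_ isT); lra.
have [||z zs hz] := IH y s0; first by rewrite (ltW yt) t1.
  by move=> g gs; apply: gap; rewrite inE gs orbT.
by exists z => //; rewrite inE zs orbT.
Qed.

Lemma max_gap_nearest tau (t : R) : tau != [::] -> 0 <= t <= 1 ->
  exists i : 'I_(size tau), `|t - tau`_i| <= max_gap tau.
Proof.
move=> tau0 t01; have [|y ys hy] := @nearest_point tau 0 t (max_gap tau) tau0 t01.
  by move=> g gs; rewrite /max_gap; exact: le_bigmax_seq.
by have yi := ys; rewrite -index_mem in yi; exists (Ordinal yi); rewrite /= nth_index.
Qed.

Lemma max_gap_ge0 tau : 0 <= max_gap tau.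
Proof. exact: bigmax_ge_id. Qed.

Section SortedGrid.
Variables (tau : seq R).
Hypothesis tau01 : forall t, t \in tau -> 0 <= t <= 1.
Hypothesis tau_incr : sorted <=%R tau.
Hypothesis tau_uniq : uniq tau.

Lemma min_gap_gt0 : 0 < min_gap tau.
Proof.
rewrite /min_gap; apply: lt_bigmin => // i _.
have i1 : (i.+1 < size tau)%N by have := ltn_ord i; lia.
rewrite subr_gt0 lt_neqAle (nth_uniq 0)//; last exact: ltnW.
rewrite neq_ltn leqnn/=.
by apply: (sorted_leq_nth le_trans le_refl 0 tau_incr) => //; rewrite ?inE//; exact: ltnW.
Qed.

Lemma min_gap_le : (size tau).-1%:R * min_gap tau <= 1.
Proof.
case E : (size tau).-1 => [|n]; first by rewrite mul0r.
have h : \sum_(i < n.+1) min_gap tau <= \sum_(i < n.+1) (tau`_i.+1 - tau`_i).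
  by apply: ler_sum => i _; rewrite /min_gap E; exact: (bigmin_le_cond _ (fun i : 'I_n.+1 => tau`_i.+1 - tau`_i)).
rewrite sumr_const card_ord -mulr_natl in h; apply: (le_trans h).
have := telescope_sumr (nth 0 tau) (leq0n n.+1); rewrite big_mkord => ->.
have l1 : (n.+1 < size tau)%N by lia.
have l0 : (0 < size tau)%N by lia.
have := tau01 (mem_nth 0 l1); have := tau01 (mem_nth 0 l0).
lra.
Qed.

End SortedGrid.

(** The gaps are comparable and their sum is at most 1. *)
Lemma max_gap_cvg (tau : nat -> seq R) :
  (forall d t, t \in tau d -> 0 <= t <= 1) -> (forall d, sorted <=%R (tau d)) ->
  (forall d, uniq (tau d)) ->
  (exists r : R, forall d, max_gap (tau d) / min_gap (tau d) <= r) ->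
  size (tau d) @[d --> \oo] --> \oo ->
  max_gap (tau d) @[d --> \oo] --> 0.
Proof.
move=> t01 ti tu [r hr] cs; apply/cvgrPdist_le => e e0.
have [K hK] : exists K : nat, r / e <= K%:R.
  by exists (Num.truncn (`|r / e|)).+1; rewrite (le_trans (ler_norm _))// ltW// truncnS_gt.
have : \forall d \near \oo, (K.+2 <= size (tau d))%N by move/cvgnyPge: cs; apply.
apply: filterS => d hd; rewrite sub0r normrN ger0_norm ?max_gap_ge0//.
have g0 := min_gap_gt0 (ti d) (tu d).
have := hr d; rewrite ler_pdivrMr// => h1.
have h2 := min_gap_le (t01 d) (ti d) (tu d).
have h3 : K.+1%:R <= (size (tau d)).-1%:R :> R by rewrite ler_nat; lia.
have h4 : r <= K.+1%:R * e.
  by rewrite -ler_pdivrMr// (le_trans hK)// ler_nat.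
have h5 : K.+1%:R * min_gap (tau d) <= 1.
  by apply: le_trans h2; apply: ler_wpM2r => //; exact: ltW.
apply: (le_trans h1).
have : r * min_gap (tau d) <= K.+1%:R * e * min_gap (tau d) by apply: ler_wpM2r => //; exact: ltW.
move: h5; set k := K.+1%:R; set g := min_gap _ => h5 h6; apply: (le_trans h6).
rewrite mulrAC -[leRHS]mul1r; apply: ler_wpM2r => //; exact: ltW.
Qed.

End Grid.

Section Invertible.
Context {R : realType}.
Lemma mulmx_tupleK p (Q : 'M[R]_p) : Q \in unitmx ->
  cancel (mulmx_tuple Q) (mulmx_tuple (invmx Q)).
Proof.
move=> uQ x; apply: eq_from_tnth => i; rewrite tnth_mktuple.
rewrite (_ : \col_j tnth (mulmx_tuple Q x) j = Q *m \col_j tnth x j).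
  by rewrite mulKmx// mxE.
by apply/matrixP => k l; rewrite mxE tnth_mktuple (ord1 l).
Qed.
End Invertible.

(** * Rules that only use the sampled functions *)

Section Sampling.
Context {R : realType}.
Variables (m : nat) (B : 'I_m.+1 -> (R -> R) -> R) (hB : boundary_operator B).
Context d (T : measurableType d) (P : probability T R).
Variables (X : {RV P >-> sobolev_borel B}).
Hypothesis X_sobolev : forall w, sobolev m.+1 (X w).
Variable (tau : nat -> seq R).
Hypothesis tau01 : forall k t, t \in tau k -> 0 <= t <= 1.
Hypothesis tau0 : forall k, tau k != [::].
Hypothesis gap_cvg : max_gap (tau k) @[k --> \oo] --> 0.

Lemma measurable_sampled d' (S : measurableType d') (f : (R -> R) -> S) :
  measurable_fun (sobolev m.+1 : set (sobolev_borel B)) f -> measurable_fun setT (fun w => f (X w)).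
Proof.
move=> mf _ A mA; rewrite setTI.
rewrite (_ : _ @^-1` A = X @^-1` (sobolev m.+1 `&` f @^-1` A)).
  rewrite -[X in measurable X]setTI; apply: measurable_funPT => //.
  by apply: mf => //; exact: measurable_sobolev.
by apply/seteqP; split => w /=; [split => //; exact: X_sobolev|move=> []].
Qed.

Let Z k w := sample (tau k) (X w).

Let mZ k : measurable_fun setT (Z k).
Proof. exact: (measurable_sampled (measurable_sample hB (@tau01 k))). Qed.

(** Evaluation at t is the limit of the evaluations at the nearest grid points. *)
Lemma known_evaluation t : 0 <= t <= 1 ->
  measurable_fun (setT : set (known P Z)) (fun w => X w t).
Proof.
move=> t01.
pose ind k := projT1 (cid (max_gap_nearest (tau0 k) t01)).
have hind k : `|t - (tau k)`_(ind k)| <= max_gap (tau k) by rewrite /ind; case: cid.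
apply: (known_cvg mZ (U_ := fun k z => tnth z (ind k))).
  by move=> k; exact: measurable_tnth.
move=> w; rewrite (_ : (fun k => _) = fun k => X w (tau k)`_(ind k)); last first.
  by apply/funext => k; rewrite /Z tnth_mktuple.
have [/within_continuousP01 c _ _ _] := X_sobolev w.
apply/cvgrPdist_le => e e0; have [r r0 hr] := c t t01 e e0.
move/cvgrPdist_lt : gap_cvg => /(_ _ r0); apply: filterS => k.
rewrite sub0r normrN ger0_norm ?max_gap_ge0// => h.
by apply: hr; [apply: (@tau01 k); exact: mem_nth|exact: le_lt_trans (hind k) h].
Qed.

(** Hence the events about X are asymptotically determined by its samples. *)
Lemma known_sobolev (A : set (sobolev_borel B)) : measurable A ->
  measurable (X @^-1` A : set (known P Z)).
Proof.
move=> mA.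
have mX : measurable_fun (setT : set (known P Z)) (X : known P Z -> sobolev_borel B).
  apply: (@measurability _ _ (known P Z) (sobolev_borel B) setT X (sobolev_open B) erefl).
  move=> _ [V oV <-]; rewrite setTI.
  exact: (@sobolev_measurable _ _ _ hB _ (known P Z) X X_sobolev known_evaluation _ oV).
by have := mX measurableT A mA; rewrite setTI.
Qed.

Lemma known_sobolev_fun (phi : sobolev_borel B -> R) :
  measurable_fun (sobolev m.+1 : set (sobolev_borel B)) phi ->
  measurable_fun (setT : set (known P Z)) (phi \o X).
Proof.
move=> mphi _ A mA; rewrite setTI.
rewrite (_ : _ @^-1` A = X @^-1` (sobolev m.+1 `&` phi @^-1` A)).
  by apply: known_sobolev; apply: mphi => //; exact: measurable_sobolev.
by apply/seteqP; split => w /=; [split => //; exact: X_sobolev|move=> []].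
Qed.

Local Notation sob := (sobolev m.+1 : set (sobolev_borel B)).

(** The risk of a measurable rule on H^m is approached by rules that only use the
    sampled functions. *)
Lemma sampled_risk c (Y : {RV P >-> R}) (phi : sobolev_borel B -> R) (e : R) :
  (c = Regression -> (\int[P]_w ((Y w ^+ 2)%:E) < +oo)%E) -> measurable_fun sob phi ->
  (forall x, sob x -> labels c (phi x)) -> 0 < e -> (risk c P (phi \o X) Y < +oo)%E ->
  exists N, forall k, (N <= k)%N -> exists phik : (size (tau k)).-tuple R -> R,
    [/\ measurable_fun setT phik, (forall z, labels c (phik z)) &
        (risk c P (phik \o Z k) Y <= risk c P (phi \o X) Y + e%:E)%E].
Proof.
move=> Y2 mphi phi_label e0 roo.
have kf := known_sobolev_fun mphi; set f := phi \o X in kf roo *.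
have mf := known_measurable_fun mZ kf.
have f_label w : labels c (f w) by apply: phi_label; exact: X_sobolev.
clearbody f.
case: c Y2 f_label roo {phi_label} => Y2 f_label roo.
  pose A : set T := f @^-1` [set 1].
  have kA : approximable P Z A.
    by have := kf measurableT _ (measurable_set1 1); rewrite setTI => /(known_measurable mZ).
  have [mA /(_ e e0)[N hN]] := kA.
  exists N => k /hN[C mC hC]; pose phik z : R := 2 * \1_C z - 1.
  have mphik : measurable_fun setT phik.
    apply: measurable_funB; last exact: measurable_cst.
    by apply: measurable_funM; [exact: measurable_cst|exact: measurable_indic].
  have phik1 z : C z -> phik z = 1.
    by move=> Cz; rewrite /phik indicE mem_set//= mulr1; lra.
  have phikN1 z : ~ C z -> phik z = -1.
    by move=> Cz; rewrite /phik indicE memNset//= mulr0 sub0r.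
  exists phik; split => //.
    by move=> z; have [/phik1 ->|/phikN1 ->] := pselect (C z); [right|left].
  have mC' := measurable_preimage mZ mC.
  have mE (g : T -> R) : measurable_fun setT g -> measurable [set w | g w <> Y w].
    move=> mg; rewrite (_ : [set w | _] = ~` ((g \- Y) @^-1` [set 0])).
      apply: measurableC; rewrite -[X in measurable X]setTI.
      by apply: measurable_funB.
    apply/seteqP; split => w /=; first by move=> h /eqP; rewrite subr_eq0 => /eqP.
    by move=> h gY; apply: h; rewrite gY subrr.
  have mg : measurable_fun setT (phik \o Z k) by exact: (measurableT_comp mphik (@mZ k)).
  rewrite /risk; apply: (@le_trans _ _ (P [set w | f w <> Y w] + P (symdiff A (Z k @^-1` C)))%E);
    last by apply: leeD => //; exact: ltW.
  have mS := measurable_symdiff mA mC'.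
  apply: le_trans (measureU2 _ (mE _ mf) mS).
  apply: le_measure; rewrite ?inE; [exact: mE|by apply: measurableU => //; exact: mE|].
  move=> w /= gY; have [fY|fY] := pselect (f w = Y w); last by left.
  right; move: gY; rewrite -fY; have [Cw|Cw] := pselect (C (Z k w)).
    by rewrite phik1// => h; right; split => // fw; apply: h; rewrite fw.
  by rewrite phikN1// => h; left; split => //; have [fw|//] := f_label w; case: h.
have fY : (mse P f Y < +oo)%E by move: roo; rewrite /risk unlock.
have f2 : (\int[P]_w ((f w ^+ 2)%:E) < +oo)%E.
  have := @mse_triangle _ _ _ P f Y (cst 0) mf (measurable_funPT Y) (measurable_cst _).
  rewrite {1 3}/mse; under eq_integral do rewrite /= subr0.
  under [X in (_ <= _ * (_ + X))%E]eq_integral do rewrite /= subr0.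
  move=> /le_lt_trans; apply.
  have Y2' := Y2 erefl.
  by apply: lte_mul_pinfty => //; rewrite ?lee_fin//; exact: lte_add_pinfty.
have fYfin : mse P f Y \is a fin_num by rewrite ge0_fin_numE ?mse_ge0.
pose M := fine (mse P f Y).
have M0 : 0 <= M by rewrite fine_ge0// mse_ge0.
(* (a + b)^2 <= (1 + dl) a^2 + (1 + 1/dl) b^2 *)
pose dl := e / (2 * (M + 1)).
have dl0 : 0 < dl by rewrite divr_gt0// mulr_gt0// ltr_wpDl.
pose et := e / (2 * (1 + dl^-1)).
have dli0 : 0 < dl^-1 by rewrite invr_gt0.
have et0 : 0 < et by rewrite divr_gt0// mulr_gt0// ltr_wpDl// ltW.
have [N hN] := known_L2 mZ kf f2 et0.
exists N => k /hN[g mg hg]; exists g; split => //.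
have mgZ : measurable_fun setT (g \o Z k) by exact: (measurableT_comp mg (@mZ k)).
rewrite /risk unlock.
have h1 : (mse P (g \o Z k) Y <=
    (1 + dl)%:E * mse P f Y + (1 + dl^-1)%:E * mse P f (g \o Z k))%E.
  rewrite /mse -!ge0_integralZl//; last 6 first.
  - exact: measurable_mse.
  - by move=> w _; rewrite lee_fin sqr_ge0.
  - by rewrite lee_fin addr_ge0// ltW.
  - exact: measurable_mse.
  - by move=> w _; rewrite lee_fin sqr_ge0.
  - by rewrite lee_fin addr_ge0// ltW.
  rewrite -ge0_integralD//; last 4 first.
  - by move=> w _; rewrite -EFinM lee_fin mulr_ge0 ?sqr_ge0// addr_ge0// ltW.
  - by apply: emeasurable_funM; [exact: measurable_cst|exact: measurable_mse].
  - by move=> w _; rewrite -EFinM lee_fin mulr_ge0 ?sqr_ge0// addr_ge0// ltW.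
  - by apply: emeasurable_funM; [exact: measurable_cst|exact: measurable_mse].
  apply: ge0_le_integral => //.
  - by move=> w _; rewrite lee_fin sqr_ge0.
  - exact: measurable_mse.
  - by apply: emeasurable_funD; (apply: emeasurable_funM; [exact: measurable_cst|exact: measurable_mse]).
  - move=> w _; rewrite -!EFinM -EFinD lee_fin /=.
    set a := f w - Y w; set b := f w - g (Z k w).
    have -> : g (Z k w) - Y w = a - b by rewrite /a /b; ring.
    have dd : dl * dl^-1 = 1 by rewrite mulfV// gt_eqF.
    have : 0 <= dl^-1 * (dl * a + b) ^+ 2 by rewrite mulr_ge0 ?sqr_ge0// ltW.
    rewrite (_ : dl^-1 * _ = (dl * dl^-1) * dl * a ^+ 2 + 2 * (dl * dl^-1) * a * b + dl^-1 * b ^+ 2);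
      last by ring.
    by rewrite dd; nra.
apply: (le_trans h1).
have gfin : mse P f (g \o Z k) \is a fin_num.
  by rewrite ge0_fin_numE ?mse_ge0// (lt_trans hg)// ltry.
rewrite -[X in (_ <= X + _)%E]/(mse P f Y).
move: hg; rewrite -(fineK fYfin) -(fineK gfin) -/M lte_fin => hg.
rewrite -!EFinM -!EFinD lee_fin.
have e2 : (1 + dl^-1) * et = e / 2.
  rewrite /et; field; rewrite gt_eqF//; lra.
have d2 : dl * (M + 1) = e / 2.
  rewrite /dl; field; rewrite gt_eqF//; lra.
have : (1 + dl^-1) * fine (mse P f (g \o Z k)) <= e / 2.
  by rewrite -e2; apply: ler_wpM2l; [lra|exact: ltW].
move: d2; nra.
Qed.

End Sampling.

(** * Limits of the risks *)

Section Optimal.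
Context {R : realType} d (T : measurableType d) (P : probability T R).
Variables (c : learning_problem) (Y : {RV P >-> R}).
Hypothesis Y2 : c = Regression -> (\int[P]_w ((Y w ^+ 2)%:E) < +oo)%E.

Lemma risk_ge0 (F : T -> R) : (0 <= risk c P F Y)%E.
Proof.
rewrite /risk; case: c => //; rewrite unlock; apply: integral_ge0 => w _.
by rewrite lee_fin sqr_ge0.
Qed.

(** The constant rule 1 has a finite risk. *)
Lemma optimal_risk_fin d' (E : measurableType d') (D : set E) (X : T -> E) :
  optimal_risk c P D X Y \is a fin_num.
Proof.
have L0 : (0 <= optimal_risk c P D X Y)%E.
  by apply: le_ereal_inf_tmp => _ [phi _ <-]; exact: risk_ge0.
rewrite ge0_fin_numE//.
apply: (@le_lt_trans _ _ (risk c P (cst 1) Y)).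
  apply: ereal_inf_lbound; exists (cst 1) => //; split; first exact: measurable_cst.
  by move=> x _; rewrite /labels; case: c => //=; right.
move: Y2; rewrite /risk; case: c => Y2'.
  have mA : measurable [set w | (cst 1 w : R) <> Y w].
    rewrite (_ : [set w | _] = ~` (Y @^-1` [set 1])).
      apply: measurableC; rewrite -[X in measurable X]setTI.
      exact: (measurable_funPT Y).
    by apply/seteqP; split => w /= h e; apply: h; rewrite e.
  by rewrite (le_lt_trans (probability_le1 _ mA))// ltry.
rewrite unlock; have := Y2' erefl; set i := integral _ _ _ => ioo.
have := @mse_triangle _ _ _ P (cst 1) (cst 0) Y (measurable_cst _) (measurable_cst _) (measurable_funPT Y).
move=> /le_lt_trans; apply.
have -> : mse P (cst 1) (cst 0) = 1%E.
  rewrite /mse; under eq_integral do rewrite /= subr0 expr1n.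
  by rewrite integral_cst//= mul1e; exact: probability_setT.
have -> : mse P (cst 0) Y = i.
  by rewrite /mse /i; apply: eq_integral => w _; rewrite /= sub0r sqrrN.
by rewrite lte_mul_pinfty// ?lee_fin// lte_add_pinfty// ltry.
Qed.

End Optimal.

Section SobolevTheorem.
Context {R : realType}.
Variables (c : learning_problem) (m : nat).
Variables (B : 'I_m.+1 -> (R -> R) -> R) (hB : boundary_operator B).
Variables (tau : nat -> seq R) (lam : nat -> R).
Hypothesis tau01 : forall d t, t \in tau d -> 0 <= t <= 1.
Hypothesis tau_incr : forall d, sorted <=%R (tau d).
Hypothesis lam_gt0 : forall d, 0 < lam d.
Context (disp : measure_display) (T : measurableType disp) (P : probability T R).
Variables (X : {RV P >-> sobolev_borel B}) (Y : {RV P >-> R}).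
Variables (Xs : nat -> {RV P >-> sobolev_borel B}) (Ys : nat -> {RV P >-> R}).
Hypothesis X_sobolev : forall w, sobolev m.+1 (X w).
Hypothesis Y_label : forall w, labels c (Y w).
Hypothesis Xs_sobolev : forall i w, sobolev m.+1 (Xs i w).
Hypothesis Ys_label : forall i w, labels c (Ys i w).
Hypothesis copies : independent_copies P
  (fun w => (X w, Y w)) (fun i w => (Xs i w, Ys i w)).
Hypothesis A1 : forall d, [/\ uniq (tau d), (m.+1 <= size (tau d))%N &
  independent_of_evaluations B (tau d)].
Hypothesis A2 : exists r : R, forall d, max_gap (tau d) / min_gap (tau d) <= r.
Hypothesis A3 : size (tau d) @[d --> \oo] --> \oo.
Hypothesis Y2 : c = Regression -> ('E_P[fun w => (Y w ^+ 2)%R] < +oo)%E.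
Variables (psi : @multivariate_scheme R).
Hypothesis psi_scheme : is_scheme c psi.
Hypothesis psi_consistent : consistent_scheme c psi.

Local Notation sob := (sobolev m.+1 : set (sobolev_borel B)).

Let Q d := spline_cholesky B (tau d) (lam d).

Let Q_unit d : Q d \in unitmx.
Proof.
have [u s i] := A1 d.
exact: (spline_cholesky_unit (@tau01 d) u s (lam_gt0 d) hB i).
Qed.

(** The transformed data. *)
Let K d (h : sobolev_borel B) : (size (tau d)).-tuple R := mulmx_tuple (Q d) (sample (tau d) h).

Let mK d : measurable_fun sob (K d).
Proof. exact: (measurable_transform hB (@tau01 d)). Qed.

(** The optimal risk among the rules that use the transformed samples. *)
Let risk_limit d : \bar R := optimal_risk c P setT (K d \o X) Y.

Let measurable_KX d (V : {RV P >-> sobolev_borel B}) : (forall w, sobolev m.+1 (V w)) ->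
  measurable_fun setT (K d \o V).
Proof. by move=> sV; exact: (@measurable_sampled _ _ _ _ _ P V sV _ _ (K d) (@mK d)). Qed.

(** For a fixed grid, consistency of the scheme in finite dimension. *)
Lemma expected_risk_cvg d :
  expected_risk c psi B (tau d) (lam d) P X Y Xs Ys n @[n --> \oo] --> risk_limit d.
Proof.
have [_ sz _] := A1 d; have p1 : (1 <= size (tau d))%N by exact: leq_trans sz.
pose U : {RV P >-> (size (tau d)).-tuple R} := HB.pack (K d \o X)
  (isMeasurableFun.Build _ _ _ _ (K d \o X) (@measurable_KX d X X_sobolev)).
pose Us i : {RV P >-> (size (tau d)).-tuple R} := HB.pack (K d \o Xs i)
  (isMeasurableFun.Build _ _ _ _ (K d \o Xs i) (@measurable_KX d (Xs i) (Xs_sobolev i))).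
have UVcopies : independent_copies P (fun w => (U w, Y w)) (fun i w => (Us i w, Ys i w)).
  (* outside H^m the transformation need not be measurable, and is replaced
     by a constant *)
  pose f (z : sobolev_borel B * R) := ((K d \_ sob) z.1, z.2).
  have mf : measurable_fun setT f.
    apply: measurable_fun_pair; last exact: measurable_snd.
    apply: (measurableT_comp _ measurable_fst).
    exact: (proj1 (measurable_restrictT (K d) (@measurable_sobolev R m B)) (@mK d)).
  have := independent_copies_map mf copies.
  rewrite (_ : f \o _ = fun w => (U w, Y w)); last first.
    by apply/funext => w; rewrite /f /= patchE mem_set//; exact: X_sobolev.
  rewrite (_ : (fun i => _) = fun i w => (Us i w, Ys i w))//.
  by apply/funext => i; apply/funext => w; rewrite /f /= patchE mem_set//; exact: Xs_sobolev.
have := psi_consistent p1 Y_label Ys_label Y2 UVcopies.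
rewrite -/(risk_limit d) (_ : (fun n => expected_risk _ _ _ _ _ _ _ _ _ _ _) = fun n =>
  risk c P (fun w => psi [tuple (Us i w, Ys i w) | i < n] (U w)) Y)//.
apply/funext => n; rewrite -(expected_conditional_risk psi_scheme n p1 Ys_label UVcopies).
apply: eq_integral => w _; congr (risk c P _ Y); apply/funext => w'.
rewrite /spline_rule; congr (psi _ _); apply: eq_from_tnth => i.
by rewrite !tnth_mktuple.
Qed.

(** A rule that uses the transformed samples is a rule on H^m. *)
Lemma optimal_le_risk_limit d : (optimal_risk c P sob X Y <= risk_limit d)%E.
Proof.
apply: le_ereal_inf_tmp => _ [phi [mphi phi_label] <-].
apply: ereal_inf_lbound; exists (phi \o K d) => //; split.
  by apply: (measurableT_comp mphi); exact: mK.
by move=> x _; exact: phi_label.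
Qed.

(** Rules of the samples are rules of the transformed samples, because the
    transformation is invertible. *)
Lemma risk_limit_le (e : R) : 0 < e -> exists N, forall d, (N <= d)%N ->
  (risk_limit d <= optimal_risk c P sob X Y + e%:E)%E.
Proof.
move=> e0; have e2 : 0 < e / 2 by rewrite divr_gt0.
have Y2' : c = Regression -> (\int[P]_w ((Y w ^+ 2)%:E) < +oo)%E.
  by move/Y2; rewrite unlock.
have Lfin := optimal_risk_fin Y2' sob X.
have [_ [phi [mphi phi_label] <-] hphi] := lb_ereal_inf_adherent e2 Lfin.
rewrite -/(optimal_risk c P sob X Y) in hphi.
have roo : (risk c P (phi \o X) Y < +oo)%E.
  by apply: (lt_trans hphi); rewrite -(fineK Lfin) -EFinD ltry.
have tau0 d : tau d != [::].
  by have [_ + _] := A1 d; case: (tau d).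
have gc : max_gap (tau d) @[d --> \oo] --> 0.
  by apply: max_gap_cvg => // d; have [] := A1 d.
have [N hN] := sampled_risk hB X_sobolev tau01 tau0 gc Y2' mphi phi_label e2 roo.
exists N => d /hN[phik [mphik phik_label hk]].
have : (risk_limit d <= risk c P (phik \o (fun w => sample (tau d) (X w))) Y)%E.
  apply: ereal_inf_lbound; exists (phik \o mulmx_tuple (invmx (Q d))).
    split; last by move=> x _; exact: phik_label.
    apply: measurableT_comp => //; exact: measurable_mulmx_tuple.
  by congr (risk c P _ Y); apply/funext => w; rewrite /= /K mulmx_tupleK ?Q_unit.
move=> /le_trans; apply; apply: (le_trans hk).
have -> : e%:E = ((e / 2)%:E + (e / 2)%:E)%E by rewrite -EFinD -splitr.
by rewrite addeA; apply: leeD => //; exact: ltW.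
Qed.

Lemma risk_limit_cvg : risk_limit d @[d --> \oo] --> optimal_risk c P sob X Y.
Proof.
have Y2' : c = Regression -> (\int[P]_w ((Y w ^+ 2)%:E) < +oo)%E.
  by move/Y2; rewrite unlock.
have Lfin := optimal_risk_fin Y2' sob X.
have lfin d : risk_limit d \is a fin_num by exact: optimal_risk_fin.
rewrite -(fineK Lfin); apply/fine_cvgP; split; first exact: nearW.
apply/cvgrPdist_le => e /risk_limit_le[N hN]; exists N => // d /= /hN.
have := optimal_le_risk_limit d; rewrite -(fineK Lfin) -(fineK (lfin d)) /= -EFinD !lee_fin => h1 h2.
by rewrite ler0_norm ?subr_le0// opprB lerBlDl.
Qed.

End SobolevTheorem.

Theorem theorem3 (R : realType) (c : learning_problem)
    (m : nat) (hm : (1 <= m)%N)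
    (B : 'I_m -> (R -> R) -> R) (hB : boundary_operator B)
    (tau : nat -> seq R) (lam : nat -> R)
    (tau01 : forall d t, t \in tau d -> 0 <= t <= 1)
    (tau_incr : forall d, sorted <=%R (tau d))
    (lam_gt0 : forall d, 0 < lam d)
    (disp : measure_display) (T : measurableType disp) (P : probability T R)
    (X : {RV P >-> sobolev_borel B}) (Y : {RV P >-> R})
    (Xs : nat -> {RV P >-> sobolev_borel B}) (Ys : nat -> {RV P >-> R})
    (X_sobolev : forall w, sobolev m (X w))
    (Y_label : forall w, labels c (Y w))
    (Xs_sobolev : forall i w, sobolev m (Xs i w))
    (Ys_label : forall i w, labels c (Ys i w))
    (copies : independent_copies P
       (fun w => (X w, Y w)) (fun i w => (Xs i w, Ys i w)))
    (A1 : forall d, [/\ uniq (tau d), (m <= size (tau d))%N &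
                        independent_of_evaluations B (tau d)])
    (A2 : exists r : R, forall d, max_gap (tau d) / min_gap (tau d) <= r)
    (A3 : size (tau d) @[d --> \oo] --> \oo /\
          lam d @[d --> \oo] --> (0 : R))
    (A4 : (c = Classification /\
            ('E_P[fun w => L2sqnorm (wderiv m (X w))] < +oo)%E) \/
          ((forall d, {subset tau d <= tau d.+1}) /\
            ('E_P[fun w => (Y w ^+ 2)%R] < +oo)%E))
    (psi : multivariate_scheme)
    (psi_scheme : is_scheme c psi) (psi_consistent : consistent_scheme c psi) :
  exists l : nat -> \bar R,
    (forall d, expected_risk c psi B (tau d) (lam d) P X Y Xs Ys n
                 @[n --> \oo] --> l d) /\
    l d @[d --> \oo] -->
      optimal_risk c P (sobolev m : set (sobolev_borel B)) X Y.
Proof.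
case: m hm B hB X Xs X_sobolev Xs_sobolev copies A1 A4 => // m _ B hB X Xs
  X_sobolev Xs_sobolev copies A1 A4.
(* the second moment only matters for regression, which excludes the first
   case of A4 *)
have Y2 : c = Regression -> ('E_P[fun w => (Y w ^+ 2)%R] < +oo)%E.
  by case: A4 => [[-> _]|[_]].
have [A3s _] := A3.
eexists; split.
  by move=> d; apply: expected_risk_cvg.
by apply: risk_limit_cvg.
Qed.
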